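(* Let $q$ be a prime power and let $n,s$ be two relatively prime positive integers. For $a,b\in\mathbb{F}_{q^{2n}}$ let $f_{a,b,s}$ be the $\mathbb{F}_q$-linear map $\mathbb{F}_{q^{2n}}\to\mathbb{F}_{q^{2n}}$, $x\mapsto x+ax^{q^s}+bx^{q^{n+s}}$. Suppose that \[ n\geq\begin{cases} 4s+2 & \text{if } q=3 \text{ and } s>1, \text{ or } q=2 \text{ and } s>2;\\ 4s+1 & \text{otherwise}.\end{cases} \] Then for every $\delta\in\mathbb{F}_{q^{2n}}^*$ with $\mathrm{N}_{q^{2n}/q^n}(\delta)\neq 1$ there exists $a\in\mathbb{F}_{q^{2n}}^*$ such that $\dim_{\mathbb{F}_q}\ker f_{a,b,s}=2$, where $b=\delta a$.
   Context: $\mathrm{N}_{q^{2n}/q^n}(x)=x^{q^n+1}$ denotes the norm from $\mathbb{F}_{q^{2n}}$ to $\mathbb{F}_{q^n}$. The kernel of $f_{a,b,s}$ is the $\mathbb{F}_q$-subspace of $x\in\mathbb{F}_{q^{2n}}$ with $f_{a,b,s}(x)=0$. *)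

(* Defs.v *)
From HB Require Import structures.
From mathcomp Require Import all_boot all_order all_algebra all_field.
Set Implicit Arguments. Unset Strict Implicit. Unset Printing Implicit Defensive.
Import GRing.Theory.
Local Open Scope ring_scope.

(* F_q = K (a finite field with q = #|K| elements, hence q a prime power),
   F_{q^{2n}} = L, a field extension of K of degree 2n. *)

Definition fabs (L : pzRingType) (q n s : nat) (a b : L) (x : L) : L :=
  x + a * x ^+ (q ^ s) + b * x ^+ (q ^ (n + s)).

(* norm from F_{q^{2n}} to F_{q^n} *)
Definition relnorm_q2n (L : pzRingType) (q n : nat) (x : L) : L := x ^+ (q ^ n + 1).

Definition nbound (q s : nat) : nat := (
  if ((q == 3)%N && (1 < s)%N) || ((q == 2)%N && (2 < s)%N) then 4 * s + 2 else 4 * s + 1)%N.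

(* Main.v *)
(** Write [Q = q^n], [e = q^s] and [g x = x^e + delta * x^(Q e)], so that the map is
    [x + a * g x].  Since the norm of [delta] is not 1, [g] vanishes only at 0; if
    [g x1 / x1 = g x2 / x2] with [x1 / x2] outside [F_Q], then [a := - x2 / g x2]
    gives a kernel spanned by [x1] and [x2]: a kernel element has coordinates in
    [F_Q] on this pair, and these are fixed by the [e]-power map, hence lie in [F_q].
    Such a pair amounts to [rho] of norm [D], the norm of [delta], and to [m] in
    [F_(Q^2)], not in [F_Q], and [b] in [F_Q^*], such that
    [m^e + rho * m^(Q e) = b^(e-1) * m * (1 + rho)].
    Assume that there is none.  Elements [rho] are then produced without collision by
    two families of quadratic equations [Y^2 - tau Y + nu = 0] with conjugate roots,
    indexed by [F_Q]; there are at most [Q + 1] elements of norm [D], whereas Weil's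
    bound for the discriminants (a quadratic character sum if [q] is odd, an
    Artin-Schreier sum if [q] is even) yields more of them as soon as [n >= 4 s + 1].
    Weil's bound is proved with Stepanov's method: Newton's identities make the sums
    over [F_(Q^k)] the power sums of finitely many numbers, and a nonzero polynomial of
    low degree vanishing on a level set of the character bounds them for all even [k]. *)

Require Import Defs.
From HB Require Import structures.
From mathcomp Require Import all_boot all_order all_algebra all_field.
From mathcomp Require Import ring lra zify.
Set Implicit Arguments. Unset Strict Implicit. Unset Printing Implicit Defensive.
Import Order.TTheory GRing.Theory Num.Theory.
Local Open Scope ring_scope.

(** One family would not suffice: the first one alone yields about [Q] elements [rho], which is
    compatible with the [Q + 1] elements of norm [D]. The second consists of the [rho] of norm [D]
    and trace [det_pol j]; each such [rho] comes from at most [q - 1] values of [j]. If [N1] and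
    [N2] count the solutions in the two families, then (q - 1) N1 + N2 <= (q - 1)(Q + 1), although
    [N1] and [N2] are both close to [Q]. The characters have conductors of degree [2 e] and
    [2 (e - 1)], so Weil's errors are (2 e - 1) sqrt Q and (2 e - 3) sqrt Q. With the weights
    [q - 1] and 1 they add up to (2 e q - q - 2) sqrt Q. Hence the decisive inequality is (2 e q - q
    - 1)^2 <= Q, and this is where [4 s + 1] comes from. Even extension degrees are singled out
    because the field then has [P ^ 2] elements with [P] a power of the characteristic: a [P]-th
    power taken twice is the identity on its points, and this keeps the degree in Stepanov's method
    low. Odd degrees then come for free, since a bound on the even power sums already bounds every
    reciprocal root. *)

(** * Frobenius powers in characteristic p *)

Lemma pnat_pos (pi : nat_pred) (n : nat) : pi.-nat n -> (0 < n)%N.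
Proof. by case/andP. Qed.

Definition frob (R : comNzRingType) (Q : nat) of [pchar R].-nat Q : R -> R :=
  fun x => x ^+ Q.

Section FrobMorphism.
Variables (R : comNzRingType) (Q : nat) (hQ : [pchar R].-nat Q).

Fact frob_is_nmod_morphism : nmod_morphism (frob hQ).
Proof.
split=> [|x y]; rewrite /frob; last exact: exprDn_pchar.
by rewrite expr0n; case: (Q) (pnat_pos hQ).
Qed.

Fact frob_is_monoid_morphism : monoid_morphism (frob hQ).
Proof. by split=> [|x y]; rewrite /frob ?expr1n ?exprMn. Qed.

HB.instance Definition _ :=
  GRing.isNmodMorphism.Build R R (frob hQ) frob_is_nmod_morphism.
HB.instance Definition _ :=
  GRing.isMonoidMorphism.Build R R (frob hQ) frob_is_monoid_morphism.

End FrobMorphism.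

Lemma pnat_natr0 (R : nzRingType) (Q : nat) :
  [pchar R].-nat Q -> (1 < Q)%N -> Q%:R = 0 :> R.
Proof.
move=> hQ Q1; have hp : pdiv Q \in [pchar R] by rewrite (pnatPpi hQ) ?pi_pdiv.
by apply/eqP; rewrite -(dvdn_pcharf hp) pdiv_dvd.
Qed.

Lemma exprp_inj (R : idomainType) (Q : nat) :
  [pchar R].-nat Q -> injective (fun x : R => x ^+ Q).
Proof.
move=> hQ x y /= e; apply/eqP; rewrite -subr_eq0.
have: frob hQ (x - y) == 0 by rewrite rmorphB /= /frob e subrr.
by rewrite /frob expf_eq0 => /andP[].
Qed.

Lemma exprBn_pcharW (R : comNzRingType) (Q : nat) (x y : R) :
  [pchar R].-nat Q -> (x - y) ^+ Q = x ^+ Q - y ^+ Q.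
Proof. exact: (fun hQ => rmorphB (frob hQ) x y). Qed.

Lemma exprNn_pcharW (R : comNzRingType) (Q : nat) (x : R) :
  [pchar R].-nat Q -> (- x) ^+ Q = - x ^+ Q.
Proof. exact: (fun hQ => rmorphN (frob hQ) x). Qed.

Lemma expr_sum_pchar (R : comNzRingType) (Q : nat) I (r : seq I) (F : I -> R) :
  [pchar R].-nat Q -> (\sum_(i <- r) F i) ^+ Q = \sum_(i <- r) F i ^+ Q.
Proof. by move=> hQ; have := rmorph_sum (frob hQ) r xpredT F. Qed.

Lemma expfix (R : nzRingType) (Q : nat) (x : R) (k : nat) :
  x ^+ Q = x -> x ^+ (Q ^ k) = x.
Proof. by move=> e; elim: k => // k IH; rewrite expnSr exprM IH. Qed.

Lemma pchar_poly_nat (R : nzRingType) (Q : nat) :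
  [pchar R].-nat Q -> [pchar {poly R}].-nat Q.
Proof.
by move=> hQ; rewrite (eq_pnat _ (@pchar_poly R)).
Qed.

(** * Finite fields and their polynomials inside one algebraically closed field *)

Section Fix.
Variable (W : closedFieldType).

Lemma closed_nth_root (n : nat) (a : W) : (0 < n)%N -> exists x, x ^+ n = a.
Proof.
move=> n0; have /closed_rootP[x] : size ('X^n - a%:P) != 1.
  by rewrite size_XnsubC // eqSS -lt0n.
by rewrite /root !hornerE subr_eq0 => /eqP <-; exists x.
Qed.

(** This list plays the role of F_P. All the fields F_(Q^k) are thus subsets of a single [W], and
    sums over them are sums over lists. *)
Definition fixs (P : nat) : seq W := sval (closed_field_poly_normal ('X^P - 'X : {poly W})).

Section P.
Variables (P : nat) (hP : [pchar W].-nat P) (P1 : (1 < P)%N).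

Lemma fixs_prod : 'X^P - 'X = \prod_(z <- fixs P) ('X - z%:P) :> {poly W}.
Proof.
rewrite /fixs; case: closed_field_poly_normal => r /= e; rewrite {1}e.
suff -> : lead_coef ('X^P - 'X : {poly W}) = 1 by rewrite scale1r.
by rewrite lead_coefDl ?lead_coefXn // size_polyN size_polyX size_polyXn ltnS.
Qed.

Lemma mem_fixs x : (x \in fixs P) = (x ^+ P == x).
Proof. by rewrite -root_prod_XsubC -fixs_prod /root !hornerE subr_eq0. Qed.

Lemma size_fixs : size (fixs P) = P.
Proof.
apply: succn_inj; rewrite -(size_prod_XsubC _ id) -fixs_prod.
by rewrite size_polyDl ?size_polyXn // size_polyN size_polyX ltnS.
Qed.

Lemma uniq_fixs : uniq (fixs P).
Proof.
rewrite -separable_prod_XsubC -fixs_prod unlock derivB derivXn derivX.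
rewrite -mulr_natl (pnat_natr0 (pchar_poly_nat hP) P1) mul0r sub0r.
by rewrite -(scaleN1r 1) coprimepZr ?coprimep1 // oppr_eq0 oner_eq0.
Qed.
End P.

(** Membership in F_Q[X], as a boolean; [finvP] restates it as invariance under Frobenius, from
    which all closure properties follow. *)
Definition finv (Q : nat) (g : {poly W}) := all (fun c => c ^+ Q == c) g.

Section Finv.
Variables (Q : nat) (hQ : [pchar W].-nat Q).

Lemma finv_map g : finv Q g = (map_poly (frob hQ) g == g).
Proof.
apply/allP/eqP => [h | e].
  apply/polyP => i; rewrite coef_map /= /frob.
  have [ltig|] := ltnP i (size g); first by apply/eqP/h/mem_nth.
  by move=> le; rewrite nth_default // expr0n; case: (Q) (pnat_pos hQ).
by move=> x /(nthP 0)[i _ <-]; rewrite -[X in _ == X](congr1 (fun g : {poly W} => g`_i) e) coef_map.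
Qed.

Lemma finvP g : reflect (map_poly (frob hQ) g = g) (finv Q g).
Proof. by rewrite finv_map; apply: eqP. Qed.

Lemma finvC c : c ^+ Q = c -> finv Q c%:P.
Proof. by move=> e; apply/finvP; rewrite map_polyC /= /frob e. Qed.
Lemma finvX : finv Q 'X. Proof. by apply/finvP; rewrite map_polyX. Qed.
Lemma finvD g h : finv Q g -> finv Q h -> finv Q (g + h).
Proof. by move=> /finvP eg /finvP eh; apply/finvP; rewrite rmorphD /= eg eh. Qed.
Lemma finvN g : finv Q g -> finv Q (- g).
Proof. by move=> /finvP eg; apply/finvP; rewrite rmorphN /= eg. Qed.
Lemma finvB g h : finv Q g -> finv Q h -> finv Q (g - h).
Proof. by move=> /finvP eg /finvP eh; apply/finvP; rewrite rmorphB /= eg eh. Qed.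
Lemma finvM g h : finv Q g -> finv Q h -> finv Q (g * h).
Proof. by move=> /finvP eg /finvP eh; apply/finvP; rewrite rmorphM /= eg eh. Qed.
Lemma finvXn g k : finv Q g -> finv Q (g ^+ k).
Proof. by move=> /finvP eg; apply/finvP; rewrite rmorphXn /= eg. Qed.
Lemma finv_modp g h : finv Q g -> finv Q h -> finv Q (g %% h).
Proof. by move=> /finvP eg /finvP eh; apply/finvP; rewrite map_modp eg eh. Qed.
Lemma finv_divp g h : finv Q g -> finv Q h -> finv Q (g %/ h).
Proof. by move=> /finvP eg /finvP eh; apply/finvP; rewrite map_divp eg eh. Qed.
Lemma finv_deriv g : finv Q g -> finv Q g^`().
Proof. by move=> /finvP eg; apply/finvP; rewrite -deriv_map eg. Qed.
Lemma finv_horner g x : finv Q g -> g.[x] ^+ Q = g.[x ^+ Q].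
Proof.
by move=> /finvP eg; rewrite -{2}eg; apply/esym/(horner_map (frob hQ)).
Qed.
Lemma finv_coef g i : finv Q g -> g`_i ^+ Q = g`_i.
Proof. by move=> /finvP eg; rewrite -{2}eg coef_map. Qed.
End Finv.
End Fix.

(** * Characteristic polynomials of elements of F_(Q^k) *)

Section OrbitPoly.
Variables (W : closedFieldType) (Q : nat).
Hypotheses (hQ : [pchar W].-nat Q) (Q1 : (1 < Q)%N).
Implicit Types (x : W) (f g : {poly W}).

(** For [x] in F_(Q^k) this is the characteristic polynomial over F_Q, a power of the minimal
    polynomial when [x] lies in a smaller field. *)
Definition orbit_poly k x : {poly W} :=
  \prod_(z <- [seq x ^+ (Q ^ j) | j <- iota 0 k]) ('X - z%:P).

Lemma orbit_poly_monic k x : orbit_poly k x \is monic.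
Proof. exact: monic_prod_XsubC. Qed.

Lemma size_orbit_poly k x : size (orbit_poly k x) = k.+1.
Proof. by rewrite size_prod_XsubC size_map size_iota. Qed.

Lemma root_orbit_poly k x : (0 < k)%N -> root (orbit_poly k x) x.
Proof. by case: k => // k _; rewrite root_prod_XsubC /= inE expn0 expr1 eqxx. Qed.

Lemma orbit_polyD e k x : x ^+ (Q ^ e) = x ->
  orbit_poly (e + k) x = orbit_poly e x * orbit_poly k x.
Proof.
move=> ex; rewrite /orbit_poly iotaD map_cat big_cat /=; congr (_ * _).
rewrite -[e in iota (0 + e)]addn0 add0n iotaDl -map_comp.
by congr (\prod_(z <- _) _); apply: eq_map => j /=; rewrite expnD exprM ex.
Qed.

Lemma finv_orbit_poly k x : x ^+ (Q ^ k) = x -> finv Q (orbit_poly k x).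
Proof.
move=> ex; apply/(finvP hQ); rewrite rmorph_prod /= big_map.
under eq_bigr do rewrite rmorphB /= map_polyX map_polyC /= /frob -exprM -expnSr.
rewrite /orbit_poly big_map; case: k ex => [|k] ex; first by rewrite !big_nil.
rewrite -{1}[k.+1]addn1 iotaD big_cat /= big_cons big_nil mulr1.
rewrite add0n ex mulrC [RHS]big_cons expn0 expr1; congr (_ * _).
by rewrite -[1%N]addn0 iotaDl big_map.
Qed.

Lemma finv_root_orbit f x k : finv Q f -> root f x -> root f (x ^+ (Q ^ k)).
Proof.
move=> hf rx; elim: k => [|k IH]; first by rewrite expn0.
rewrite expnSr exprM /root -(finv_horner hQ) // (rootP IH) expr0n.
by case: (Q) (pnat_pos hQ).
Qed.

Lemma expQk_inj k : injective (fun x => x ^+ (Q ^ k)).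
Proof. by apply: exprp_inj; rewrite pnatX hQ. Qed.

Lemma root_period f x : f != 0 -> finv Q f -> root f x ->
  exists2 e, (0 < e)%N & x ^+ (Q ^ e) == x.
Proof.
move=> f0 hf rx; pose s := [seq x ^+ (Q ^ j) | j <- iota 0 (size f)].
have : ~~ uniq s.
  apply/negP => us; have := max_poly_roots f0 _ us.
  rewrite size_map size_iota ltnn => h; suff: false by []; apply: h.
  by apply/allP => _ /mapP[j _ ->]; apply: finv_root_orbit.
case/(uniqPn 0) => i [j] [ltij]; rewrite size_map size_iota => ltj.
have lti := ltn_trans ltij ltj.
rewrite !(nth_map 0%N) ?size_iota // !nth_iota // !add0n => e.
exists (j - i)%N; first by rewrite subn_gt0.
apply/eqP; apply: (@expQk_inj i) => /=; rewrite -exprM -expnD subnK //.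
exact: ltnW.
Qed.

(* By induction on the degree: if [e] is the period of a root [x], the orbit
   polynomial of [x] splits off [f], and this shifts the admissible [k] by [e]. *)
Lemma sum_orbit_poly_dvd x N f : f \is monic -> finv Q f ->
  (size f <= N.+1)%N ->
  (\sum_(1 <= k < N.+1) ((x ^+ (Q ^ k) == x) && (orbit_poly k x %| f)%R) = mup x f)%N.
Proof.
elim: {f}(size f) {-2}f (leqnn (size f)) N => [|m IH] f.
  by rewrite leqn0 size_poly_eq0 => /eqP -> N; rewrite monicE lead_coef0 eq_sym oner_eq0.
move=> lem N mf hf leN; have f0 := monic_neq0 mf.
have [rx|nrx] := boolP (root f x); last first.
  rewrite mupNroot // big_nat big1 // => k /andP[k1 _].
  case: eqP => //= _; case: (boolP (_ %| _)) => // dv.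
  have := root_orbit_poly x k1; rewrite -dvdp_XsubCl => /dvdp_trans/(_ dv).
  by rewrite dvdp_XsubCl (negbTE nrx).
have [e0 e00 ee0] := root_period f0 hf rx.
have exE : exists e, (0 < e)%N && (x ^+ (Q ^ e) == x) by exists e0; rewrite e00.
case: (ex_minnP exE) => e /andP[e1 /eqP ex] emin {e0 e00 ee0 exE}.
pose s := [seq x ^+ (Q ^ j) | j <- iota 0 e].
(* Minimality of the period [e] makes the orbit repetition-free, so [x] is a simple root of its
   orbit polynomial and the multiplicity drops by exactly one. *)
have us : uniq s.
  apply/negPn/negP; case/(uniqPn 0) => i [j] [ltij]; rewrite size_map size_iota => ltj.
  have lti := ltn_trans ltij ltj.
  rewrite !(nth_map 0%N) ?size_iota // !nth_iota // !add0n => E.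
  have := emin (j - i)%N; rewrite subn_gt0 ltij /= => h.
  suff /h : x ^+ (Q ^ (j - i)) == x.
    by apply/negP; rewrite -ltnNge (leq_ltn_trans _ ltj) // leq_subr.
  by apply/eqP; apply: (@expQk_inj i) => /=; rewrite -exprM -expnD subnK // ltnW.
have dvf : orbit_poly e x %| f.
  apply: (@uniq_roots_dvdp W f s); rewrite ?uniq_rootsE //.
  by apply/allP => _ /mapP[j _ ->]; apply: finv_root_orbit.
have mo := orbit_poly_monic e x; have o0 := monic_neq0 mo.
pose f' := f %/ orbit_poly e x; have ff' : f = orbit_poly e x * f' by rewrite mulrC divpK.
have mf' : f' \is monic by move: mf; rewrite ff' monicMl.
have hf' : finv Q f' by apply: finv_divp => //; apply: finv_orbit_poly.
have f'0 := monic_neq0 mf'.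
have sf : size f = (size f' + e)%N by rewrite ff' size_monicM // size_orbit_poly addSn addnC.
have eN : (e <= N)%N.
  by rewrite -ltnS; apply: leq_trans leN; rewrite sf -add1n leq_add2r size_poly_gt0.
have -> : mup x f = (mup x f').+1.
  have xs : x \in s by apply/mapP; exists 0%N; rewrite ?mem_iota // expn0 expr1.
  by rewrite ff' mupM // mu_prod_XsubC -/s count_uniq_mem // xs.
(* Indices below [e] contribute nothing, [k = e] contributes 1, and the later ones are those of [f']
   shifted by [e]. *)
rewrite (big_cat_nat (n := e)) ?leqW //= [X in (X + _)%N]big_nat big1 ?add0n; last first.
  move=> k /andP[k1 ke]; case: eqP => // E; have := emin k; rewrite k1 E eqxx => /(_ isT).
  by rewrite leqNgt ke.
rewrite big_ltn ?ltnS // ex eqxx dvf /= add1n; congr _.+1.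
rewrite -[e.+1]add1n big_addn -(IH f' _ (N - e)%N) //; last 2 first.
- by rewrite -ltnS; apply: leq_trans lem; rewrite sf -addn1 leq_add2l.
- by rewrite -(leq_add2r e) -sf addSn subnK.
rewrite -subSn //; apply: eq_bigr => k _; rewrite addnC orbit_polyD // expnD exprM ex.
by rewrite ff' dvdp_mul2l.
Qed.

End OrbitPoly.

Lemma perm_map_self (T : eqType) (s : seq T) (f : T -> T) :
  uniq s -> {in s &, injective f} -> {in s, forall x, f x \in s} ->
  perm_eq (map f s) s.
Proof.
move=> us fi fs; have ums : uniq (map f s) by rewrite map_inj_in_uniq.
apply: uniq_perm => //.
have sub : {subset map f s <= s} by move=> _ /mapP[x xs ->]; apply: fs.
by have [] := uniq_min_size ums sub; rewrite ?size_map.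
Qed.

Lemma sum_count_mem (T : eqType) (V s : seq T) :
  uniq V -> {subset s <= V} -> (\sum_(x <- V) count_mem x s = size s)%N.
Proof.
move=> uV; elim: s => [|z s IH] sub /=; first by rewrite big1.
rewrite big_split /= IH => [|x xs]; last by apply: sub; rewrite inE xs orbT.
rewrite -add1n; congr (_ + _)%N.
have <- : count_mem z V = 1%N by rewrite count_uniq_mem // sub ?mem_head.
by rewrite -sum1_count [RHS]big_mkcond; apply: eq_bigr => x _ /=; rewrite eq_sym; case: eqP.
Qed.

(** * Character sums over monic polynomials, and their L-series *)

Section FinvPolys.
Variables (W : closedFieldType) (Q : nat).
Hypotheses (hQ : [pchar W].-nat Q) (Q1 : (1 < Q)%N).
Implicit Types (x : W) (f g : {poly W}).

Fixpoint finv_polys d : seq {poly W} :=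
  if d is d'.+1 then [seq c%:P + 'X * g | c <- fixs W Q, g <- finv_polys d']
  else [:: 0].

Lemma mem_finv_polys d g : (g \in finv_polys d) = (size g <= d)%N && finv Q g.
Proof.
elim: d g => [|d IH] g /=.
  rewrite inE leqn0 size_poly_eq0; case: eqP => // ->.
  by rewrite /finv polyseq0.
apply/allpairsP/andP => [[[c h] /= []]|[sg hg]].
  rewrite mem_fixs // IH => /eqP ec /andP[sh hh] ->; split.
    rewrite (leq_trans (size_polyD _ _)) // geq_max.
    rewrite (leq_trans (size_polyC_leq1 c)) //= mulrC.
    by rewrite (leq_trans (size_polyMleq _ _)) // size_polyX addn2.
  by apply: finvD => //; [apply: finvC | apply: finvM => //; apply: finvX].
have hc : g`_0 ^+ Q = g`_0 by apply: finv_coef.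
have dv : 'X %| g - (g`_0)%:P.
  by have := dvdp_XsubCl (g - (g`_0)%:P) 0; rewrite subr0 => ->; rewrite /root !hornerE horner_coef0 subrr.
exists (g`_0, (g - (g`_0)%:P) %/ 'X); split => /=; last first.
- by rewrite mulrC divpK // addrC subrK.
- rewrite IH; apply/andP; split; last first.
    by apply: finv_divp => //; [apply: finvB => //; apply: finvC | apply: finvX].
  rewrite size_divp ?polyX_eq0 // size_polyX leq_subLR add1n.
  rewrite (leq_trans (size_polyD _ _)) // size_polyN geq_max sg.
  exact: leq_trans (size_polyC_leq1 _) _.
- by rewrite mem_fixs // hc.
Qed.

Lemma uniq_finv_polys d : uniq (finv_polys d).
Proof.
elim: d => //= d IH; apply: allpairs_uniq => //; first exact: uniq_fixs.
move=> [c g] [c' g'] _ _ /= e.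
have ec : c = c'.
  by have /(congr1 (fun h => h.[0])) := e; rewrite !(hornerE, mul0r, addr0).
by congr (_, _) => //; move: e; rewrite ec => /addrI/mulfI; apply; rewrite polyX_eq0.
Qed.

Definition finv_monics d := [seq 'X^d + g | g <- finv_polys d].

Lemma uniq_finv_monics d : uniq (finv_monics d).
Proof. by rewrite map_inj_uniq ?uniq_finv_polys //; apply: addrI. Qed.

Lemma mem_finv_monics d g :
  (g \in finv_monics d) = [&& g \is monic, size g == d.+1 & finv Q g].
Proof.
apply/mapP/and3P => [[h]|[mg /eqP sg hg]].
  rewrite mem_finv_polys => /andP[sh hh] ->; have lt : (size h < size ('X^d : {poly W}))%N by rewrite size_polyXn ltnS.
  rewrite monicE lead_coefDl // lead_coefXn eqxx size_polyDl // size_polyXn eqxx.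
  by split=> //; apply: finvD => //; apply: finvXn => //; apply: finvX.
exists (g - 'X^d); last by rewrite addrC subrK.
rewrite mem_finv_polys; apply/andP; split; last first.
  by apply: finvB => //; apply: finvXn => //; apply: finvX.
apply/leq_sizeP => i; rewrite leq_eqVlt => /predU1P[<-|lti].
  rewrite coefB coefXn eqxx; move: mg; rewrite monicE lead_coefE sg => /eqP ->.
  by rewrite subrr.
by rewrite coefB coefXn nth_default ?sg // gtn_eqF // subrr.
Qed.

(** Separates the low [D] coefficients [l] from the rest: for fixed [h] the sum over [l] runs over a
    full residue system modulo a monic polynomial of degree [D]. *)
Lemma big_finv_polysD (R : nmodType) (phi : {poly W} -> R) D j :
  \sum_(g <- finv_polys (D + j)) phi g =
  \sum_(h <- finv_polys j) \sum_(l <- finv_polys D) phi (l + 'X^D * h).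
Proof.
elim: D phi => [|D IH] phi.
  by rewrite add0n; apply: eq_bigr => h _; rewrite big_seq1 add0r expr0 mul1r.
rewrite addSn [LHS]big_allpairs_dep; under eq_bigr do rewrite IH.
rewrite exchange_big; apply: eq_bigr => h _; rewrite [RHS]big_allpairs_dep.
apply: eq_bigr => c _; apply: eq_bigr => l _; congr phi.
by rewrite mulrDr addrA mulrA -exprS.
Qed.

Section Character.
Variables (chi : {poly W} -> int) (M g0 : {poly W}) (D : nat).
Hypotheses (chiM : {in finv Q &, {morph chi : g h / g * h}}).
Hypotheses (mM : M \is monic) (hM : finv Q M) (sM : size M = D.+1).
Hypotheses (chi_mod : {in finv Q, forall g, chi (g %% M) = chi g}).
Hypotheses (hg0 : finv Q g0) (chi_g0 : chi g0 = -1) (co_g0 : coprimep g0 M).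

Let M0 : M != 0. Proof. exact: monic_neq0. Qed.

Lemma size_modM g : (size (g %% M)%R <= D)%N.
Proof. by rewrite -ltnS -sM ltn_modp. Qed.

(** Multiplication by [g0], a unit modulo [M], permutes the residues and reverses the sign of [chi],
    so the sum equals its own opposite. *)
Lemma sum_residues0 : \sum_(g <- finv_polys D) chi g = 0.
Proof.
have P : perm_eq [seq (g0 * g) %% M | g <- finv_polys D] (finv_polys D).
  apply: perm_map_self; first exact: uniq_finv_polys.
    move=> g h; rewrite !mem_finv_polys => /andP[sg _] /andP[sh _] /eqP.
    rewrite -subr_eq0 -modpN -modpD -mulrBr -/(M %| _) Gauss_dvdpr 1?coprimep_sym //.
    move=> dv; apply/eqP; rewrite -subr_eq0; apply/negPn/negP => nz.
    have := dvdp_leq nz dv; rewrite sM ltnNge.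
    by rewrite (leq_trans (size_polyD _ _)) // size_polyN geq_max sg.
  move=> g; rewrite !mem_finv_polys => /andP[sg hg]; rewrite size_modM.
  by apply: finv_modp => //; apply: finvM.
set S := \sum_(g <- _) _; suff e : S = - S.
  by apply/eqP; have := mulrn_eq0 S 2; rewrite mulr2n {1}e addNr eqxx.
rewrite {1}/S -(perm_big _ P) big_map /= /S -sumrN big_seq [RHS]big_seq.
apply: eq_bigr => g; rewrite mem_finv_polys => /andP[_ hg].
by rewrite chi_mod ?chiM ?chi_g0 ?mulN1r //; apply: finvM.
Qed.

Lemma sum_shifted_residues0 c : finv Q c -> \sum_(l <- finv_polys D) chi (l + c) = 0.
Proof.
move=> hc; have P : perm_eq [seq l + (c %% M) | l <- finv_polys D] (finv_polys D).
  apply: perm_map_self; [exact: uniq_finv_polys | by move=> ? ? _ _ /addIr |].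
  move=> g; rewrite !mem_finv_polys => /andP[sg hg].
  rewrite (leq_trans (size_polyD _ _)) ?geq_max ?sg ?size_modM //=.
  by apply: finvD => //; apply: finv_modp.
rewrite -[RHS]sum_residues0 -[RHS](perm_big _ P) big_map big_seq [RHS]big_seq.
apply: eq_bigr => g; rewrite mem_finv_polys => /andP[sg hg].
rewrite -[LHS]chi_mod; last exact: finvD.
by rewrite modpD (@modp_small _ g) // sM ltnS.
Qed.

(** This makes the L-series of [chi] a polynomial of degree less than [D]: with the high
    coefficients fixed, the low ones sweep all residues modulo [M], shifted by a constant. *)
Lemma sum_monics0 d : (D <= d)%N -> \sum_(g <- finv_monics d) chi g = 0.
Proof.
move=> leD; rewrite big_map -(subnKC leD) big_finv_polysD big_seq big1 // => h.
rewrite mem_finv_polys => /andP[_ hh].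
under eq_bigr do rewrite addrCA.
by apply: sum_shifted_residues0; rewrite finvD ?finvM ?finvXn ?finvX.
Qed.

End Character.

Section Newton.
Variable chi : {poly W} -> int.
Hypotheses (chiM : {in finv Q &, {morph chi : g h / g * h}}).

(** [monic_sum] gives the coefficients of the L-series L(T) of [chi], and [orbit_sum] those of T
    L'(T) / L(T). *)
Definition monic_sum d := \sum_(g <- finv_monics d) chi g.
Definition orbit_sum k := \sum_(x <- fixs W (Q ^ k)) chi (orbit_poly Q k x).

Let hQk k : [pchar W].-nat (Q ^ k)%N. Proof. by rewrite pnatX hQ. Qed.
Let Qk1 k : (0 < k)%N -> (1 < Q ^ k)%N. Proof. by move=> k0; rewrite -(expn0 Q) ltn_exp2l. Qed.

Lemma monic_sum0 : chi 1 = 1 -> monic_sum 0 = 1.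
Proof. by move=> c1; rewrite /monic_sum /finv_monics big_seq1 expr0 addr0. Qed.

Lemma perm_monics_dvd h k d : h \in finv_monics k -> (k <= d)%N ->
  perm_eq [seq h * g | g <- finv_monics (d - k)] [seq f <- finv_monics d | h %| f].
Proof.
rewrite mem_finv_monics => /and3P[mh /eqP sh hh] le; have h0 := monic_neq0 mh.
apply: uniq_perm; rewrite ?filter_uniq ?uniq_finv_monics //.
  by rewrite map_inj_uniq ?uniq_finv_monics //; apply: mulfI.
move=> f; rewrite mem_filter; apply/mapP/andP => [[g]|[dv]].
  rewrite !mem_finv_monics => /and3P[mg /eqP sg hg] ->; split; first by rewrite dvdp_mulr.
  rewrite monicMl // mg finvM //= size_monicM ?monic_neq0 // sh sg addSn /= addnS.
  by rewrite subnKC // eqxx.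
rewrite mem_finv_monics => /and3P[mf /eqP sf hf].
exists (f %/ h); last by rewrite mulrC divpK.
have e : f = h * (f %/ h) by rewrite mulrC divpK.
have mg : f %/ h \is monic by move: mf; rewrite {1}e monicMl.
by rewrite mem_finv_monics mg finv_divp // size_divp // sf sh subSn //= eqxx.
Qed.

(** By [sum_orbit_poly_dvd] each [x] is counted as often as it is a root of [f], and the
    multiplicities add up to the degree. *)
Lemma sum_orbit_dvd d f : f \in finv_monics d ->
  (\sum_(1 <= k < d.+1) \sum_(x <- fixs W (Q ^ k)) (orbit_poly Q k x %| f)%R = d)%N.
Proof.
rewrite mem_finv_monics => /and3P[mf /eqP sf hf].
pose V := undup (flatten [seq fixs W (Q ^ k) | k <- index_iota 1 d.+1]).
have uV : uniq V by apply: undup_uniq.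
have inV x k : (0 < k < d.+1)%N -> x ^+ (Q ^ k) == x -> x \in V.
  move=> kd ex; rewrite mem_undup; apply/flattenP; exists (fixs W (Q ^ k)).
    by apply: map_f; rewrite mem_index_iota.
  by rewrite mem_fixs ?Qk1 //; case/andP: kd.
transitivity (\sum_(x <- V) mup x f)%N; last first.
  have [rs] := closed_field_poly_normal f; rewrite (monicP mf) scale1r => ef.
  have <- : size rs = d by apply: succn_inj; rewrite -sf ef size_prod_XsubC.
  rewrite -(sum_count_mem uV); first by apply: eq_bigr => x _; rewrite ef mu_prod_XsubC.
  move=> x xrs; apply/negPn/negP => xV.
  have : (0 < mup x f)%N by rewrite ef mu_prod_XsubC -has_count has_pred1.
  rewrite -(sum_orbit_poly_dvd hQ x mf hf (N := d)) ?sf //.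
  rewrite big_nat big1 // => k kd; case: eqP => //= /eqP/(inV _ _ kd).
  by rewrite (negbTE xV).
have e k : (0 < k < d.+1)%N -> (\sum_(x <- fixs W (Q ^ k)) (orbit_poly Q k x %| f)%R =
    \sum_(x <- V) ((x ^+ (Q ^ k) == x) && (orbit_poly Q k x %| f)%R))%N.
  move=> kd; have k0 : (0 < k)%N by case/andP: kd.
  rewrite [RHS](eq_bigr (fun x => if x ^+ (Q ^ k) == x then nat_of_bool (orbit_poly Q k x %| f)%R else 0%N)).
    rewrite -[RHS]big_mkcond -[RHS]big_filter; apply: perm_big; apply: uniq_perm.
    - by apply: uniq_fixs; rewrite ?Qk1.
    - exact: filter_uniq.
    - move=> x; rewrite mem_filter mem_fixs ?Qk1 //.
      by case: eqP => //= /eqP/(inV _ _ kd) ->.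
  by move=> x _; case: eqP.
under eq_big_nat => k kd do rewrite (e k kd).
rewrite exchange_big; apply: eq_bigr => x _.
by apply: sum_orbit_poly_dvd; rewrite ?sf.
Qed.

(** The identity T L' = L * (T L' / L), read off coefficientwise. By multiplicativity, each term on
    the right is a sum of [chi f] over the multiples [f] of an orbit polynomial, and every [f] is
    reached [d] times. *)
Lemma newton_monic_sum d :
  d%:R * monic_sum d = \sum_(1 <= k < d.+1) orbit_sum k * monic_sum (d - k).
Proof.
have e k : (0 < k < d.+1)%N -> orbit_sum k * monic_sum (d - k) =
    \sum_(f <- finv_monics d) \sum_(x <- fixs W (Q ^ k)) chi f *+ (orbit_poly Q k x %| f)%R.
  case/andP=> k0; rewrite ltnS => kd; rewrite exchange_big mulr_suml /=.
  rewrite big_seq [RHS]big_seq; apply: eq_bigr => x.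
  rewrite mem_fixs ?Qk1 // => /eqP ex; rewrite mulr_sumr.
  have ho : finv Q (orbit_poly Q k x) by apply: finv_orbit_poly.
  have mo : orbit_poly Q k x \in finv_monics k.
    by rewrite mem_finv_monics orbit_poly_monic size_orbit_poly eqxx.
  transitivity (\sum_(f <- finv_monics d | orbit_poly Q k x %| f) chi f).
    rewrite -[RHS]big_filter -(perm_big _ (perm_monics_dvd mo kd)) [RHS]big_map /=.
    rewrite big_seq [RHS]big_seq; apply: eq_bigr => g.
    by rewrite mem_finv_monics => /and3P[_ _ hg]; rewrite chiM.
  by rewrite big_mkcond; apply: eq_bigr => f _; case: (_ %| _).
under eq_big_nat => k kd do rewrite (e k kd).
rewrite exchange_big mulr_sumr /= big_seq [RHS]big_seq; apply: eq_bigr => f hf.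
under eq_bigr do rewrite sumrMnr.
by rewrite sumrMnr (sum_orbit_dvd hf) mulr_natl.
Qed.

End Newton.

End FinvPolys.

(** * Newton's identities and the size of the reciprocal roots *)

(* Newton's identities, as a congruence modulo ['X^N.+1]: the telescoping
   [(1 - w X) * \sum_(1 <= k <= N) (w X)^k = w X - (w X)^N.+1] drives the
   induction on the list of roots. *)
Lemma newton_congr (R : comNzRingType) (ws : seq R) (N : nat) :
  let r := \prod_(w <- ws) (1 - w *: 'X) in
  exists h, 'X * r^`() + (\sum_(1 <= k < N.+1) (\sum_(w <- ws) w ^+ k) *: 'X^k) * r
     = 'X^(N.+1) * h.
Proof.
elim: ws => [|w ws [h IH]] /=.
  exists 0; rewrite big_nil derivC !mulr0 add0r mulr1 big1 // => k _.
  by rewrite big_nil scale0r.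
rewrite big_cons; set r := \prod_(_ <- _) _ in IH *.
pose t := \sum_(1 <= k < N.+1) (w *: 'X : {poly R}) ^+ k.
have et : (1 - w *: 'X) * t = w *: 'X - (w *: 'X) ^+ N.+1.
  rewrite /t; elim: (N) => [|m IHm]; first by rewrite big_geq // mulr0 expr1 subrr.
  by rewrite big_nat_recr //= mulrDr IHm [in RHS]exprS; ring.
have -> : \sum_(1 <= k < N.+1) (\sum_(j <- w :: ws) j ^+ k) *: 'X^k =
   t + \sum_(1 <= k < N.+1) (\sum_(w <- ws) w ^+ k) *: 'X^k.
  by rewrite -big_split; apply: eq_bigr => k _; rewrite big_cons scalerDl exprZn.
set p := \sum_(1 <= k < N.+1) _ in IH *.
exists ((1 - w *: 'X) * h - w ^+ N.+1 *: r).
have -> : ((1 - w *: 'X) * r)^`() = - w%:P * r + (1 - w *: 'X) * r^`().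
  by rewrite derivM derivB derivZ derivX derivC sub0r alg_polyC.
have eX : w *: 'X = w%:P * 'X by rewrite mul_polyC.
have -> : w ^+ N.+1 *: r = w%:P ^+ N.+1 * r by rewrite -mul_polyC polyC_exp.
transitivity ((1 - w *: 'X) * ('X * r^`() + p * r) - w%:P * 'X * r + ((1 - w *: 'X) * t) * r); first by ring.
by rewrite et IH eX exprMn; ring.
Qed.

Lemma newton_power_sums (R : comNzRingType) (ws : seq R) (d : nat) :
  let r := \prod_(w <- ws) (1 - w *: 'X) in
  d%:R * r`_d + \sum_(1 <= k < d.+1) (\sum_(w <- ws) w ^+ k) * r`_(d - k) = 0.
Proof.
move=> r; have [h] := newton_congr ws d; rewrite -/r => /(congr1 (fun p : {poly R} => p`_d)).
rewrite coefD coefXM coef_deriv coefXnM ltnSn mulr_suml coef_sum => e.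
rewrite -[RHS]e; congr (_ + _).
  by case: (d) => [|m] /=; rewrite ?mul0r // mulr_natl.
rewrite [LHS]big_nat [RHS]big_nat; apply: eq_bigr => k /andP[_ kd].
by rewrite -scalerAl coefZ coefXnM ltnNge -ltnS kd.
Qed.

(** A polynomial [p] vanishing at all the other values isolates [c * y0 ^+ k] as a fixed combination
    of power sums; this stays bounded in [k], whereas [|y0| > 1] would force growth by Bernoulli's
    inequality. *)
Lemma bounded_power_sums (s : seq algC) (K : algC) :
  (forall k, (0 < k)%N -> `|\sum_(y <- s) y ^+ k| <= K) ->
  {in s, forall y, `|y| <= 1}.
Proof.
move=> hK y0 ys; pose p := \prod_(z <- undup s | z != y0) ('X - z%:P).
pose c := (count_mem y0 s)%:R * p.[y0].
have ep k : \sum_(y <- s) p.[y] * y ^+ k = c * y0 ^+ k.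
  rewrite (bigID (pred1 y0)) /= [X in _ + X]big_seq_cond [X in _ + X]big1 ?addr0; last first.
    move=> y /andP[yin yn]; rewrite (_ : p.[y] = 0) ?mul0r //; apply/rootP.
    by rewrite /p -big_filter root_prod_XsubC mem_filter yn mem_undup.
  rewrite (eq_bigr (fun=> p.[y0] * y0 ^+ k)) => [|y /eqP -> //].
  by rewrite big_const_seq iter_addr_0 -mulr_natl mulrA.
have c0 : c != 0.
  rewrite mulf_neq0 ?pnatr_eq0 -?lt0n -?has_count ?has_pred1 //.
  by rewrite -/(root _ _) /p -big_filter root_prod_XsubC mem_filter eqxx.
pose K' := \sum_(i < size p) `|p`_i| * K.
have bk k : (0 < k)%N -> `|c| * `|y0| ^+ k <= K'.
  move=> k0; rewrite -normrX -normrM -ep.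
  under eq_bigr do rewrite horner_coef mulr_suml.
  rewrite exchange_big (le_trans (ler_norm_sum _ _ _)) // ler_sum // => i _.
  under eq_bigr do rewrite -mulrA -exprD.
  by rewrite -mulr_sumr normrM ler_wpM2l // hK // addn_gt0 k0 orbT.
rewrite real_leNgt ?realE ?normr_ge0 ?ler01 //; apply/negP => y1.
have cp : 0 < `|c| by rewrite normr_gt0.
pose e := `|y0| - 1; have e0 : 0 < e by rewrite subr_gt0.
have K'0 : 0 <= K' by apply: le_trans (bk 1%N isT); rewrite mulr_ge0 ?exprn_ge0.
have bern k : 1 + k%:R * e <= `|y0| ^+ k.
  elim: k => [|k IHk]; first by rewrite mul0r addr0 expr0.
  have ey : `|y0| = 1 + e by rewrite /e addrC subrK.
  rewrite exprSr; apply: le_trans (ler_wpM2r _ IHk) => //; rewrite ey.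
  rewrite -subr_ge0 (_ : _ - _ = k%:R * e ^+ 2); last by rewrite -natr1; ring.
  by rewrite mulr_ge0 ?exprn_ge0 // ltW.
have q0 : 0 <= K' / (`|c| * e) by rewrite divr_ge0 // mulr_ge0 // ltW.
have [k hk] : exists k, K' / (`|c| * e) < k%:R.
  exists (Num.bound (K' / (`|c| * e))).
  by rewrite archi_boundP.
have k0 : (0 < k)%N.
  by rewrite lt0n; apply/eqP => ke; move: (le_lt_trans q0 hk); rewrite ke ltxx.
move: hk; rewrite ltr_pdivrMr ?mulr_gt0 // => hk.
suff : K' < K' by rewrite ltxx.
apply: (lt_le_trans hk); apply: le_trans (bk k k0).
rewrite mulrCA ler_wpM2l ?(ltW cp) // (le_trans _ (bern k)) //.
by rewrite lerDr.
Qed.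

(* The sums [S k] are minus the power sums of the reciprocal roots of the
   polynomial with coefficients [C i]. *)
Lemma weil_from_newton (C S : nat -> int) (D Q : nat) (K : nat) :
  (0 < Q)%N -> C 0%N = 1 -> (forall d, (D <= d)%N -> C d = 0) ->
  (forall d, d%:R * C d = \sum_(1 <= k < d.+1) S k * C (d - k)%N) ->
  (forall k, (0 < k)%N -> `|S k.*2| <= (K * Q ^ k)%N%:R) ->
  S 1%N ^+ 2 <= (D.-1 ^ 2 * Q)%N%:R.
Proof.
move=> Q0 C0 CD newtonC bS.
have D0 : (0 < D)%N by case: D CD => // /(_ 0%N isT); rewrite C0.
pose r : {poly algC} := \poly_(i < D) (C i)%:~R.
have rE i : r`_i = (C i)%:~R.
  by rewrite coef_poly; case: ltnP => // /CD ->.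
have rE0 : r`_0 = 1 by rewrite rE C0.
have r0 : r != 0.
  by apply/eqP => e; move: rE0; rewrite e coef0 => /eqP; rewrite eq_sym oner_eq0.
have [rs er] := closed_field_poly_normal r.
have rsn0 z : z \in rs -> z != 0.
  move=> zrs; apply/eqP => z0; have : root r 0.
    by rewrite er rootZ ?lead_coef_eq0 // root_prod_XsubC -z0.
  by rewrite /root horner_coef0 rE0 oner_eq0.
pose ws := [seq z^-1 | z <- rs].
have rw : r = \prod_(w <- ws) (1 - w *: 'X).
  have e0 : lead_coef r * \prod_(z <- rs) (- z) = 1.
    rewrite -[RHS]rE0 -[RHS]horner_coef0 [in RHS]er hornerZ horner_prod.
    by congr (_ * _); apply: eq_bigr => z _; rewrite !hornerE.
  rewrite er big_map (eq_big_seq (fun z => (- z)%:P * (1 - z^-1 *: 'X))); last first.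
    move=> z /rsn0 z0; rewrite mulrBr mulr1 -mul_polyC mulrA -polyCM mulNr divff //.
    by rewrite !polyCN mulN1r opprK addrC.
  by rewrite big_split /= -rmorph_prod mul_polyC scalerA e0 scale1r.
have sws : (size ws <= D.-1)%N.
  have : (size r <= D)%N by apply: size_poly.
  rewrite size_map er size_scale ?lead_coef_eq0 // size_prod_XsubC.
  by case: (D) D0.
pose p k := \sum_(w <- ws) w ^+ k.
have ep k : (0 < k)%N -> (S k)%:~R = - p k.
  elim/ltn_ind: k => k IH k0.
  have := newton_power_sums ws k; rewrite /= -rw.
  have := congr1 (fun z : int => z%:~R : algC) (newtonC k).
  rewrite rmorphM /= rmorph_nat -rE => ->; rewrite rmorph_sum /=.
  rewrite !(big_nat_recr k) //= subnn rmorphM /= C0 rE0 !mulr1.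
  set a := \sum_(1 <= i < k) _; set b := \sum_(1 <= i < k) _.
  have -> : b = - a.
    rewrite /a /b -sumrN !big_nat; apply: eq_bigr => i /andP[i1 ik].
    by rewrite rmorphM /= IH // rE mulNr opprK.
  move=> /eqP; rewrite addrACA subrr add0r addr_eq0 => /eqP //.
have q0 : (Q%:R : algC) != 0 by rewrite pnatr_eq0 -lt0n.
(* Only the sums with even index are bounded, so the boundedness criterion is applied to the numbers
   [w ^+ 2 / Q]. *)
have bw : {in ws, forall w, `|w| <= sqrtC Q%:R}.
  move=> w wws; have : `|w ^+ 2 / Q%:R| <= 1.
    apply: (@bounded_power_sums [seq z ^+ 2 / Q%:R | z <- ws] K%:R) => [k k0|]; last first.
      by apply/mapP; exists w.
    rewrite big_map.
    under eq_bigr do rewrite expr_div_n -exprM mul2n.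
    rewrite -mulr_suml normrM normfV normrX normr_nat ler_pdivrMr ?exprn_gt0 ?ltr0n //.
    have -> : \sum_(i <- ws) i ^+ k.*2 = - (S k.*2)%:~R by rewrite ep ?double_gt0 // opprK.
    have := bS k k0; rewrite -(ler_int algC) normrN -natrX -natrM intr_norm.
    by rewrite rmorph_nat.
  rewrite normrM normfV normr_nat normrX ler_pdivrMr ?ltr0n // mul1r.
  by rewrite -{1}(sqrtCK Q%:R) ler_pXn2r ?nnegrE ?sqrtC_ge0 ?ler0n.
have b1 : `|(S 1%N)%:~R : algC| <= D.-1%:R * sqrtC Q%:R.
  rewrite ep // normrN (le_trans (ler_norm_sum _ _ _)) //.
  rewrite big_seq (le_trans (ler_sum _ (G := fun=> sqrtC Q%:R) _)) => [//|w ww|].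
    by rewrite expr1 bw.
  rewrite -big_seq big_const_seq iter_addr_0 count_predT -[_ *+ size ws]mulr_natl.
  by rewrite ler_wpM2r ?sqrtC_ge0 ?ler0n // ler_nat.
rewrite -(ler_int algC) rmorphXn /= -[X in X ^+ 2 <= _]/((S 1%N)%:~R : algC).
rewrite -real_normK ?realz //.
apply: le_trans (_ : (D.-1%:R * sqrtC Q%:R) ^+ 2 <= _).
  by rewrite ler_pXn2r ?nnegrE ?normr_ge0 ?mulr_ge0 ?sqrtC_ge0 ?ler0n.
by rewrite [X in _ <= X]rmorph_nat natrM natrX exprMn sqrtCK.
Qed.

(** * Weil's bound for an abstract real character modulo [M] *)

Lemma coprimep_roots (W : closedFieldType) (f g : {poly W}) : f != 0 ->
  (forall x, root f x -> ~~ root g x) -> coprimep f g.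
Proof.
move=> f0 h; rewrite /coprimep; apply/negPn/negP => /closed_rootP[x].
by rewrite root_gcd => /andP[/h /negbTE ->].
Qed.

Lemma finv_expn (W : closedFieldType) (Q j : nat) (g : {poly W}) :
  finv Q g -> finv (Q ^ j) g.
Proof. by move/allP => h; apply/allP => c /h /eqP /expfix ->. Qed.

Lemma coprimep_orbit_poly (W : closedFieldType) (Q k : nat) (M : {poly W}) (x : W) :
  [pchar W].-nat Q -> finv Q M -> (0 < k)%N ->
  coprimep (orbit_poly Q k x) M = ~~ root M x.
Proof.
move=> hQ hM k0; apply/idP/idP => [co|nr].
  have r : root (orbit_poly Q k x) x by apply: root_orbit_poly.
  by rewrite /root (coprimep_root co r).
apply: coprimep_roots => [|y]; first by rewrite monic_neq0 ?orbit_poly_monic.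
rewrite root_prod_XsubC => /mapP[j _ ->]; apply: contra nr.
have hj : [pchar W].-nat (Q ^ j)%N by rewrite pnatX hQ.
by rewrite /root -(finv_horner hj) ?finv_expn // expf_eq0 => /andP[].
Qed.

Section WeilCharacter.
Variables (W : closedFieldType) (Q : nat).
Hypotheses (hQ : [pchar W].-nat Q) (Q1 : (1 < Q)%N).
Variables (chi : {poly W} -> int) (M : {poly W}) (D K : nat).
Hypotheses (chi1 : chi 1 = 1) (chiM : {in finv Q &, {morph chi : g h / g * h}}).
Hypotheses (mM : M \is monic) (hM : finv Q M) (sM : size M = D.+1) (D0 : (0 < D)%N).
Hypotheses (chi_mod : {in finv Q, forall g, chi (g %% M) = chi g}).
Hypotheses (chi_val : {in finv Q, forall g, chi g \in [:: 0; 1; -1]}).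
Hypotheses (chi_neq0 : {in finv Q, forall g, (chi g != 0) = coprimep g M}).
Hypothesis chi_bound : forall k, (0 < k)%N ->
  `|orbit_sum Q chi k.*2| <= (K * Q ^ k)%N%:R.

(* If [chi] never took the value [-1], its sum over [fixs W (Q ^ k.*2)] would be
   at least [Q ^ k.*2 - D], against [chi_bound]. *)
Lemma nontrivial_chi : exists2 g0, finv Q g0 & chi g0 = -1.
Proof.
(* With this [k], [K + D < Q ^ k], hence [Q ^ k.*2 - D] exceeds [K * Q ^ k]. *)
pose k := (K + D).+1; pose s := fixs W (Q ^ k.*2).
have hQk : [pchar W].-nat (Q ^ k.*2)%N by rewrite pnatX hQ.
have Qk1 : (1 < Q ^ k.*2)%N by rewrite -(expn0 Q) ltn_exp2l.
have [/hasP[x xs /eqP e]|no] := boolP (has (fun x => chi (orbit_poly Q k.*2 x) == -1) s).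
  exists (orbit_poly Q k.*2 x) => //; apply: finv_orbit_poly => //.
  by apply/eqP; move: xs; rewrite /s mem_fixs.
have c x : x \in s -> chi (orbit_poly Q k.*2 x) = (~~ root M x)%:R.
  move=> xs; have hx : finv Q (orbit_poly Q k.*2 x).
    by apply: finv_orbit_poly => //; apply/eqP; move: xs; rewrite /s mem_fixs.
  have cop : coprimep (orbit_poly Q k.*2 x) M = ~~ root M x by apply: coprimep_orbit_poly.
  have := chi_val hx; rewrite !inE (negbTE (hasPn no _ xs)) orbF.
  by have := chi_neq0 hx; rewrite cop => <-; case/orP => /eqP ->.
have us : uniq s by apply: uniq_fixs.
have := chi_bound (k := k) isT; rewrite /orbit_sum -/s (eq_big_seq _ c) -natr_sum normr_nat.
rewrite ler_nat (_ : (\sum_(x <- s) _)%N = count (predC (root M)) s); last first.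
  by rewrite -sum1_count [RHS]big_mkcond; apply: eq_bigr => x _ /=; case: root.
have cM : (count (root M) s <= D)%N.
  rewrite -ltnS -sM -size_filter max_poly_roots ?monic_neq0 ?filter_uniq //.
  by apply/allP => x; rewrite mem_filter => /andP[].
have := count_predC (root M) s; rewrite size_fixs // -addnn expnD.
have lt : (K + D < Q ^ k)%N by apply: ltn_trans (ltn_expl _ Q1).
have := leq_mul lt (leqnn (Q ^ k)); nia.
Qed.

Lemma weil_character : (\sum_(x <- fixs W Q) chi ('X - x%:P)) ^+ 2 <= (D.-1 ^ 2 * Q)%N%:R.
Proof.
have [g0 hg0 eg0] := nontrivial_chi.
have co0 : coprimep g0 M by rewrite -chi_neq0 // eg0.
have -> : \sum_(x <- fixs W Q) chi ('X - x%:P) = orbit_sum Q chi 1.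
  by rewrite /orbit_sum expn1; apply: eq_bigr => x _; rewrite /orbit_poly big_seq1 expn0 expr1.
apply: (@weil_from_newton (monic_sum Q chi) _ _ _ K) => //; first exact: ltnW.
- exact: monic_sum0.
- move=> d; exact: (sum_monics0 hQ Q1 chiM mM hM sM chi_mod hg0 eg0 co0).
- by move=> d; apply: newton_monic_sum.
Qed.
End WeilCharacter.

(** * Stepanov's method *)

Lemma poly_lin_dep (F : fieldType) (I : finType) (p : I -> {poly F}) (E : nat) :
  (forall t, (size (p t) <= E)%N) -> (E < #|I|)%N ->
  exists2 c : I -> F, (exists t, c t != 0) & \sum_t c t *: p t = 0.
Proof.
move=> sp ltE; pose A := \matrix_(t < #|I|, k < E) (p (enum_val t))`_k.
have : kermx A != 0.
  rewrite kermx_eq0 /row_free neq_ltn; apply/orP; left.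
  by apply: leq_ltn_trans (rank_leq_col A) ltE.
case/rowV0Pn => v /sub_kermxP vA v0; exists (fun t => v 0 (enum_rank t)).
  have [k vk] : exists k, v 0 k != 0.
    apply/existsP; apply: contraNT v0 => /existsPn h.
    by apply/eqP/rowP => k; rewrite mxE; apply/eqP; move: (h k); rewrite negbK.
  by exists (enum_val k); rewrite enum_valK.
apply/polyP => k; rewrite coef0 coef_sum.
have [ltk|lek] := ltnP k E; last first.
  by rewrite big1 // => t _; rewrite coefZ nth_default ?mulr0 ?(leq_trans (sp t)).
have /rowP/(_ (Ordinal ltk)) := vA; rewrite !mxE => e; rewrite -[RHS]e.
rewrite (reindex (@enum_val I xpredT)) /=; last exact/onW_bij/enum_val_bij.
by apply: eq_bigr => t _; rewrite coefZ !mxE enum_valK.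
Qed.

(* With [G := \sum_i 'X^(i * P) * (a i * e + b i * s)] and [x ^+ (P ^ 2) = x],
   [G.[x] ^+ P * u1.[x]] is the value at [x] of [e ^+ P] times
   [\sum_i 'X^i * (a i ^+ P * u1 + b i ^+ P * u2)], which is arranged to be the
   zero polynomial by counting coefficients. *)
Lemma stepanov (W : closedFieldType) (P : nat) (u1 u2 e s : {poly W}) (h l m : nat)
    (good : seq W) :
  [pchar W].-nat P ->
  (size u1 <= h.+1)%N -> (size u2 <= h.+1)%N ->
  (size e <= h.+1)%N -> (size s <= h.+1)%N ->
  (m + l * P + h < 2 * m * l)%N ->
  (forall a b : nat -> {poly W},
     (forall i, (size (a i) <= l)%N) -> (forall i, (size (b i) <= l)%N) ->
     \sum_(i < m) 'X^(i * P) * (a i * e + b i * s) = 0 ->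
     forall i, (i < m)%N -> a i = 0 /\ b i = 0) ->
  uniq good ->
  {in good, forall x, [/\ x ^+ (P ^ 2) = x, u1.[x] != 0 &
     s.[x] ^+ P * u1.[x] = e.[x] ^+ P * u2.[x]]} ->
  (size good <= m * P + l + h)%N.
Proof.
move=> hP su1 su2 se ss dim nonvan ug hg; have P0 := pnat_pos hP.
pose I : finType := (bool * ('I_m * 'I_l))%type.
pose p (t : I) : {poly W} := 'X^(t.2.1 + t.2.2 * P) * (if t.1 then u1 else u2).
have sp t : (size (p t) <= m + l * P + h)%N.
  case: t => [b [i j]]; rewrite /p /= (leq_trans (size_polyMleq _ _)) // size_polyXn.
  have su : (size (if b then u1 else u2) <= h.+1)%N by case: b.
  have ij : (i + j * P < m + l * P)%N.
    by rewrite -addSn leq_add // leq_mul2r ltnW ?ltn_ord ?orbT.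
  by move: su ij; set z := size _; lia.
(* The unknowns are the [2 * m * l] coefficients of the [a i] and [b i]; the equations are the
   coefficients of a polynomial of size at most [m + l * P + h]. *)
have cI : (m + l * P + h < #|I|)%N by rewrite card_prod card_bool card_prod !card_ord mulnA.
have [c [[b0 [i0 j0]] c0] ec] := poly_lin_dep sp cI.
have rt (z : W) : exists y, y ^+ P == z.
  by have [y <-] := closed_nth_root z P0; exists y.
(* The vanishing condition [cond] is linear in the coefficients of [a i ^+ P], not of [a i]; the
   linear system is solved for these [P]-th powers and roots are extracted afterwards. *)
pose d (t : I) := xchoose (rt (c t)); have dP t : d t ^+ P = c t by apply/eqP; exact: (xchooseP (rt (c t))).
pose a b (i : nat) : {poly W} :=
  if insub i is Some k then \poly_(j < l) (if insub j is Some j' then d (b, (k, j')) else 0) else 0.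
have sa b i : (size (a b i) <= l)%N.
  by rewrite /a; case: insub => [k|]; rewrite ?size_poly // size_poly0.
have aE b (i : 'I_m) : a b i = \sum_(j < l) d (b, (i, j)) *: 'X^j.
  rewrite /a valK poly_def; apply: eq_bigr => j _.
  by rewrite valK.
have aP b (i : 'I_m) : a b i ^+ P = \sum_(j < l) c (b, (i, j)) *: 'X^(j * P).
  rewrite aE expr_sum_pchar ?pchar_poly_nat //; apply: eq_bigr => j _.
  by rewrite exprZn dP exprM.
have cond : \sum_(i < m) 'X^i * (a true i ^+ P * u1 + a false i ^+ P * u2) = 0.
  rewrite -[RHS]ec (eq_bigr (fun t : I => c (t.1, (t.2.1, t.2.2)) *: p (t.1, (t.2.1, t.2.2)))); last by case=> [b [i j]].
  rewrite -(pair_bigA _ (fun b q => c (b, (q.1, q.2)) *: p (b, (q.1, q.2)))) /=.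
  rewrite big_bool /= -!(pair_bigA _ (fun i j => c (_, (i, j)) *: p (_, (i, j)))) /=.
  rewrite -big_split /=; apply: eq_bigr => i _; rewrite !aP mulrDr !mulr_suml !mulr_sumr.
  by congr (_ + _); apply: eq_bigr => j _; rewrite /p /= exprD -!scalerAl -scalerAr mulrA.
pose G := \sum_(i < m) 'X^(i * P) * (a true i * e + a false i * s).
have G0 : G != 0.
  apply/eqP => /(nonvan (a true) (a false) (sa _) (sa _))/(_ i0 (ltn_ord i0)) [z1 z2].
  case/negP: c0; rewrite -dP expf_eq0 P0 /=.
  have : a b0 i0 = 0 by case: (b0).
  move/(congr1 (fun q : {poly W} => q`_j0)); rewrite coef0 /a valK coef_poly ltn_ord valK.
  by move=> ->.
have sG : (size G <= m * P + l + h)%N.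
  apply: leq_trans (size_sum _ _ _) _; apply/bigmax_leqP => i _.
  apply: leq_trans (size_polyMleq _ _) _; rewrite size_polyXn addSn /=.
  have ale b (r : {poly W}) : (size r <= h.+1)%N -> (size (a b i * r)%R <= l + h)%N.
    move=> sr; apply: leq_trans (size_polyMleq _ _) _.
    by have := sa b i; move: sr; lia.
  have : (size (a true i * e + a false i * s)%R <= l + h)%N.
    by rewrite (leq_trans (size_polyD _ _)) // geq_max !ale.
  have : (i * P <= m * P)%N by rewrite leq_mul2r ltnW ?ltn_ord ?orbT.
  by rewrite -addnA => h1 h2; apply: leq_add.
have rG : all (root G) good.
  apply/allP => x /hg[xP u1x us]; rewrite /root.
  have : G.[x] ^+ P * u1.[x] == 0.
    have /(congr1 (fun q : {poly W} => e.[x] ^+ P * q.[x])) := cond.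
    rewrite horner0 mulr0 => ez; apply/eqP; rewrite -[RHS]ez !horner_sum.
    rewrite expr_sum_pchar // mulr_suml mulr_sumr; apply: eq_bigr => i _.
    rewrite !(hornerE, horner_exp) exprMn exprDn_pchar // !exprMn -!exprM.
    have -> : x ^+ (i * P * P) = x ^+ i by rewrite -mulnA mulnC exprM xP.
    transitivity (x ^+ i * ((a true i).[x] ^+ P * (e.[x] ^+ P * u1.[x]) + (a false i).[x] ^+ P * (s.[x] ^+ P * u1.[x]))); first by ring.
    by rewrite us /=; ring.
  by rewrite mulf_eq0 (negbTE u1x) orbF expf_eq0 => /andP[].
have := max_poly_roots G0 rG ug; move/ltnW => lt; exact: leq_trans lt sG.
Qed.

Lemma eq0_XnM_size (R : idomainType) (P : nat) (q h : {poly R}) :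
  q = 'X^P * h -> (size q <= P)%N -> q = 0.
Proof.
move=> -> sq; have [->|h0] := eqVneq h 0; first by rewrite mulr0.
have h1 : (0 < size h)%N by rewrite size_poly_gt0.
by move: sq; rewrite size_monicM ?monicXn // size_polyXn addSn /= -[X in (_ <= X)%N]addn0 leq_add2l leqNgt h1.
Qed.

(** Modulo 'X^P a [P]-th power is constant, because [f - f.[0]] is divisible by 'X. This turns
    algebraic relations with [P]-th powers into relations of low degree. *)
Lemma expr_pchar_modX (R : comNzRingType) (P : nat) (f : {poly R}) :
  [pchar R].-nat P -> exists h, f ^+ P = (f.[0] ^+ P)%:P + 'X^P * h.
Proof.
move=> hP; have [h e] : exists h, f - f.[0]%:P = h * 'X.
  have /factor_theorem[h e] : root (f - f.[0]%:P) 0 by rewrite /root !hornerE subrr.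
  by exists h; rewrite e subr0.
exists (h ^+ P); rewrite mulrC -exprMn -e exprBn_pcharW ?pchar_poly_nat //.
by rewrite polyC_exp addrC subrK.
Qed.

(** Peels off one index at a time: the terms with [i > 0] are absorbed into the multiples [A] and
    [B] of 'X^P, and once [a 0] and [b 0] vanish the relation is divided by 'X^P. *)
Lemma nonvan_of_first (R : idomainType) (P l : nat) (e s : {poly R}) :
  (forall a b A B : {poly R}, (size a <= l)%N -> (size b <= l)%N ->
    (a + 'X^P * A) * e + (b + 'X^P * B) * s = 0 -> a = 0 /\ b = 0) ->
  forall (m : nat) (a b : nat -> {poly R}),
     (forall i, (size (a i) <= l)%N) -> (forall i, (size (b i) <= l)%N) ->
     \sum_(i < m) 'X^(i * P) * (a i * e + b i * s) = 0 ->
     forall i, (i < m)%N -> a i = 0 /\ b i = 0.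
Proof.
move=> first; elim=> [|m IH] // a b sa sb z.
have sum1 (c : nat -> {poly R}) r : \sum_(i < m) 'X^(i.+1 * P) * (c i.+1 * r) =
    'X^P * (\sum_(i < m) 'X^(i * P) * c i.+1) * r.
  rewrite mulr_sumr mulr_suml; apply: eq_bigr => i _.
  by rewrite mulSn exprD !mulrA.
have [a0 b0] : a 0%N = 0 /\ b 0%N = 0.
  apply: (first (a 0%N) (b 0%N) (\sum_(i < m) 'X^(i * P) * a i.+1)
    (\sum_(i < m) 'X^(i * P) * b i.+1)) => //.
  rewrite -[RHS]z big_ord_recl mul0n expr0 mul1r; under [in RHS]eq_bigr do rewrite mulrDr.
  by rewrite big_split /= !sum1; ring.
case=> [|i] // im; apply: (IH (fun i => a i.+1) (fun i => b i.+1)) => //.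
move: z; rewrite big_ord_recl /= a0 b0 !mul0r addr0 mulr0 add0r => z.
apply/eqP; rewrite -(mulrI_eq0 _ (lregP (_ : 'X^P != 0))) ?monic_neq0 ?monicXn //.
rewrite -[X in _ == X]z mulr_sumr; apply/eqP; apply: eq_bigr => j _.
by rewrite mulrA -exprD -mulSn.
Qed.

Lemma stepanov_half (W : closedFieldType) (P D : nat) (u1 u2 e s : {poly W})
    (good : seq W) :
  [pchar W].-nat P -> (2 * D + 8 <= P)%N ->
  (size u1 <= (D * P).+1)%N -> (size u2 <= (D * P).+1)%N ->
  (size e <= (D * P).+1)%N -> (size s <= (D * P).+1)%N ->
  (forall a b A B : {poly W}, (size a <= (P - D)./2)%N -> (size b <= (P - D)./2)%N ->
    (a + 'X^P * A) * e + (b + 'X^P * B) * s = 0 -> a = 0 /\ b = 0) ->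
  uniq good ->
  {in good, forall x, [/\ x ^+ (P ^ 2) = x, u1.[x] != 0 &
     s.[x] ^+ P * u1.[x] = e.[x] ^+ P * u2.[x]]} ->
  (2 * size good <= P ^ 2 + (6 * D + 10) * P)%N.
Proof.
move=> hP ltP su1 su2 se ss first ug hg.
(* [l] leaves room for [D] extra degrees when [a] and [b] are squared, so that comparisons modulo
   'X^P become equalities. The dimension condition m (2 l - 1) > (l + D) P then forces [m] to exceed
   [P / 2] by a multiple of [D]; [2 * D + 4] is enough. *)
pose l := (P - D)./2; pose m := (P./2 + 2 * D + 4)%N.
have [l4 l2] : (P + 4 <= 4 * l)%N /\ (2 * l <= P)%N by rewrite /l; lia.
have [m1 m2] : (P + 4 * D + 7 <= 2 * m)%N /\ (2 * m <= P + 4 * D + 8)%N by rewrite /m; lia.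
have dim : (m + l * P + D * P < 2 * m * l)%N.
  have h1 : ((P + 4 * D + 7) * l <= 2 * m * l)%N by rewrite leq_mul2r m1 orbT.
  have h2 : ((4 * D + 7) * (P + 4) <= (4 * D + 7) * (4 * l))%N by rewrite leq_mul2l l4 orbT.
  nia.
have := stepanov hP su1 su2 se ss dim (@nonvan_of_first _ P l e s first m) ug hg.
have : (2 * m * P <= (P + 4 * D + 8) * P)%N by rewrite leq_mul2r m2 orbT.
nia.
Qed.

(* Both signs occur at most half of the time up to [O(P)], and they occur together
   outside a set of at most [D] points. *)
Lemma sign_sum_bound (W : closedFieldType) (P D : nat) (T : W -> int) (s : seq W) :
  size s = (P ^ 2)%N -> (0 < P)%N ->
  {in s, forall x, T x \in [:: 0; 1; -1]} ->
  (count (fun x => T x == 0%R) s <= D)%N ->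
  ((2 * D + 8 <= P)%N ->
     (2 * count (fun x => T x == 1%R) s <= P ^ 2 + (6 * D + 10) * P)%N /\
     (2 * count (fun x => T x == (-1)%R) s <= P ^ 2 + (6 * D + 10) * P)%N) ->
  `|\sum_(x <- s) T x| <= ((7 * D + 10) * P)%N%:R.
Proof.
move=> sz P0 hT h0 hb.
have [eS eC] : \sum_(x <- s) T x =
    (count (fun x => T x == 1%R) s)%:R - (count (fun x => T x == (-1)%R) s)%:R /\
  (count (fun x => T x == 0%R) s + count (fun x => T x == 1%R) s
     + count (fun x => T x == (-1)%R) s = size s)%N.
  elim: (s) hT => [|x r IH] hT /=; first by rewrite big_nil subrr.
  have [|e1 e2] := IH; first by move=> y yr; apply: hT; rewrite inE yr orbT.
  have := hT x (mem_head _ _); rewrite big_cons e1 -e2 !inE => /or3P[] /eqP ->.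
  - by rewrite add0r; split=> //=; lia.
  - by rewrite natrD; split=> /=; [ring | lia].
  - by rewrite natrD; split=> /=; [ring | lia].
rewrite eS; move: eC hb h0; rewrite sz.
set c0 := count _ s; set c1 := count _ s; set c2 := count _ s => eC hb h0.
have {hb} : ((c1 <= c2 + (7 * D + 10) * P) /\ (c2 <= c1 + (7 * D + 10) * P))%N.
  (* For small [P] the trivial bound [P ^ 2] is already linear in [P]. *)
  have [/hb[b1 b2]|lt] := leqP (2 * D + 8) P; first by nia.
  by have : (P ^ 2 <= (2 * D + 8) * P)%N; [rewrite expnS expn1 leq_mul2r ltnW ?orbT | nia].
rewrite -!(ler_nat int) !natrD => -[b1 b2].
by rewrite ler_norml; move: b1 b2; lra.
Qed.

(** * Weil's bound for quadratic characters *)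

Lemma frob_roots_perm (W : closedFieldType) (Q : nat) (rs : seq W) (hQ : [pchar W].-nat Q) :
  finv Q (\prod_(t <- rs) ('X - t%:P)) -> perm_eq [seq t ^+ Q | t <- rs] rs.
Proof.
move/(finvP hQ); rewrite rmorph_prod /= => e; apply: prod_XsubC_eq; rewrite -e big_map.
by apply: eq_bigr => t _; rewrite rmorphB /= map_polyX map_polyC.
Qed.

Lemma prod_roots_fixed (W : closedFieldType) (Q : nat) (rs : seq W) (g : {poly W}) :
  [pchar W].-nat Q -> finv Q (\prod_(t <- rs) ('X - t%:P)) -> finv Q g ->
  (\prod_(t <- rs) g.[t]) ^+ Q = \prod_(t <- rs) g.[t].
Proof.
move=> hQ hf hg; rewrite -[RHS](perm_big _ (frob_roots_perm hQ hf)) big_map -prodrXl.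
by apply: eq_bigr => t _; apply: finv_horner.
Qed.

Lemma prod_roots_neq0 (W : closedFieldType) (rs : seq W) (g : {poly W}) :
  (\prod_(t <- rs) g.[t] != 0) = coprimep g (\prod_(t <- rs) ('X - t%:P)).
Proof.
rewrite coprimep_sym; elim: rs => [|t rs IH]; first by rewrite !big_nil oner_eq0 coprime1p.
by rewrite !big_cons coprimepMl mulf_eq0 negb_or IH [coprimep ('X - _) g]coprimep_sym coprimep_XsubC.
Qed.

Lemma modp_prod_roots (W : closedFieldType) (rs : seq W) (g : {poly W}) t : t \in rs ->
  (g %% \prod_(t <- rs) ('X - t%:P)).[t] = g.[t].
Proof.
move=> trs; rewrite {2}(divp_eq g (\prod_(t <- rs) ('X - t%:P))) !hornerE.
by move: (trs); rewrite -root_prod_XsubC => /rootP ->; rewrite mulr0 add0r.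
Qed.

(** The quadratic character of F_Q for odd [Q], by Euler's criterion. *)
Definition qsign (W : closedFieldType) (Q : nat) (z : W) : int :=
  if z == 0 then 0 else if z ^+ Q.-1./2 == 1 then 1 else -1.

Lemma half_pred_double (Q : nat) : odd Q -> (Q.-1./2).*2 = Q.-1.
Proof. by move=> oQ; have := odd_double_half Q; rewrite oQ; lia. Qed.

Section Odd.
Variables (W : closedFieldType) (Q : nat).
Hypotheses (hQ : [pchar W].-nat Q) (Q1 : (1 < Q)%N) (oQ : odd Q).

Lemma odd_pnat_two_neq0 : 2 != 0 :> W.
Proof.
apply/negP => two0; have h2 : 2 \in [pchar W] by rewrite inE /= two0.
have /pnatPpi := hQ => /(_ (pdiv Q)); rewrite pi_pdiv Q1 => /(_ isT) hp.
have e : pdiv Q = 2 by apply/eqP; move: hp; rewrite (pcharf_eq h2).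
by have := pdiv_dvd Q; rewrite e dvdn2 oQ.
Qed.

Lemma fixed_half_pow (x : W) : x ^+ Q = x -> x != 0 ->
  x ^+ Q.-1./2 = 1 \/ x ^+ Q.-1./2 = -1.
Proof.
move=> ex x0; have /eqP : (x ^+ Q.-1./2) ^+ 2 = 1.
  rewrite -exprM muln2 half_pred_double //; apply: (mulfI x0).
  by rewrite -exprS prednK ?(ltnW Q1) // mulr1.
by rewrite sqrf_eq1 => /orP[] /eqP; [left | right].
Qed.

Lemma qsignM (x y : W) : x ^+ Q = x -> y ^+ Q = y ->
  qsign Q (x * y) = qsign Q x * qsign Q y.
Proof.
move=> ex ey; rewrite /qsign mulf_eq0; have [//|x0] := eqVneq x 0; first by rewrite mul0r.
have [|y0] := eqVneq y 0; first by rewrite mulr0.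
have n1 : (-1 == 1 :> W) = false by rewrite -subr_eq0 -opprD oppr_eq0 (negbTE odd_pnat_two_neq0).
by rewrite exprMn /=; case: (fixed_half_pow ex x0) => ->; case: (fixed_half_pow ey y0) => ->;
  rewrite ?mul1r ?mulr1 ?mulrNN ?mulr1 ?eqxx ?n1.
Qed.

End Odd.

Section WeilOdd.
Variables (W : closedFieldType) (Q : nat).
Hypotheses (hQ : [pchar W].-nat Q) (Q1 : (1 < Q)%N) (oQ : odd Q).
Variables (f : {poly W}) (D : nat).
Hypotheses (mf : f \is monic) (sf : size f = D.+1) (hf : finv Q f).
Hypotheses (D0 : (0 < D)%N) (eD : ~~ odd D) (f00 : f.[0] != 0).
Hypothesis nsq : forall a b : {poly W}, f * a ^+ 2 = b ^+ 2 -> a = 0.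

(** Multiplying the squared relation by [f] replaces the half power by [f ^+ P], which is a constant
    [g ^+ 2] modulo 'X^P. Hence f a^2 = (g b)^2 modulo 'X^P, an equality for degree reasons, and
    [nsq] applies. *)
Lemma stepanov_odd_first P (a b A B : {poly W}) : [pchar W].-nat P -> odd P ->
  (2 * D + 8 <= P)%N -> (size a <= (P - D)./2)%N -> (size b <= (P - D)./2)%N ->
  (a + 'X^P * A) * 1 + (b + 'X^P * B) * f ^+ P.-1./2 = 0 -> a = 0 /\ b = 0.
Proof.
move=> hP oP leP sa sb e.
have [R eR] := expr_pchar_modX f hP.
have ef : f ^+ P.-1./2 * f ^+ P.-1./2 * f = f ^+ P.
  by rewrite -exprD addnn half_pred_double // -exprSr prednK //; lia.
have [g eg] := closed_nth_root (f.[0] ^+ P) (isT : (0 < 2)%N).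
have g0 : g != 0.
  apply: contraNneq f00 => g0; move: eg; rewrite g0 expr0n /= => /esym/eqP.
  by rewrite expf_eq0 => /andP[].
have E : f * (a + 'X^P * A) ^+ 2 = ((g ^+ 2)%:P + 'X^P * R) * (b + 'X^P * B) ^+ 2.
  rewrite eg -eR -ef; move/eqP: e; rewrite mulr1 addr_eq0 => /eqP ->; ring.
have z : f * a ^+ 2 - (g%:P * b) ^+ 2 = 0.
  apply: (@eq0_XnM_size _ P _ (R * (b + 'X^P * B) ^+ 2 + (g ^+ 2)%:P * (2 * b * B + 'X^P * B ^+ 2)
      - f * (2 * a * A + 'X^P * A ^+ 2))).
    apply/eqP; rewrite -subr_eq0; apply/eqP.
    rewrite -[RHS](subrr (f * (a + 'X^P * A) ^+ 2)) {2}E rmorphXn /=; ring.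
  have sm (c : {poly W}) : (size c <= (P - D)./2)%N -> (size (c ^+ 2)%R <= (P - D).-1)%N.
    by move=> sc; have := size_poly_exp_leq c 2; move: sc; move: (size (c ^+ 2)) (size c) => z t; lia.
  rewrite (leq_trans (size_polyD _ _)) // size_polyN geq_max; apply/andP; split.
    apply: leq_trans (size_polyMleq _ _) _; rewrite sf.
    by have := sm a sa; move: (size (a ^+ 2)) => z; lia.
  rewrite exprMn -polyC_exp mul_polyC (leq_trans (size_scale_leq _ _)) //.
  by have := sm b sb; move: (size (b ^+ 2)) => z; lia.
move/eqP: z; rewrite subr_eq0 => /eqP z; have a0 := nsq z.
split=> //; move/eqP: z; rewrite a0 expr0n mulr0 eq_sym expf_eq0 /= mulf_eq0.
by rewrite polyC_eq0 (negbTE g0) => /eqP.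
Qed.

Lemma qsign_norm k (y : W) : (0 < k)%N ->
  qsign Q (y ^+ (\sum_(j < k) Q ^ j)) = qsign (Q ^ k) y.
Proof.
case: k => // k _; rewrite /qsign expf_eq0 lt0n sum_nat_eq0 negb_forall.
have -> : [exists j : 'I_k.+1, ~~ (true ==> (Q ^ j == 0)%N)].
  by apply/existsP; exists ord0; rewrite expn0.
have e : ((\sum_(j < k.+1) Q ^ j) * Q.-1./2 = (Q ^ k.+1).-1./2)%N.
  apply: double_inj; rewrite -!muln2 -mulnA !muln2 !half_pred_double ?oddX ?oQ ?orbT //.
  by rewrite predn_exp mulnC.
by rewrite -exprM e.
Qed.

Lemma weil_odd :
  (\sum_(x <- fixs W Q) qsign Q f.[x]) ^+ 2 <= (D.-1 ^ 2 * Q)%N%:R.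
Proof.
have [rs] := closed_field_poly_normal f; rewrite (monicP mf) scale1r => ef.
have srs : size rs = D by apply: succn_inj; rewrite -sf ef size_prod_XsubC.
(* The quadratic character of the resultant of [f] and [g]: it depends on [g] modulo [f] only, and
   since [D] is even it takes the value of [f.[x]] at ['X - x] without a sign. *)
pose chi (g : {poly W}) := qsign Q (\prod_(t <- rs) g.[t]).
have hrs : finv Q (\prod_(t <- rs) ('X - t%:P)) by rewrite -ef.
have chi_orbit k x : (0 < k)%N -> chi (orbit_poly Q k x) = qsign (Q ^ k) f.[x].
  move=> k0; rewrite -qsign_norm // /chi; congr qsign.
  under eq_bigr do rewrite /orbit_poly horner_prod.
  rewrite exchange_big /= big_map -{1}[k]subn0 -/(index_iota 0 k) big_mkord.
  rewrite expr_sum; apply: eq_bigr => j _.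
  rewrite (finv_horner (Q := Q ^ j)) ?finv_expn ?pnatX ?hQ // [in RHS]ef horner_prod.
  transitivity (\prod_(t <- rs) (- 1 * ('X - t%:P).[x ^+ (Q ^ j)])).
    by apply: eq_bigr => t _; rewrite !hornerXsubC mulN1r opprB.
  rewrite big_split /= big_const_seq iter_mulr_1 count_predT srs.
  by rewrite -signr_odd (negbTE eD) mul1r.
have K : forall k, (0 < k)%N -> `|orbit_sum Q chi k.*2| <= ((7 * D + 10) * Q ^ k)%N%:R.
  move=> k k0; set P := (Q ^ k)%N; have hP : [pchar W].-nat P by rewrite pnatX hQ.
  have P0 : (0 < P)%N := pnat_pos hP.
  have oP : odd P by rewrite oddX oQ orbT.
  have eP : (Q ^ k.*2 = P ^ 2)%N by rewrite /P -expnM muln2.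
  have P21 : (1 < P ^ 2)%N by rewrite -eP -(expn0 Q) ltn_exp2l // double_gt0.
  have hP2 : [pchar W].-nat (P ^ 2)%N by rewrite pnatX hP.
  have us := uniq_fixs hP2 P21.
  rewrite /orbit_sum eP; under eq_bigr do rewrite chi_orbit ?double_gt0 // eP.
  have T01 (x : W) : qsign (P ^ 2) f.[x] \in [:: 0; 1; -1].
    by rewrite /qsign; case: eqP => // _; case: eqP.
  (* This factorisation writes the character of F_(P^2) at [f.[x]] as [s ^+ P * s] with [s] the
     value of [f ^+ P.-1./2], the shape Stepanov's method requires. *)
  have half : ((P ^ 2).-1./2 = P.-1./2 * P.+1)%N.
    apply: double_inj; rewrite half_pred_double ?oddX ?oQ ?orbT //. rewrite -[RHS]muln2 mulnAC muln2 half_pred_double //.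
    by rewrite -mulnn; move: P0; clear; nia.
  apply: (@sign_sum_bound W P D (fun x => qsign (P ^ 2) f.[x])) => //; first by rewrite size_fixs.
    rewrite -ltnS -sf -size_filter max_poly_roots ?monic_neq0 ?filter_uniq //.
    apply/allP => x; rewrite mem_filter => /andP[/eqP] /=; rewrite /qsign /root.
    by case: eqP => // _; case: eqP.
  move=> leP; have good (kp : W) (p : pred W) :
      {in fixs W (P ^ 2), forall x, p x -> f.[x] != 0 /\ f.[x] ^+ (P ^ 2).-1./2 = kp} ->
      (2 * count p (fixs W (P ^ 2)) <= P ^ 2 + (6 * D + 10) * P)%N.
    move=> hp; rewrite -size_filter.
    have sz : (size (f ^+ P.-1./2)%R <= (D * P).+1)%N.
      apply: leq_trans (size_poly_exp_leq _ _) _; rewrite sf ltnS leq_mul2l.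
      by apply/orP; right; clear; lia.
    apply: (@stepanov_half W P D (f ^+ P.-1./2) kp%:P 1 (f ^+ P.-1./2)) => //.
    - by rewrite (leq_trans (size_polyC_leq1 _)).
    - by rewrite size_poly1.
    - by move=> a b A B sa sb; apply: stepanov_odd_first.
    - exact: filter_uniq.
    - move=> x; rewrite mem_filter mem_fixs // => /andP[px ex]; have [|fx e] := hp x _ px; first by rewrite mem_fixs.
      move/eqP: ex => ex; split=> //.
        by rewrite horner_exp expf_neq0.
      by rewrite !horner_exp -polyC1 !hornerC expr1n mul1r -exprSr -exprM -half.
  split; [apply: (good 1) | apply: (good (-1))] => x xs; rewrite /qsign.
    have [//|fx] := eqVneq f.[x] 0.
    by case: ifP => [/eqP e _|]; [split | ].
  have [//|fx] := eqVneq f.[x] 0.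
  case: ifP => [|/eqP ne _]; [by [] | split=> //].
  have ex : f.[x] ^+ (P ^ 2) = f.[x].
    rewrite (finv_horner hP2); last by rewrite -eP finv_expn.
    by move: xs; rewrite mem_fixs // => /eqP ->.
  have oP2 : odd (P ^ 2) by rewrite oddX oP orbT.
  by case: (fixed_half_pow P21 oP2 ex fx).
have hm t g : t \in rs -> (g %% f).[t] = g.[t] by rewrite ef; apply: modp_prod_roots.
have -> : \sum_(x <- fixs W Q) qsign Q f.[x] = \sum_(x <- fixs W Q) chi ('X - x%:P).
  apply: eq_bigr => x _; have := chi_orbit 1%N x isT.
  by rewrite expn1 /orbit_poly big_seq1 expn0 expr1.
apply: (weil_character hQ Q1 (M := f) _ _ mf hf sf D0 _ _ _ K).
- by rewrite /chi big1 => [|t _]; rewrite ?hornerC // /qsign oner_eq0 expr1n eqxx.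
- move=> g h hg hh; rewrite /chi; under eq_bigr do rewrite hornerM.
  by rewrite big_split /= (qsignM hQ Q1 oQ) // prod_roots_fixed.
- move=> g _; rewrite /chi big_seq [in RHS]big_seq; congr qsign; apply: eq_bigr => t.
  exact: hm.
- by move=> g _; rewrite /chi /qsign; case: eqP => // _; case: eqP.
- move=> g _; rewrite ef -prod_roots_neq0 /chi /qsign.
  by have [//|_] := eqVneq (\prod_(t <- rs) g.[t]) 0; case: ifP.
Qed.

End WeilOdd.

(** * Weil's bound for Artin-Schreier sums in characteristic 2 *)

(** The additive character of F_(2^r) given by the sign of the absolute trace. *)
Definition tsign (W : closedFieldType) (r : nat) (z : W) : int :=
  if \sum_(i < r) z ^+ (2 ^ i) == 0 then 1 else -1.

Lemma pchar2_nat (R : nzRingType) r : 2 \in [pchar R] -> [pchar R].-nat (2 ^ r)%N.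
Proof. by move=> h2; rewrite (eq_pnat _ (pcharf_eq h2)) pnatX pnat_id ?orbT. Qed.

Section Trace.
Variables (W : closedFieldType) (h2 : 2 \in [pchar W]) (r : nat).

Lemma trace01 (z : W) : z ^+ (2 ^ r) = z ->
  \sum_(i < r) z ^+ (2 ^ i) = 0 \/ \sum_(i < r) z ^+ (2 ^ i) = 1.
Proof.
move=> ez; set t := \sum_(i < r) _.
have : t ^+ 2 = t.
  rewrite /t expr_sum_pchar ?(@pchar2_nat _ 1) //.
  under eq_bigr do rewrite -exprM -expnSr.
  case: (r) ez => [|m] ez; first by rewrite !big_ord0.
  by rewrite big_ord_recr big_ord_recl /= ez expn0 expr1 addrC.
move/eqP; rewrite -subr_eq0 expr2 -{3}[t]mulr1 -mulrBr mulf_eq0 subr_eq0.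
by case/orP => /eqP ->; [left | right].
Qed.

Lemma tsignD (z w : W) : z ^+ (2 ^ r) = z -> w ^+ (2 ^ r) = w ->
  tsign r (z + w) = tsign r z * tsign r w.
Proof.
move=> ez ew; rewrite /tsign.
under eq_bigr do rewrite exprDn_pchar ?pchar2_nat //.
rewrite big_split /=; have e11 : 1 + 1 = 0 :> W by have := pcharf0 h2; rewrite mulr2n.
by case: (trace01 ez) => ->; case: (trace01 ew) => ->;
  rewrite ?addr0 ?add0r ?e11 ?eqxx ?oner_eq0.
Qed.
End Trace.

Section ArtinSchreierPoly.
Variables (R : comNzRingType) (h2 : 2 \in [pchar R]) (A C : {poly R}).

(* [as_poly v / A ^+ 2 ^ v] is the partial trace [\sum_(i < v.+1) (C / A) ^+ 2 ^ i]. *)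
Fixpoint as_poly v : {poly R} :=
  if v is v'.+1 then as_poly v' * A ^+ (2 ^ v') + C ^+ (2 ^ v) else C.

(** With h = C / A, the partial trace t satisfies t^2 + t = h^(2^(v+1)) + h by telescoping; the
    statement clears denominators. *)
Lemma as_polyE v : A * (as_poly v ^+ 2 + as_poly v * A ^+ (2 ^ v)) =
  A * C ^+ (2 ^ v.+1) + C * A ^+ (2 ^ v.+1).
Proof.
have two0 : 2%:R = 0 :> {poly R} by apply: pcharf0; rewrite pchar_poly.
elim: v => [|v IH] /=; first by rewrite expr1; ring.
rewrite [(2 ^ v.+2)%N]expnSr [(2 ^ v.+1)%N]expnSr !exprM in IH *.
set s := as_poly v in IH *; set c := C ^+ (2 ^ v) in IH *; set e := A ^+ (2 ^ v) in IH *.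
transitivity (e ^+ 2 * (A * (s ^+ 2 + s * e)) + A * c ^+ 2 ^+ 2 + A * c ^+ 2 * e ^+ 2
   + 2%:R * (A * s * e * c ^+ 2)); first by ring.
rewrite IH two0 mul0r addr0.
transitivity (A * c ^+ 2 ^+ 2 + C * (e ^+ 2) ^+ 2 + 2%:R * (e ^+ 2 * A * c ^+ 2)); first by ring.
by rewrite two0 mul0r addr0.
Qed.

Lemma size_as_poly G v : (size A <= G.+1)%N -> (size C <= G.+1)%N ->
  (size (as_poly v) <= (G * 2 ^ v).+1)%N.
Proof.
move=> sA sC; have se (c : {poly R}) k : (size c <= G.+1)%N -> (size (c ^+ k)%R <= (G * k).+1)%N.
  move=> sc; apply: leq_trans (size_poly_exp_leq _ _) _; rewrite ltnS leq_mul2r.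
  by apply/orP; right; move: sc; case: (size c).
elim: v => [|v IH] /=; first by rewrite expn0 muln1.
rewrite (leq_trans (size_polyD _ _)) // geq_max se // andbT.
apply: leq_trans (size_polyMleq _ _) _; have := se A (2 ^ v)%N sA.
by move: IH; move: (size (as_poly v)) (size (A ^+ (2 ^ v))) => a b; rewrite expnS; lia.
Qed.
End ArtinSchreierPoly.

Lemma as_poly_horner (W : closedFieldType) (A C : {poly W}) v x : A.[x] != 0 ->
  (as_poly A C v).[x] = A.[x] ^+ (2 ^ v) * \sum_(i < v.+1) (C.[x] / A.[x]) ^+ (2 ^ i).
Proof.
move=> Ax; elim: v => [|v IH] /=.
  by rewrite big_ord_recl big_ord0 addr0 !expn0 !expr1 mulrC divfK.
rewrite !(hornerE, horner_exp) IH [in RHS]big_ord_recr /= mulrDr; congr (_ + _).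
  by rewrite mulrAC -exprD addnn -mul2n expnS.
by rewrite -exprMn mulrC divfK.
Qed.

(* Infinite descent: a simple pole [x] of [C / A] forces [b], then [a], to vanish
   at [x], and both can be divided by ['X - x%:P]. *)
Lemma artin_schreier_descent (F : fieldType) (A C a b : {poly F}) (x g : F) :
  root A x -> A^`().[x] != 0 -> C.[x] != 0 ->
  A * (a ^+ 2 + a * b - g%:P * b ^+ 2) = b ^+ 2 * C -> a = 0 /\ b = 0.
Proof.
case/factor_theorem => A1 ->; set L := 'X - x%:P => A'x Cx.
have A1x : A1.[x] != 0.
  by move: A'x; rewrite derivM derivXsubC mulr1 !hornerE subrr mulr0 add0r.
have L0 : L != 0 by rewrite polyXsubC_eq0.
have fac (q : {poly F}) : q.[x] = 0 -> exists q1, q = q1 * L by move/eqP/factor_theorem.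
elim: {b}(size b) {-2}b (leqnn (size b)) a => [|m IH] b sb a E.
  have b0 : b = 0 by apply/eqP; rewrite -size_poly_eq0 -leqn0.
  split=> //; move: E; rewrite b0 !expr0n /= !(mulr0, mul0r) subr0 addr0 => /eqP.
  have AL0 : A1 * L != 0.
    by rewrite mulf_neq0 //; apply: contraNneq A1x => ->; rewrite horner0.
  by rewrite mulf_eq0 (negbTE AL0) /= expf_eq0 => /eqP.
have [b1 eb] : exists q1, b = q1 * L.
  apply: fac; move/(congr1 (fun q : {poly F} => q.[x])): E; rewrite !(hornerE, horner_exp) /=.
  rewrite subrr mulr0 mul0r => /esym/eqP; rewrite mulf_eq0 (negbTE Cx) orbF.
  by rewrite expf_eq0 => /eqP.
have E1 : A1 * (a ^+ 2 + a * b - g%:P * b ^+ 2) = b1 ^+ 2 * L * C.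
  by apply: (mulIf L0); rewrite mulrAC E eb; ring.
have [a1 ea] : exists q1, a = q1 * L.
  apply: fac; move/(congr1 (fun q : {poly F} => q.[x])): E1; rewrite eb !(hornerE, horner_exp) /=.
  rewrite subrr !(mulr0, mul0r) addr0 subr0 => /eqP.
  by rewrite mulf_eq0 (negbTE A1x) /= expf_eq0 => /eqP.
have E2 : A1 * L * (a1 ^+ 2 + a1 * b1 - g%:P * b1 ^+ 2) = b1 ^+ 2 * C.
  by apply: (mulIf L0); transitivity (b1 ^+ 2 * L * C); [rewrite -E1 ea eb|]; ring.
have [b10|b1n] := eqVneq b1 0.
  have sb1 : (size b1 <= m)%N by rewrite b10 size_poly0.
  by have [a10 _] := IH b1 sb1 a1 E2; rewrite ea eb a10 b10 !mul0r.
have sb1 : (size b1 <= m)%N.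
  by move: sb; rewrite eb size_Mmonic ?monicXsubC // size_XsubC addn2.
by have [a10 b10] := IH b1 sb1 a1 E2; rewrite ea eb a10 b10 !mul0r.
Qed.

(** [L] interpolates [C] at the nodes [rs]; the difference has more roots than its degree allows. *)
Lemma lagrange_partial_fraction (F : fieldType) (rs : seq F) (C : {poly F}) (x : F) :
  let A := \prod_(t <- rs) ('X - t%:P) in
  uniq rs -> (size C <= size rs)%N -> A.[x] != 0 ->
  \sum_(t <- rs) C.[t] / A^`().[t] / (x - t) = C.[x] / A.[x].
Proof.
move=> A us sC Ax; pose B t := A %/ ('X - t%:P).
have eB t : t \in rs -> A = B t * ('X - t%:P).
  by move=> trs; rewrite divpK // dvdp_XsubCl root_prod_XsubC.
have BA t : t \in rs -> (B t).[t] = A^`().[t].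
  by move=> trs; rewrite [in RHS](eB t trs) derivM derivXsubC mulr1 !hornerE subrr mulr0 add0r.
have A't t : t \in rs -> A^`().[t] != 0.
  move=> trs; have : separable_poly A by rewrite separable_prod_XsubC.
  by rewrite unlock => /coprimep_root; apply; rewrite root_prod_XsubC.
have sA : size A = (size rs).+1 by rewrite size_prod_XsubC.
pose L := \sum_(t <- rs) (C.[t] / A^`().[t]) *: B t.
have eL : C = L.
  apply/eqP; rewrite -subr_eq0; apply/negPn/negP => nz.
  have : (size rs < size (C - L)%R)%N.
    apply: max_poly_roots => //; apply/allP => u urs; rewrite /root hornerD hornerN horner_sum.
    rewrite (bigD1_seq u) //= hornerZ BA // divfK ?A't // big_seq_cond big1 ?addr0 ?subrr //.
    move=> t /andP[trs tu]; rewrite hornerZ; suff -> : (B t).[u] = 0 by rewrite mulr0.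
    have : A.[u] == 0 by rewrite -/(root _ _) root_prod_XsubC.
    by rewrite {1}(eB t trs) hornerM hornerXsubC mulf_eq0 subr_eq0 [u == t]eq_sym (negbTE tu) orbF => /eqP.
  apply/negP; rewrite -leqNgt (leq_trans (size_polyD _ _)) // size_polyN geq_max sC /=.
  apply: leq_trans (size_sum _ _ _) _; apply/bigmax_leqP_seq => t trs _.
  rewrite (leq_trans (size_scale_leq _ _)) // size_divp ?polyXsubC_eq0 //.
  by rewrite sA size_XsubC subn1.
rewrite [in RHS]eL horner_sum mulr_suml big_seq [RHS]big_seq; apply: eq_bigr => t trs.
rewrite hornerZ; have xt : x - t != 0.
  by apply: contraNneq Ax => e; rewrite (eB t trs) hornerM hornerXsubC e mulr0.
have Bx : (B t).[x] != 0.
  by apply: contraNneq Ax => e; rewrite (eB t trs) hornerM e mul0r.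
by rewrite (eB t trs) in BA A't *; rewrite hornerM hornerXsubC; field; rewrite xt Bx /= A't.
Qed.

Section WeilEven.
Variables (W : closedFieldType) (h2 : 2 \in [pchar W]) (r : nat) (r0 : (0 < r)%N).
Let Q := (2 ^ r)%N.
Variables (A C : {poly W}) (G : nat) (x0 : W).
Hypotheses (mA : A \is monic) (sA : size A = G.+1) (hA : finv Q A) (G0 : (0 < G)%N).
Hypotheses (sC : (size C <= G)%N) (hC : finv Q C) (A00 : A.[0] != 0).
Hypothesis sepA : forall t, root A t -> A^`().[t] != 0.
Hypotheses (rx0 : root A x0) (Cx0 : C.[x0] != 0).

Let hQ : [pchar W].-nat Q. Proof. exact: pchar2_nat. Qed.
Let Q1 : (1 < Q)%N. Proof. by rewrite /Q -(expn0 2) ltn_exp2l. Qed.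
Let D := (2 * G)%N.

Lemma pchar2_opp (x : W) : - x = x.
Proof. by apply/eqP; rewrite -subr_eq0 -opprD oppr_eq0 -mulr2n -mulr_natl (pcharf0 h2) mul0r. Qed.

(** Squaring and inserting [as_polyE] leaves only [A ^+ P] and [C ^+ P], constants modulo 'X^P. The
    resulting quadratic relation between [a] and [b] is exact for degree reasons, and is excluded by
    descent at the simple pole [x0]. *)
Lemma stepanov_even_first v (a b X B : {poly W}) : let P := (2 ^ v.+1)%N in
  (2 * D + 8 <= P)%N -> (size a <= (P - D)./2)%N -> (size b <= (P - D)./2)%N ->
  (a + 'X^P * X) * A ^+ (2 ^ v) + (b + 'X^P * B) * as_poly A C v = 0 -> a = 0 /\ b = 0.
Proof.
move=> P leP sa sb e; have hP : [pchar W].-nat P by apply: pchar2_nat.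
have h2p : 2 \in [pchar {poly W}] by rewrite pchar_poly.
have [RA eRA] := expr_pchar_modX A hP; have [RC eRC] := expr_pchar_modX C hP.
set al := A.[0] ^+ P in eRA *; set ga := C.[0] ^+ P in eRC *.
have al0 : al != 0 by rewrite expf_neq0.
set Y := a + 'X^P * X in e *; set Z := b + 'X^P * B in e *; set S := as_poly A C v in e *.
set E := A ^+ (2 ^ v) in e *.
have eS : A * (S ^+ 2 + S * E) = A * C ^+ P + C * A ^+ P by apply: as_polyE.
have eE : E ^+ 2 = A ^+ P by rewrite /E -exprM -expnSr.
have E1 : A * A ^+ P * (Y ^+ 2 + Y * Z) = Z ^+ 2 * (A * C ^+ P + C * A ^+ P).
  have YE : Y * E = - (Z * S) by apply/eqP; rewrite -addr_eq0 e.
  have YE' : Y * E = Z * S.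
    by rewrite YE -mulN1r -polyC1 -polyCN pchar2_opp polyC1 mul1r.
  rewrite -eS -eE; transitivity (A * ((Y * E) ^+ 2 + (Y * E) * Z * E)); first by ring.
  by rewrite YE'; ring.
have z : al%:P * A * (a ^+ 2 + a * b) - b ^+ 2 * (ga%:P * A + al%:P * C) = 0.
  apply: (@eq0_XnM_size _ P _
    (Z ^+ 2 * (A * RC + C * RA) - A * RA * (Y ^+ 2 + Y * Z)
     + (2%:R * b * B + 'X^P * B ^+ 2) * (A * ga%:P + C * al%:P)
     - A * al%:P * (2%:R * a * X + 'X^P * X ^+ 2 + a * B + X * b + 'X^P * X * B))).
    apply/eqP; rewrite -subr_eq0; apply/eqP.
    rewrite -[RHS](subrr (A * A ^+ P * (Y ^+ 2 + Y * Z))) {2}E1 eRA eRC /Y /Z; ring.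
  have sm (c d : {poly W}) : (size c <= (P - D)./2)%N -> (size d <= (P - D)./2)%N ->
      (size (c * d)%R <= (P - D).-1)%N.
    move=> sc sd; have := size_polyMleq c d.
    by move: sc sd; move: (size (c * d)) (size c) (size d) => n1 n2 n3; clear; lia.
  have s1 : (size (a ^+ 2 + a * b)%R <= (P - D).-1)%N.
    by rewrite (leq_trans (size_polyD _ _)) // geq_max expr2 !sm.
  have s2 : (size (ga%:P * A + al%:P * C)%R <= G.+1)%N.
    rewrite (leq_trans (size_polyD _ _)) // geq_max !mul_polyC.
    by rewrite !(leq_trans (size_scale_leq _ _)) ?sA // leqW.
  have s3 : (size (al%:P * A)%R <= G.+1)%N.
    by rewrite mul_polyC (leq_trans (size_scale_leq _ _)) ?sA.
  have s4 : (size (b ^+ 2)%R <= (P - D).-1)%N by rewrite expr2 sm.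
  rewrite (leq_trans (size_polyD _ _)) // size_polyN geq_max; apply/andP; split.
    apply: leq_trans (size_polyMleq _ _) _; move: s1 s3 leP; rewrite /D.
    by move: (size (al%:P * A)) (size (a ^+ 2 + a * b)) => n1 n2; clear; lia.
  apply: leq_trans (size_polyMleq _ _) _; move: s2 s4 leP; rewrite /D.
  by move: (size (b ^+ 2)) (size (ga%:P * A + al%:P * C)) => n1 n2; clear; lia.
have [] := @artin_schreier_descent _ A C a b x0 (ga / al) rx0 (sepA rx0) Cx0; last by split.
apply: (@mulfI _ al%:P); first by rewrite polyC_eq0.
apply/eqP; rewrite -subr_eq0; apply/eqP; rewrite -[RHS]z polyCM.
transitivity (al%:P * A * (a ^+ 2 + a * b) - b ^+ 2 * ((al%:P * (al^-1)%:P) * ga%:P * A + al%:P * C)); first by ring.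
by rewrite -polyCM divff // mul1r.
Qed.
Lemma trace_tower k (h : W) :
  \sum_(i < r) (\sum_(j <- iota 0 k) h ^+ (Q ^ j)) ^+ (2 ^ i) = \sum_(l < r * k) h ^+ (2 ^ l).
Proof.
elim: k => [|k IH].
  by rewrite muln0 big_ord0 big1 // => i _; rewrite big_nil expr0n expn_eq0.
rewrite -{1}[k.+1]addn1 iotaD mulnS [(r + _)%N]addnC big_split_ord /= -IH -[RHS]big_split /=.
apply: eq_bigr => i _; rewrite big_cat big_seq1 /= add0n exprDn_pchar ?pchar2_nat //.
by rewrite -exprM /Q -expnM -expnD.
Qed.

Lemma weil_even :
  (\sum_(x <- fixs W Q) (if A.[x] == 0 then 0 else tsign r (C.[x] / A.[x]))) ^+ 2
    <= (D.-1 ^ 2 * Q)%N%:R.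
Proof.
have [rs] := closed_field_poly_normal A; rewrite (monicP mA) scale1r => eA.
have srs : size rs = G by apply: succn_inj; rewrite -sA eA size_prod_XsubC.
have hrs : finv Q (\prod_(t <- rs) ('X - t%:P)) by rewrite -eA.
have rrs t : t \in rs -> root A t by rewrite eA root_prod_XsubC.
have us : uniq rs.
  rewrite -separable_prod_XsubC -eA unlock.
  by apply: coprimep_roots => [|t /sepA]; rewrite ?monic_neq0.
pose w t := C.[t] / A^`().[t].
(* Logarithmic derivatives weighted by the residues [w t] of [C / A]: additive in [g], equal to
   [C.[z] / A.[z]] on ['X - z] by partial fractions, and dependent on [g] modulo [A ^+ 2]. This
   explains the modulus [A ^+ 2] and [D = 2 * G]. *)
pose La (g : {poly W}) := \sum_(t <- rs) w t * (g^`().[t] / g.[t]).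
pose chi (g : {poly W}) := if \prod_(t <- rs) g.[t] == 0 then 0 else tsign r (La g).
have nz (g : {poly W}) : \prod_(t <- rs) g.[t] != 0 -> {in rs, forall t, g.[t] != 0}.
  by rewrite prodf_seq_neq0 => /allP h t /h.
have LaM (g h : {poly W}) : {in rs, forall t, g.[t] != 0} -> {in rs, forall t, h.[t] != 0} ->
    La (g * h) = La g + La h.
  move=> g0 h0; rewrite /La -big_split big_seq [RHS]big_seq; apply: eq_bigr => t trs /=.
  rewrite -mulrDr; congr (_ * _); rewrite derivM !hornerE.
  by have := g0 t trs; have := h0 t trs => a b; field; rewrite a b.
have LaQ (g : {poly W}) : finv Q g -> La g ^+ Q = La g.
  move=> hg; rewrite /La -[RHS](perm_big _ (frob_roots_perm hQ hrs)) big_map.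
  rewrite expr_sum_pchar //; apply: eq_bigr => t _; rewrite !exprMn !exprVn.
  by rewrite !(finv_horner hQ) ?finv_deriv.
have La_prod (zs : seq W) : all (fun z => ~~ root A z) zs ->
    La (\prod_(z <- zs) ('X - z%:P)) = \sum_(z <- zs) C.[z] / A.[z].
  elim: zs => [|z zs IH] /=.
    by move=> _; rewrite !big_nil /La big1 // => t _; rewrite derivC horner0 mul0r mulr0.
  case/andP=> rz azs; rewrite !big_cons LaM ?IH //; last first.
  - move=> t /rrs rt; rewrite -/(root _ t) root_prod_XsubC; apply/negP => /(allP azs).
    by rewrite rt.
  - move=> t /rrs rt; rewrite hornerXsubC subr_eq0; apply: contraNneq rz => <-.
    by [].
  congr (_ + _); rewrite [in RHS]eA.
  rewrite -(@lagrange_partial_fraction _ rs C z us); first last.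
  - by rewrite -eA.
  - by rewrite srs.
  rewrite /La -eA; apply: eq_bigr => t _; rewrite derivXsubC hornerC hornerXsubC div1r.
  by rewrite -[z - t]pchar2_opp opprB.
have chi_orbit k x : (0 < k)%N -> chi (orbit_poly Q k x) =
    if A.[x] == 0 then 0 else tsign (r * k) (C.[x] / A.[x]).
  move=> k0; rewrite /chi -[\prod_(t <- rs) _ == 0]negbK prod_roots_neq0 -eA.
  rewrite coprimep_orbit_poly // negbK -/(root A x); have [//|rx] := boolP (root A x).
  rewrite /tsign La_prod; last first.
    apply/allP => z /mapP[j _ ->]; apply: contra rx.
    have hj : [pchar W].-nat (Q ^ j)%N by rewrite pnatX hQ.
    by rewrite /root -(finv_horner hj _ (finv_expn j hA)) expf_eq0 => /andP[].
  rewrite -trace_tower; congr (if _ == _ then _ else _); apply: eq_bigr => i _.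
  congr (_ ^+ _); rewrite big_map; apply: eq_bigr => j _.
  have hj : [pchar W].-nat (Q ^ j)%N by rewrite pnatX hQ.
  by rewrite expr_div_n (finv_horner hj _ (finv_expn j hA)) (finv_horner hj _ (finv_expn j hC)).
have K : forall k, (0 < k)%N -> `|orbit_sum Q chi k.*2| <= ((7 * D + 10) * Q ^ k)%N%:R.
  move=> k k0; set P := (Q ^ k)%N.
  pose v := (r * k).-1; have ev : v.+1 = (r * k)%N by rewrite prednK // muln_gt0 r0.
  have eP : P = (2 ^ v.+1)%N by rewrite ev /P /Q -expnM.
  have hP : [pchar W].-nat P by rewrite eP pchar2_nat.
  have P0 : (0 < P)%N := pnat_pos hP.
  have eP2 : (Q ^ k.*2 = P ^ 2)%N by rewrite /P -expnM muln2.
  have P21 : (1 < P ^ 2)%N by rewrite -eP2 -(expn0 Q) ltn_exp2l // double_gt0.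
  have hP2 : [pchar W].-nat (P ^ 2)%N by rewrite pnatX hP.
  have us2 := uniq_fixs hP2 P21.
  have erk : (r * k.*2 = v.+1 + v.+1)%N by rewrite ev -addnn mulnDr.
  rewrite /orbit_sum eP2; under eq_bigr do rewrite chi_orbit ?double_gt0 // erk.
  pose T (x : W) : int := if A.[x] == 0 then 0 else tsign (v.+1 + v.+1) (C.[x] / A.[x]).
  apply: (@sign_sum_bound W P D T) => //; first by rewrite size_fixs.
  - by move=> x _; rewrite /T /tsign; case: ifP => // _; case: ifP.
  - apply: (@leq_trans G); last by rewrite /D leq_pmull.
    rewrite -ltnS -sA -size_filter max_poly_roots ?monic_neq0 ?filter_uniq //.
    apply/allP => x; rewrite mem_filter /T /tsign /root => /andP[+ _].
    by have [//|_] := eqVneq A.[x] 0; case: ifP.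
  move=> leP; have good (kp : W) (p : pred W) :
      {in fixs W (P ^ 2), forall x, p x -> A.[x] != 0 /\
        \sum_(i < v.+1 + v.+1) (C.[x] / A.[x]) ^+ (2 ^ i) = kp} ->
      (2 * count p (fixs W (P ^ 2)) <= P ^ 2 + (6 * D + 10) * P)%N.
    move=> hp; rewrite -size_filter; pose e := A ^+ (2 ^ v).
    have leGP : (G * 2 ^ v <= D * P)%N.
      by rewrite /D eP expnS mulnACA leq_pmull // muln_gt0.
    have se : (size e <= (D * P).+1)%N.
      apply: leq_trans (size_poly_exp_leq _ _) _; rewrite sA ltnS.
      exact: leGP.
    have ss : (size (as_poly A C v) <= (D * P).+1)%N.
      have sA' : (size A <= G.+1)%N by rewrite sA.
      by apply: leq_trans (size_as_poly h2 v sA' (leqW sC)) _.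
    apply: (@stepanov_half W P D e (as_poly A C v + kp%:P * e) e (as_poly A C v)) => //.
    - rewrite (leq_trans (size_polyD _ _)) // geq_max ss /= mul_polyC.
      by rewrite (leq_trans (size_scale_leq _ _)).
    - by move=> a b X B sa sb E; apply: (@stepanov_even_first v a b X B); rewrite -?eP.
    - exact: filter_uniq.
    - move=> x; rewrite mem_filter mem_fixs // => /andP[px ex]; have [|Ax et] := hp x _ px.
        by rewrite mem_fixs.
      move/eqP: ex => ex; split=> //; first by rewrite horner_exp expf_neq0.
      rewrite hornerD hornerM hornerC as_poly_horner // -horner_exp -/e.
      set t := \sum_(i < v.+1) _.
      (* The trace from F_(P^2) to F_2 is [t + t ^+ P], with [t] the sum of the first half of its
         terms. *)
      have tP : t ^+ P = t + kp.
        rewrite -et big_split_ord /= -/t addrA -[t + t]mulr2n -mulr_natl (pcharf0 h2) mul0r add0r.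
        rewrite /t expr_sum_pchar //; apply: eq_bigr => i _.
        by rewrite -exprM eP -expnD addnC.
      by rewrite exprMn tP; ring.
  split; [apply: (good 0) | apply: (good 1)] => x xs; rewrite /T /tsign.
    by have [//|Ax] := eqVneq A.[x] 0; case: ifP => [/eqP //|].
  have [//|Ax] := eqVneq A.[x] 0; case: ifP => // ne _; split=> //.
  have xP : x ^+ (P ^ 2) = x by move: xs; rewrite mem_fixs // => /eqP.
  have hv : (2 ^ (v.+1 + v.+1) = P ^ 2)%N by rewrite expnD -eP mulnn.
  have hz : (C.[x] / A.[x]) ^+ (2 ^ (v.+1 + v.+1)) = C.[x] / A.[x].
    rewrite hv expr_div_n -eP2 in xP *.
    have hj : [pchar W].-nat (Q ^ k.*2)%N by rewrite pnatX hQ.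
    by rewrite (finv_horner hj _ (finv_expn _ hA)) (finv_horner hj _ (finv_expn _ hC)) xP.
  by case: (trace01 h2 hz) => // z; rewrite z eqxx in ne.
have mA2 : A ^+ 2 \is monic by apply: monic_exp.
have sA2 : size (A ^+ 2) = D.+1.
  by rewrite expr2 size_monicM ?monic_neq0 // sA /D addSn addnS /= mul2n addnn.
have D0 : (0 < D)%N by rewrite muln_gt0.
have hA2 : finv Q (A ^+ 2) by apply: finvXn.
have -> : \sum_(x <- fixs W Q) (if A.[x] == 0 then 0 else tsign r (C.[x] / A.[x])) =
    \sum_(x <- fixs W Q) chi ('X - x%:P).
  apply: eq_bigr => x _; have := chi_orbit 1%N x isT.
  by rewrite muln1 /orbit_poly big_seq1 expn0 expr1.
have dm g t : t \in rs -> (g %% A ^+ 2).[t] = g.[t] /\ (g %% A ^+ 2)^`().[t] = g^`().[t].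
  move=> /rrs /rootP rt; split; rewrite [in RHS](divp_eq g (A ^+ 2)) expr2.
    by rewrite hornerD !hornerM rt !mulr0 add0r.
  by rewrite derivD !derivM !(hornerD, hornerM) rt; ring.
apply: (weil_character hQ Q1 (M := A ^+ 2) _ _ mA2 hA2 sA2 D0 _ _ _ K).
- rewrite /chi big1 => [|t _]; last by rewrite hornerC.
  rewrite oner_eq0 /La big1 => [|t _]; last by rewrite derivC horner0 mul0r mulr0.
  by rewrite /tsign big1 ?eqxx // => i _; rewrite expr0n expn_eq0.
- move=> g h hg hh; rewrite /chi; under eq_bigr do rewrite hornerM.
  rewrite big_split /= mulf_eq0; have [_|ng] := eqVneq (\prod_(t <- rs) g.[t]) 0; first by rewrite mul0r.
  have [_|nh] := eqVneq (\prod_(t <- rs) h.[t]) 0; first by rewrite mulr0.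
  by rewrite LaM ?(tsignD h2) ?LaQ //; apply: nz.
- move=> g _; rewrite /chi.
  have -> : \prod_(t <- rs) (g %% A ^+ 2).[t] = \prod_(t <- rs) g.[t].
    by rewrite big_seq [RHS]big_seq; apply: eq_bigr => t /(dm g)[].
  have -> // : La (g %% A ^+ 2) = La g.
  by rewrite /La big_seq [RHS]big_seq; apply: eq_bigr => t /(dm g)[-> ->].
- by move=> g _; rewrite /chi /tsign; case: ifP => // _; case: ifP.
- move=> g _; rewrite coprimep_pexpr // eA -prod_roots_neq0 /chi /tsign.
  by have [//|_] := eqVneq (\prod_(t <- rs) g.[t]) 0; case: ifP.
Qed.
End WeilEven.

(** * Quadratic equations with conjugate roots *)

Definition conj_pairs (W : closedFieldType) (Q : nat) (tau nu : W) : seq W :=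
  [seq Y <- fixs W (Q ^ 2) | (Y + Y ^+ Q == tau) && (Y * Y ^+ Q == nu)].

Section ConjPairs.
Variables (W : closedFieldType) (Q : nat).
Hypotheses (hQ : [pchar W].-nat Q) (Q1 : (1 < Q)%N).

Let hQ2 : [pchar W].-nat (Q ^ 2)%N. Proof. by rewrite pnatX hQ. Qed.
Let Q21 : (1 < Q ^ 2)%N. Proof. by rewrite -(expn0 Q) ltn_exp2l. Qed.

Lemma uniq_conj_pairs (tau nu : W) : uniq (conj_pairs Q tau nu).
Proof. by rewrite filter_uniq // uniq_fixs. Qed.

Lemma mem_conj_pairs (tau nu Y : W) : (Y \in conj_pairs Q tau nu) =
  [&& Y + Y ^+ Q == tau, Y * Y ^+ Q == nu & Y ^+ Q ^+ Q == Y].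
Proof. by rewrite mem_filter mem_fixs // -exprM andbA. Qed.

Lemma size_conj_pairs_sub (s : seq W) (tau nu : W) : uniq s ->
  {subset s <= conj_pairs Q tau nu} -> (size s)%:R <= (size (conj_pairs Q tau nu))%:R :> int.
Proof. by move=> us sub; rewrite ler_nat uniq_leq_size. Qed.

(** The roots [(tau + y) / 2] and [(tau - y) / 2] are exchanged by the [Q]-power map when the
    discriminant [y ^+ 2] is a non-square; discriminant 0 still leaves the root [tau / 2]. *)
Lemma size_conj_pairs_odd (tau nu : W) : odd Q -> tau ^+ Q = tau -> nu ^+ Q = nu ->
  1 - qsign Q (tau ^+ 2 - 4 * nu) <= (size (conj_pairs Q tau nu))%:R.
Proof.
move=> oQ et en; have two0 := odd_pnat_two_neq0 hQ Q1 oQ.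
have e4 : (4 : W) != 0 by rewrite (_ : 4 = 2 * 2) ?mulf_neq0 // -natrM.
have fr2 : (2 : W) ^+ Q = 2 := rmorph_nat (frob hQ) 2.
set d := tau ^+ 2 - 4 * nu; have ed : d ^+ Q = d.
  have fr4 : (4 : W) ^+ Q = 4 := rmorph_nat (frob hQ) 4.
  by rewrite /d exprBn_pcharW // [(4 * nu) ^+ Q]exprMn fr4 en exprAC et.
have [y ey] := closed_nth_root d (isT : (0 < 2)%N).
have yQ : y ^+ Q = y * d ^+ Q.-1./2.
  by rewrite -ey -exprM mul2n half_pred_double // -exprS prednK // ltnW.
have halfQ z : (z / 2) ^+ Q = z ^+ Q / 2 :> W by rewrite expr_div_n fr2.
rewrite /qsign; have [d0|d0] := eqVneq d 0.
  rewrite subr0; apply: (@size_conj_pairs_sub [:: tau / 2]) => // z; rewrite inE => /eqP ->.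
  rewrite mem_conj_pairs !halfQ !et eqxx andbT.
  apply/andP; split; apply/eqP; first by field.
  have -> : nu = (tau ^+ 2 - d) / 4.
    by rewrite /d; field; rewrite ?two0 ?e4.
  by rewrite d0; field; rewrite ?two0 ?e4.
case: ifP => [_|/eqP ne]; first by rewrite subrr ler0n.
have dQ : d ^+ Q.-1./2 = -1 by case: (fixed_half_pow Q1 oQ ed d0).
rewrite dQ mulrN1 in yQ.
have y0 : y != 0 by apply: contraNneq d0 => y0; rewrite -ey y0 expr0n.
rewrite opprK; apply: (@size_conj_pairs_sub [:: (tau + y) / 2; (tau - y) / 2]).
  rewrite /= inE andbT; apply/negP => /eqP e; case/negP: y0.
  have : y * 2 = 0.
    have := congr1 (fun z => z * 2 - tau) e; rewrite !divfK // => e1.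
    by have -> : y * 2 = (tau + y - tau) - (tau - y - tau); [ring | rewrite e1 subrr].
  by move/eqP; rewrite mulf_eq0 (negbTE two0) orbF.
have enu : nu = (tau ^+ 2 - y ^+ 2) / 4 by rewrite ey /d; field.
move=> z; rewrite !inE => /orP[] /eqP ->; rewrite mem_conj_pairs !halfQ;
  rewrite ?(exprBn_pcharW _ _ hQ) ?(exprDn_pchar _ _ hQ) ?(exprNn_pcharW _ hQ) et yQ ?opprK;
  rewrite ?(exprBn_pcharW _ _ hQ) ?(exprDn_pchar _ _ hQ) ?(exprNn_pcharW _ hQ) et yQ ?opprK eqxx andbT enu;
  by apply/andP; split; apply/eqP; field; rewrite ?two0 ?e4.
Qed.

(** Substituting Y = tau z gives z^2 + z = (c / tau)^2, and [z ^+ Q = z + 1] when [c / tau] has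
    trace 1. For [tau = 0] the double root [c] remains. *)
Lemma size_conj_pairs_even r (tau c : W) : 2 \in [pchar W] -> Q = (2 ^ r)%N ->
  tau ^+ Q = tau -> c ^+ Q = c ->
  1 - (if tau == 0 then 0 else tsign r (c / tau)) <= (size (conj_pairs Q tau (c ^+ 2)))%:R.
Proof.
move=> h2 eQ et ec; have add2 (z : W) : z + z = 0 by rewrite -mulr2n -mulr_natl (pcharf0 h2) mul0r.
have [t0|t0] := eqVneq tau 0.
  rewrite subr0; apply: (@size_conj_pairs_sub [:: c]) => // z; rewrite inE => /eqP ->.
  by rewrite mem_conj_pairs !ec add2 t0 !eqxx.
rewrite /tsign; case: ifP => [_|/eqP ne]; first by rewrite subrr ler0n.
set h := c / tau in ne *; have eh : h ^+ Q = h by rewrite /h expr_div_n ec et.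
have trh : \sum_(i < r) h ^+ (2 ^ i) = 1.
  by rewrite eQ in eh; case: (trace01 h2 eh).
have [z ez] : exists z, z ^+ 2 + z = h ^+ 2.
  have /closed_rootP[z] : size ('X^2 + 'X - (h ^+ 2)%:P : {poly W}) != 1.
    rewrite -addrA size_polyDl ?size_polyXn // ltnS.
    rewrite (leq_trans (size_polyD _ _)) // size_polyN size_polyX geq_max /=.
    by rewrite (leq_trans (size_polyC_leq1 _)).
  by rewrite /root !(hornerE, horner_exp) subr_eq0 => /eqP; exists z.
have zQ : z ^+ Q = z + 1.
  have tel m : \sum_(i < m) (z ^+ 2 + z) ^+ (2 ^ i) = z ^+ (2 ^ m) + z.
    elim: m => [|m IH]; first by rewrite big_ord0 expr1 add2.
    rewrite big_ord_recr IH /= exprDn_pchar ?pchar2_nat // -exprM -expnS.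
    move: (z ^+ (2 ^ m)) (z ^+ (2 ^ m.+1)) => u1 u2.
    by rewrite -[RHS]addr0 -(add2 u1); ring.
  have : z ^+ Q + z = 1.
    rewrite eQ -tel ez -[RHS](expr1n _ 2) -trh expr_sum_pchar ?(@pchar2_nat _ 1) //.
    by apply: eq_bigr => i _; rewrite exprAC.
  by move/(congr1 (fun w => w + z)); rewrite -addrA add2 addr0 addrC.
have z1Q : (z + 1) ^+ Q = z by rewrite exprDn_pchar // zQ expr1n -addrA add2 addr0.
rewrite opprK; apply: (@size_conj_pairs_sub [:: tau * z; tau * (z + 1)]).
  rewrite /= inE andbT; apply/negP => /eqP /(mulfI t0) /eqP.
  by rewrite -subr_eq0 opprD addrA subrr sub0r oppr_eq0 oner_eq0.
have enu : tau * z * (tau * (z + 1)) = c ^+ 2.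
  have -> : c = h * tau by rewrite divfK.
  by rewrite exprMn -ez; ring.
have s1 : tau * z + tau * (z + 1) = tau by rewrite -mulrDr addrA add2 add0r mulr1.
have yz : (tau * z) ^+ Q = tau * (z + 1) by rewrite exprMn et zQ.
have yz1 : (tau * (z + 1)) ^+ Q = tau * z by rewrite exprMn et z1Q.
move=> y; rewrite !inE => /orP[] /eqP ->; rewrite mem_conj_pairs.
  by rewrite !(yz, yz1) s1 enu !eqxx.
by rewrite !(yz, yz1) addrC s1 mulrC enu !eqxx.
Qed.
End ConjPairs.

(** * The two families of norm-D elements and their count *)

Section Fibres.
Variables (W : closedFieldType) (q Q e : nat) (D eta : W).
Hypotheses (hq : [pchar W].-nat q) (q1 : (1 < q)%N).
Hypotheses (hQ : [pchar W].-nat Q) (Q1 : (1 < Q)%N) (he : [pchar W].-nat e) (e1 : (1 < e)%N).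
Hypotheses (DQ : D ^+ Q = D) (D0 : D != 0) (D1 : D != 1).
Hypotheses (eta2 : eta ^+ Q ^+ Q = eta) (etaQ : eta ^+ Q != eta).
Hypothesis fixq : forall j : W, j ^+ Q = j -> j ^+ e = j -> j ^+ q = j.

Let kappa := eta - eta ^+ Q.
Let theta := kappa ^+ e.-1.

(** For [m = r + eta], let [k] be the quotient of [m ^+ e + rho * m' ^+ e] by [m * (1 + rho)]. With
    Y = rho m'^e, the requirement that [k] be in F_Q prescribes [Y + Y ^+ Q], while
    [rho * rho ^+ Q = D] prescribes [Y * Y ^+ Q]. *)
Definition trace_pol (r : W) : W :=
  let m := r + eta in let m' := r + eta ^+ Q in
  (m ^+ e * m' - m' ^+ e * m - D * (m ^+ e.+1 - m' ^+ e.+1)) / kappa.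
Definition norm_pol (r : W) : W := D * ((r + eta) * (r + eta ^+ Q)) ^+ e.
(** The trace of [rho] for which [1 + rho] has norm [(1 - D) * theta * j ^+ e.-1]. *)
Definition det_pol (j : W) : W := (1 - D) * theta * j ^+ e.-1 - (1 + D).

(* For [D = delta ^+ (Q + 1)], this encodes a point of weight two: with [y] such that
   [(y ^+ Q / y) ^+ e = rho / delta], the elements [m * y] and [b * y] have the same
   image under [x |-> (x ^+ e + delta * x ^+ (Q * e)) / x]. *)
Definition weight_two_witness (rho m b : W) :=
  [/\ rho * rho ^+ Q = D, m ^+ Q ^+ Q = m & m ^+ Q != m] /\
  [/\ b ^+ Q = b, b != 0 & m ^+ e + rho * m ^+ Q ^+ e = b ^+ e.-1 * m * (1 + rho)].

Hypothesis none : forall rho m b, ~ weight_two_witness rho m b.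

Let e0 : (0 < e)%N. Proof. exact: ltnW. Qed.
Let ee : e.-1.+1 = e. Proof. exact: prednK. Qed.

Lemma kappa_neq0 : kappa != 0.
Proof. by rewrite subr_eq0 eq_sym. Qed.

Lemma rho_neqN1 rho : rho * rho ^+ Q = D -> 1 + rho != 0.
Proof.
move=> eD; apply: contra D1; rewrite addrC addr_eq0 => /eqP er.
by rewrite -eD er exprNn_pcharW // expr1n mulrNN mulr1.
Qed.

Lemma pair_to_fibre r Y : r ^+ Q = r -> Y \in conj_pairs Q (trace_pol r) (norm_pol r) ->
  let rho := Y / (r + eta ^+ Q) ^+ e in
  rho * rho ^+ Q = D /\
  exists k, k ^+ Q = k /\
    (r + eta) ^+ e + rho * (r + eta ^+ Q) ^+ e = k * (r + eta) * (1 + rho).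
Proof.
move=> er; rewrite mem_conj_pairs // => /and3P[/eqP eT /eqP eN /eqP YQ].
set m := r + eta; set m' := r + eta ^+ Q; move=> rho.
have mQ : m ^+ Q = m' by rewrite exprDn_pchar // er.
have m'Q : m' ^+ Q = m by rewrite exprDn_pchar // er eta2.
have mm : m - m' = kappa by rewrite /m /m' /kappa; ring.
have m0 : m != 0.
  apply: contraNneq etaQ => m0; have m'0 : m' = 0.
    by rewrite -mQ m0 expr0n; case: (Q) (pnat_pos hQ).
  have mm' : eta ^+ Q - eta = m' - m by rewrite /m /m'; ring.
  by rewrite -subr_eq0 mm' m0 m'0 subrr.
have m'0 : m' != 0.
  by apply: contraNneq m0 => m'0; rewrite -m'Q m'0 expr0n; case: (Q) (pnat_pos hQ).
have rQ : rho ^+ Q = Y ^+ Q / m ^+ e by rewrite expr_div_n exprAC m'Q.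
have rr : rho * rho ^+ Q = D.
  rewrite rQ /rho mulrACA eN -invfM /norm_pol -/m -/m' exprMn; field.
  by rewrite !expf_neq0.
split=> //; have r1 := rho_neqN1 rr.
have r1' : 1 + rho ^+ Q != 0.
  by rewrite -(expr1n _ Q) -exprDn_pchar // expf_neq0.
have eY : Y = rho * m' ^+ e by rewrite /rho divfK // expf_neq0.
have eYQ : Y ^+ Q = rho ^+ Q * m ^+ e by rewrite rQ divfK // expf_neq0.
have key : kappa * (Y + Y ^+ Q) = m ^+ e * m' - m' ^+ e * m - D * (m ^+ e.+1 - m' ^+ e.+1).
  by rewrite eT /trace_pol -/m -/m' mulrC divfK // kappa_neq0.
clearbody m m' rho.
exists ((m ^+ e + rho * m' ^+ e) / (m * (1 + rho))); split; last first.
  by rewrite -[RHS]mulrA [RHS]divfK ?mulf_neq0.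
rewrite expr_div_n !exprDn_pchar // !exprMn exprDn_pchar // expr1n ![_ ^+ e ^+ Q]exprAC mQ m'Q.
apply/eqP; rewrite eqr_div ?mulf_neq0 // -subr_eq0.
rewrite -[X in _ == X](subrr (kappa * (Y + Y ^+ Q))) {2}key -mm eYQ eY !exprS -rr.
by apply/eqP; ring.
Qed.

(* With [b := r2 - r1], subtracting the two equations of [pair_to_fibre] gives
   [k1 = k2 = b ^+ e.-1], hence a witness. *)
Lemma fibre_map_inj r1 r2 Y1 Y2 : r1 ^+ Q = r1 -> r2 ^+ Q = r2 ->
  Y1 \in conj_pairs Q (trace_pol r1) (norm_pol r1) ->
  Y2 \in conj_pairs Q (trace_pol r2) (norm_pol r2) ->
  Y1 / (r1 + eta ^+ Q) ^+ e = Y2 / (r2 + eta ^+ Q) ^+ e -> r1 = r2.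
Proof.
move=> er1 er2 Y1in Y2in eq12.
have [rr [k1 [k1Q]]] := pair_to_fibre er1 Y1in.
have [_ [k2 [k2Q]]] := pair_to_fibre er2 Y2in.
rewrite -eq12; set rho := Y1 / _ in eq12 rr *; set m := r1 + eta; set m' := r1 + eta ^+ Q.
move=> E2 E1; apply/eqP; rewrite eq_sym -subr_eq0; apply/negPn/negP => r12.
pose b := r2 - r1; have bQ : b ^+ Q = b by rewrite exprBn_pcharW // er1 er2.
have mQ : m ^+ Q = m' by rewrite exprDn_pchar // er1.
have m'Q : m' ^+ Q = m by rewrite exprDn_pchar // er1 eta2.
have r1n := rho_neqN1 rr.
have e2 : r2 + eta = m + b by rewrite /m /b; ring.
have e2' : r2 + eta ^+ Q = m' + b by rewrite /m' /b; ring.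
have bn : b != 0 by [].
have mnF : m' != m.
  by rewrite /m /m'; apply: contra etaQ => /eqP /addrI ->.
rewrite {}e2 {}e2' in E2; clearbody m m' b rho; rewrite !exprDn_pchar // in E2.
have E : (k1 - k2) * m = k2 * b - b ^+ e.
  apply: (mulIf r1n); apply/eqP; rewrite -subr_eq0; apply/eqP.
  transitivity (k1 * m * (1 + rho) - (k2 * (m + b) * (1 + rho) - b ^+ e * (1 + rho))); first by ring.
  by rewrite -E1 -E2; ring.
(* Otherwise [E] would express [m] through elements of F_Q. *)
have k12 : k1 = k2.
  apply/eqP; rewrite -subr_eq0; apply/negPn/negP => kn; case/negP: mnF.
  have -> : m = (k2 * b - b ^+ e) / (k1 - k2) by rewrite -E mulrAC divff // mul1r.
  rewrite -mQ {1}(_ : m = (k2 * b - b ^+ e) / (k1 - k2)); last by rewrite -E mulrAC divff // mul1r.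
  by rewrite expr_div_n !exprBn_pcharW // exprMn k1Q k2Q bQ [b ^+ e ^+ Q]exprAC bQ.
have kb : k1 = b ^+ e.-1.
  apply: (mulIf bn); rewrite -exprSr ee; move/eqP: E.
  by rewrite k12 subrr mul0r eq_sym subr_eq0 => /eqP.
case: (none (rho := rho) (m := m) (b := b)); split; first by split=> //; rewrite ?mQ ?m'Q.
by split=> //; rewrite mQ E1 kb.
Qed.

(** Combining the fibre equation with its conjugate ([E3]) ties [k] to the norm of [1 + rho]. If the
    trace of [rho] were [det_pol j], then [k] would be [j^-1 ^+ e.-1], and [b := j^-1] would
    complete a witness. *)
Lemma pair_not_det r Y j : r ^+ Q = r -> j ^+ Q = j -> j != 0 ->
  Y \in conj_pairs Q (trace_pol r) (norm_pol r) ->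
  forall rho, rho = Y / (r + eta ^+ Q) ^+ e -> rho + rho ^+ Q != det_pol j.
Proof.
move=> er ej j0 Yin rho erho; have [rr [k [kQ]]] := pair_to_fibre er Yin.
rewrite -erho {erho} in rr *; set m := r + eta; set m' := r + eta ^+ Q => E1.
apply/negP => /eqP ed.
have mQ : m ^+ Q = m' by rewrite exprDn_pchar // er.
have m'Q : m' ^+ Q = m by rewrite exprDn_pchar // er eta2.
have mm : m - m' = kappa by rewrite /m /m' /kappa; ring.
have mnF : m' != m.
  by rewrite /m /m'; apply: contra etaQ => /eqP /addrI ->.
clearbody m m'.
have E2 : m' ^+ e + rho ^+ Q * m ^+ e = k * m' * (1 + rho ^+ Q).
  have := congr1 (fun z => z ^+ Q) E1 => /=.
  by rewrite exprDn_pchar // !exprMn exprDn_pchar // expr1n ![_ ^+ e ^+ Q]exprAC mQ m'Q kQ.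
have K : kappa ^+ e = m ^+ e - m' ^+ e by rewrite -mm exprBn_pcharW.
have n1 : (1 + rho) * (1 + rho ^+ Q) = (1 - D) * theta * j ^+ e.-1.
  transitivity (1 + (rho + rho ^+ Q) + rho * rho ^+ Q); first by ring.
  by rewrite ed rr /det_pol; ring.
have E3 : k * ((1 + rho) * (1 + rho ^+ Q)) * kappa = (1 - D) * kappa ^+ e.
  transitivity (k * m * (1 + rho) * (1 + rho ^+ Q) - k * m' * (1 + rho ^+ Q) * (1 + rho)).
    by rewrite -mm; ring.
  by rewrite -E1 -E2 K -rr; ring.
have kj : k * j ^+ e.-1 = 1.
  have D1' : 1 - D != 0 by rewrite subr_eq0 eq_sym.
  apply: (mulIf (mulf_neq0 D1' (expf_neq0 e kappa_neq0))); rewrite mul1r -[RHS]E3 n1.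
  have ke : kappa ^+ e = theta * kappa by rewrite /theta -exprSr ee.
  by rewrite ke; ring.
case: (none (rho := rho) (m := m) (b := j^-1)); split.
  by split=> //; rewrite ?mQ ?m'Q.
split; rewrite ?invr_eq0 ?exprVn ?ej // mQ E1; congr (_ * _ * _).
by apply: (mulIf (expf_neq0 e.-1 j0)); rewrite kj mulVf // expf_neq0.
Qed.
Lemma det_pol_neq0 rho j : rho * rho ^+ Q = D -> rho + rho ^+ Q = det_pol j -> j != 0.
Proof.
move=> rr ed; apply/negP => /eqP j0; have r1 := rho_neqN1 rr.
have : (1 + rho) * (1 + rho) ^+ Q = 0.
  rewrite exprDn_pchar // expr1n.
  transitivity (1 + (rho + rho ^+ Q) + rho * rho ^+ Q); first by ring.
  rewrite ed rr /det_pol j0.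
  have -> : 0 ^+ e.-1 = 0 :> W by rewrite expr0n; case: (e) e1 => [|[]].
  by rewrite mulr0 sub0r; ring.
by apply/eqP; rewrite mulf_neq0 ?expf_neq0.
Qed.

Let hits rho : pred W := fun j => rho + rho ^+ Q == det_pol j.

(** Two solutions have equal powers [j ^+ e.-1], so their ratio is fixed by both Frobenius powers
    and is a nonzero element of F_q. *)
Lemma count_det_pol rho : rho * rho ^+ Q = D ->
  (count (hits rho) (fixs W Q) <= q.-1 * has (hits rho) (fixs W Q))%N.
Proof.
move=> rr; have [/hasP[j0 j0Q /eqP ed0]|] := boolP (has _ _); last first.
  by rewrite has_count -leqNgt => /leq_trans -> //.
rewrite muln1 -size_filter; have j0n := det_pol_neq0 rr ed0.
rewrite mem_fixs // in j0Q; move/eqP: j0Q => j0Q.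
rewrite -(size_map (fun j => j / j0)).
have -> : q.-1 = size (rem 0 (fixs W q)).
  by rewrite size_rem ?size_fixs // mem_fixs // expr0n; case: (q) q1.
apply: uniq_leq_size.
  rewrite map_inj_uniq ?filter_uniq ?uniq_fixs //.
  by apply: mulIf; rewrite invr_eq0.
move=> _ /mapP[j jin ->]; move: jin; rewrite mem_filter mem_fixs // => /andP[/eqP ed /eqP jQ].
have jn := det_pol_neq0 rr ed.
rewrite rem_filter ?uniq_fixs // mem_filter /= mulf_neq0 ?invr_eq0 //= mem_fixs //.
apply/eqP/fixq; first by rewrite expr_div_n jQ j0Q.
have D1' : 1 - D != 0 by rewrite subr_eq0 eq_sym.
have th0 : theta != 0 by rewrite expf_neq0 ?kappa_neq0.
have ej : j ^+ e.-1 = j0 ^+ e.-1.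
  apply: (mulfI (mulf_neq0 D1' th0)); apply: (addIr (- (1 + D))).
  by rewrite -/(det_pol j) -/(det_pol j0) -ed -ed0.
have eS (z : W) : z ^+ e = z * z ^+ e.-1 by rewrite -exprS ee.
by rewrite expr_div_n !eS ej invfM mulrACA divff ?expf_neq0 ?mulr1.
Qed.

(** [L1] lists the first family, repetition-free by [fibre_map_inj]; [A1] lists the elements met by
    the second, disjoint from [L1] by [pair_not_det]. Both lie among the roots of X^(Q+1) - D. *)
Lemma fibre_count :
  (q.-1 * (\sum_(r <- fixs W Q) size (conj_pairs Q (trace_pol r) (norm_pol r)))
   + \sum_(j <- fixs W Q) size (conj_pairs Q (det_pol j) D) <= q.-1 * Q.+1)%N.
Proof.
have Q21 : (1 < Q ^ 2)%N by rewrite -(expn0 Q) ltn_exp2l.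
have hQ2 : [pchar W].-nat (Q ^ 2)%N by rewrite pnatX hQ.
pose U := [seq rho <- fixs W (Q ^ 2) | rho * rho ^+ Q == D].
pose hasj rho := has (hits rho) (fixs W Q).
pose L1 := [seq Y / (r + eta ^+ Q) ^+ e |
  r <- fixs W Q, Y <- conj_pairs Q (trace_pol r) (norm_pol r)].
have uU : uniq U by rewrite filter_uniq ?uniq_fixs.
have sU : (size U <= Q.+1)%N.
  have sp : size ('X^(Q.+1) - D%:P : {poly W}) = Q.+2 by rewrite size_XnsubC.
  rewrite -ltnS -sp max_poly_roots ?uU -?size_poly_gt0 ?sp //.
  by apply/allP => z; rewrite mem_filter /root !(hornerE, horner_exp) subr_eq0 exprS => /andP[].
have uL1 : uniq L1.
  apply: allpairs_uniq_dep; first exact: uniq_fixs.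
    by move=> r _; apply: uniq_conj_pairs.
  move=> _ _ /allpairsPdep[r1 [Y1 [r1in Y1in ->]]] /allpairsPdep[r2 [Y2 [r2in Y2in ->]]] /=.
  move: r1in r2in; rewrite !mem_fixs // => /eqP er1 /eqP er2 E.
  have er := fibre_map_inj er1 er2 Y1in Y2in E; rewrite -er in Y2in E *; congr existT.
  apply: (mulIf _ E); rewrite invr_eq0 expf_neq0 //; apply: contra etaQ => /eqP z.
  have -> : eta ^+ Q = - r1 by apply/eqP; rewrite -addr_eq0 addrC z.
  by rewrite -eta2 (_ : eta ^+ Q = - r1) ?exprNn_pcharW ?er1 //; apply/eqP; rewrite -addr_eq0 addrC z.
pose A1 := [seq rho <- U | hasj rho].
have sL1 : size L1 = (\sum_(r <- fixs W Q) size (conj_pairs Q (trace_pol r) (norm_pol r)))%N.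
  by rewrite size_allpairs_dep sumnE big_map.
have L1U : {subset L1 <= U}.
  move=> _ /allpairsPdep[r [Y [rin Yin ->]]]; rewrite mem_fixs // in rin; move/eqP: rin => er.
  have [rr _] := pair_to_fibre er Yin; rewrite mem_filter rr eqxx mem_fixs //=.
  have rn : Y / (r + eta ^+ Q) ^+ e != 0.
    by apply: contraNneq D0 => z; rewrite -rr z mul0r.
  apply/eqP/(mulfI (expf_neq0 Q rn)); rewrite -mulnn exprM -exprMn rr DQ.
  by rewrite mulrC rr.
have A1U : {subset A1 <= U} by move=> z; rewrite mem_filter => /andP[].
have dis : uniq (L1 ++ A1).
  rewrite cat_uniq uL1 filter_uniq // andbT; apply/hasPn => z.
  rewrite mem_filter => /andP[/hasP[j jin /eqP ed] _]; apply/negP.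
  move=> /allpairsPdep[r [Y [rin Yin ez]]]; rewrite !mem_fixs // in rin jin.
  move/eqP: rin => er; move/eqP: jin => ej.
  have [rr _] := pair_to_fibre er Yin; rewrite -ez in rr.
  have j0 := det_pol_neq0 rr ed.
  by case/negP: (pair_not_det er ej j0 Yin ez); rewrite ed.
have tot : (size L1 + size A1 <= Q.+1)%N.
  rewrite -size_cat; apply: leq_trans sU; apply: uniq_leq_size => // z.
  by rewrite mem_cat => /orP[/L1U|/A1U].
have s2 : (\sum_(j <- fixs W Q) size (conj_pairs Q (det_pol j) D) <= q.-1 * size A1)%N.
  have -> : (\sum_(j <- fixs W Q) size (conj_pairs Q (det_pol j) D) =
      \sum_(rho <- U) count (hits rho) (fixs W Q))%N.
    under [RHS]eq_bigr do rewrite -sum1_count big_mkcond.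
    rewrite [RHS]exchange_big; apply: eq_bigr => j _ /=.
    rewrite -big_mkcond sum1_count /conj_pairs size_filter count_filter.
    by apply: eq_count => z; rewrite /hits /= andbC.
  rewrite size_filter -sum1_count [X in (_ * X)%N]big_mkcond [leqRHS]big_distrr /=.
  rewrite big_seq [leqRHS]big_seq; apply: leq_sum => rho; rewrite mem_filter => /andP[/eqP rr _].
  apply: leq_trans (count_det_pol rr) _; rewrite /hasj.
  by case: (has _ _); rewrite ?muln1 ?muln0.
rewrite -sL1; apply: leq_trans (_ : q.-1 * (size L1 + size A1) <= _)%N.
  by rewrite mulnDr leq_add2l.
by rewrite leq_mul2l tot orbT.
Qed.

End Fibres.

Lemma size_polyD_leq (R : nzRingType) (p q : {poly R}) (n : nat) :
  (size p <= n)%N -> (size q <= n)%N -> (size (p + q)%R <= n)%N.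
Proof. by move=> sp sq; rewrite (leq_trans (size_polyD _ _)) // geq_max sp. Qed.

Lemma size_CM_leq (R : nzRingType) (c : R) (p : {poly R}) (n : nat) :
  (size p <= n)%N -> (size (c%:P * p)%R <= n)%N.
Proof. by move=> sp; rewrite mul_polyC (leq_trans (size_scale_leq _ _)). Qed.

(** If f = h^2, then [h] divides the derivative and is coprime to [u], so it divides [v], whose
    degree is smaller than that of [h]. *)
Lemma nonsquare_of_deriv (F : fieldType) (f u v : {poly F}) (d : nat) :
  size f = (2 * d).+1 -> f^`() = u * v -> coprimep f u -> v != 0 -> (size v <= d)%N ->
  forall a b : {poly F}, f * a ^+ 2 = b ^+ 2 -> a = 0.
Proof.
move=> sf ef cop v0 sv a b E; apply/eqP/negPn/negP => a0.
have /dvdpP[h eb] : a %| b by rewrite -(dvdp_pexp2r _ _ (isT : (0 < 2)%N)) -E dvdp_mull.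
have fh : f = h ^+ 2.
  by apply: (mulIf (expf_neq0 2 a0)); rewrite E eb exprMn.
have hf : h %| f by rewrite fh expr2 dvdp_mulr.
have hv : h %| v.
  have cu : coprimep h u by apply: coprimep_dvdr cop; rewrite ?hf.
  by rewrite -(Gauss_dvdpr _ cu) -ef fh deriv_exp /= -mulr_natl !dvdp_mull.
have := dvdp_leq v0 hv; apply/negP; rewrite -ltnNge (leq_ltn_trans sv) //.
have h0 : (0 < size h)%N.
  by rewrite size_poly_gt0; apply: contra_eq_neq sf => h0; rewrite fh h0 expr0n size_poly0.
by have := size_exp h 2; rewrite -fh sf /=; move: h0; move: (size h) => m; lia.
Qed.

(** * The discriminants and their character sums *)

Section PolClosed.
Variables (W : closedFieldType) (Q e : nat) (D eta : W).
Hypotheses (hQ : [pchar W].-nat Q) (Q1 : (1 < Q)%N) (he : [pchar W].-nat e) (e1 : (1 < e)%N).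
Hypotheses (DQ : D ^+ Q = D) (D0 : D != 0) (D1 : D != 1).
Hypotheses (eta2 : eta ^+ Q ^+ Q = eta) (etaQ : eta ^+ Q != eta).

Let kappa := eta - eta ^+ Q.
Let theta := kappa ^+ e.-1.
Local Notation tp := (trace_pol Q e D eta).
Local Notation np := (norm_pol Q e D eta).

Lemma kappaQ : kappa ^+ Q = - kappa.
Proof. by rewrite exprBn_pcharW // eta2 opprB. Qed.

Lemma trace_pol_fixed r : r ^+ Q = r -> tp r ^+ Q = tp r.
Proof.
move=> er; have mQ : (r + eta) ^+ Q = r + eta ^+ Q by rewrite exprDn_pchar // er.
have m'Q : (r + eta ^+ Q) ^+ Q = r + eta by rewrite exprDn_pchar // er eta2.
have k0 := kappa_neq0 etaQ; rewrite /trace_pol -/kappa in k0 *.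
move: (r + eta) (r + eta ^+ Q) mQ m'Q => m m' mQ m'Q.
rewrite expr_div_n kappaQ !exprBn_pcharW // !exprMn !exprBn_pcharW // DQ.
rewrite ![_ ^+ e ^+ Q]exprAC ![_ ^+ e.+1 ^+ Q]exprAC mQ m'Q.
by field; rewrite oppr_eq0 k0.
Qed.

Lemma norm_pol_fixed r : r ^+ Q = r -> np r ^+ Q = np r.
Proof.
move=> er; rewrite /norm_pol exprMn DQ exprAC exprMn !exprDn_pchar // er eta2.
by rewrite [X in X ^+ e]mulrC.
Qed.

(** The terms of degree [e + 1] cancel and the division by [kappa] is exact: an additive polynomial
    of degree [e] plus a constant remains. *)
Lemma trace_polE r : tp r = - (1 + D) * r ^+ e + (1 - D) * theta * r + tp 0.
Proof.
have k0 := kappa_neq0 etaQ; rewrite -/kappa in k0.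
have ke : theta * kappa = eta ^+ e - eta ^+ Q ^+ e.
  by rewrite -exprSr prednK ?(ltnW e1) // exprBn_pcharW.
rewrite /trace_pol -/kappa !exprS !exprDn_pchar // !add0r expr0n.
have -> : (e == 0)%N = false by case: (e) e1.
rewrite !add0r; apply: (mulIf k0); rewrite divfK // [RHS]mulrDl divfK // [in RHS]mulrDl.
have -> : (1 - D) * theta * r * kappa = (1 - D) * r * (eta ^+ e - eta ^+ Q ^+ e).
  by rewrite -ke; ring.
by rewrite /kappa; ring.
Qed.

Lemma theta_fixed : (2 \in [pchar W]) || odd e -> theta ^+ Q = theta.
Proof.
rewrite /theta exprAC kappaQ => /orP[h2|oe]; first by rewrite pchar2_opp.
rewrite exprNn -signr_odd; have -> : odd e.-1 = false by move: oe; case: (e) e1 => //= m _ /negbTE.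
by rewrite mul1r.
Qed.
End PolClosed.

Section OddSums.
Variables (W : closedFieldType) (Q e : nat) (D : W).
Hypotheses (hQ : [pchar W].-nat Q) (Q1 : (1 < Q)%N) (he : [pchar W].-nat e) (e1 : (1 < e)%N).
Hypotheses (oQ : odd Q) (oe : odd e) (DQ : D ^+ Q = D) (D0 : D != 0) (D1 : D != 1).

Let two0 : 2 != 0 :> W. Proof. exact: odd_pnat_two_neq0 hQ Q1 oQ. Qed.
Let e3 : (2 < e)%N. Proof. by move: oe; case: (e) e1 => [|[|[]]]. Qed.

(** With [eta] of trace 0, [trace_pol] has no constant term and [norm_pol] depends on
    [r ^+ 2 - eta ^+ 2] only. *)
Lemma exists_eta_odd : exists eta : W, eta != 0 /\ eta ^+ Q = - eta.
Proof.
have Q0 : (0 < Q.-1)%N by case: (Q) Q1 => [|[]].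
have [eta ee] := closed_nth_root (-1 : W) Q0; exists eta; split.
  apply: contra_eq_neq ee => ->; rewrite expr0n gtn_eqF //= eq_sym oppr_eq0.
  exact: oner_neq0.
by rewrite -(prednK (ltnW Q1)) exprS ee mulrN1.
Qed.

Lemma qsign_sqrM (c z : W) : c ^+ Q = c -> c != 0 -> z ^+ Q = z ->
  qsign Q (c ^+ 2 * z) = qsign Q z.
Proof.
move=> ec c0 ez; have ec2 : (c ^+ 2) ^+ Q = c ^+ 2 by rewrite exprAC ec.
rewrite (qsignM hQ Q1 oQ) // expr2 (qsignM hQ Q1 oQ) // {1 2}/qsign (negbTE c0).
by case: ifP; rewrite ?mulrNN ?mul1r.
Qed.

Lemma sum_conj_pairs_odd (tau nu : W -> W) (f : {poly W}) (c : W) (d : nat) :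
  (forall r, r ^+ Q = r -> tau r ^+ Q = tau r) ->
  (forall r, r ^+ Q = r -> nu r ^+ Q = nu r) ->
  (forall r, tau r ^+ 2 - 4 * nu r = c ^+ 2 * f.[r]) -> c ^+ Q = c -> c != 0 ->
  f \is monic -> size f = (2 * d).+1 -> finv Q f -> (0 < d)%N -> f.[0] != 0 ->
  (forall a b : {poly W}, f * a ^+ 2 = b ^+ 2 -> a = 0) ->
  exists2 S : int, Q%:R - S <= \sum_(r <- fixs W Q) (size (conj_pairs Q (tau r) (nu r)))%:R &
    S ^+ 2 <= ((2 * d).-1 ^ 2 * Q)%N%:R.
Proof.
move=> ht hn hf ec c0 mf sf ff d0 f0 nsq.
exists (\sum_(x <- fixs W Q) qsign Q f.[x]); last first.
  by apply: (weil_odd hQ Q1 oQ mf sf ff) => //; rewrite ?muln_gt0 // oddM.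
have -> : (Q%:R : int) = \sum_(x <- fixs W Q) 1.
  by rewrite big_const_seq count_predT size_fixs // iter_addr_0.
rewrite -sumrB big_seq [leRHS]big_seq; apply: ler_sum => r; rewrite mem_fixs // => /eqP er.
have fr : f.[r] ^+ Q = f.[r] by rewrite (finv_horner hQ) // er.
rewrite -(qsign_sqrM ec c0 fr) -hf; apply: size_conj_pairs_odd => //.
  exact: ht.
exact: hn.
Qed.

Lemma trace_norm_sums_odd : exists eta : W, [/\ eta ^+ Q ^+ Q = eta, eta ^+ Q != eta,
  exists2 S : int,
    Q%:R - S <= \sum_(r <- fixs W Q)
      (size (conj_pairs Q (trace_pol Q e D eta r) (norm_pol Q e D eta r)))%:R
    & S ^+ 2 <= ((2 * e).-1 ^ 2 * Q)%N%:R &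
  exists2 S : int,
    Q%:R - S <= \sum_(j <- fixs W Q) (size (conj_pairs Q (det_pol Q e D eta j) D))%:R
    & S ^+ 2 <= ((2 * e.-1).-1 ^ 2 * Q)%N%:R].
Proof.
have [eta [eta0 etaN]] := exists_eta_odd; exists eta.
have eta2 : eta ^+ Q ^+ Q = eta by rewrite etaN exprNn_pcharW // etaN opprK.
have etaQ : eta ^+ Q != eta.
  by rewrite etaN -subr_eq0 -opprD oppr_eq0 -mulr2n -mulr_natl mulf_neq0.
pose theta := (eta - eta ^+ Q) ^+ e.-1.
have th0 : theta != 0 by rewrite expf_neq0 // kappa_neq0.
have thQ : theta ^+ Q = theta by apply: theta_fixed => //; rewrite oe orbT.
have D1' : 1 - D != 0 by rewrite subr_eq0 eq_sym.
have fr2 : (2 : W) ^+ Q = 2 := rmorph_nat (frob hQ) 2.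
have fr4 : (4 : W) ^+ Q = 4 := rmorph_nat (frob hQ) 4.
have e4 : (4 : W) != 0 by rewrite (_ : 4 = 2 * 2) ?mulf_neq0 // -natrM.
have ez : e%:R = 0 :> {poly W} by rewrite (pnat_natr0 (pchar_poly_nat he) e1).
have dXe : ('X^e : {poly W})^`() = 0 by rewrite derivXn -mulr_natl ez mul0r.
have DQ1 : (1 - D) ^+ Q = 1 - D by rewrite exprBn_pcharW // expr1n DQ.
have DQ2 : (1 + D) ^+ Q = 1 + D by rewrite exprDn_pchar // expr1n DQ.
have sXe : size ('X^e ^+ 2 : {poly W}) = (2 * e).+1 by rewrite -exprM size_polyXn mulnC.
split=> //.
  (* The discriminant has leading coefficient (1 + D)^2 - 4 D = (1 - D)^2, a nonzero square; [f] is
     the discriminant divided by it. *)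
  pose a := 2 * (1 + D) * theta / (1 - D); pose b := theta ^+ 2.
  pose c := 4 * D * (eta ^+ 2) ^+ e / (1 - D) ^+ 2.
  pose rest : {poly W} := - (a%:P * ('X^e * 'X)) + b%:P * 'X^2 + c%:P.
  pose f : {poly W} := 'X^e ^+ 2 + rest.
  have aQ : a ^+ Q = a by rewrite expr_div_n !exprMn fr2 DQ2 thQ DQ1.
  have bQ : b ^+ Q = b by rewrite exprAC thQ.
  have cQ : c ^+ Q = c.
    have eta2Q : (eta ^+ 2) ^+ Q = eta ^+ 2 by rewrite exprAC etaN sqrrN.
    rewrite /c expr_div_n exprMn [(4 * D) ^+ Q]exprMn fr4 DQ.
    by rewrite [(eta ^+ 2 ^+ e) ^+ Q]exprAC eta2Q [((1 - D) ^+ 2) ^+ Q]exprAC DQ1.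
  have srest : (size rest < (2 * e).+1)%N.
    rewrite ltnS !size_polyD_leq ?size_polyN ?size_CM_leq -?exprSr ?size_polyXn //.
    - by move: e3; clear; lia.
    - by move: e3; clear; lia.
    - by rewrite (leq_trans (size_polyC_leq1 _)) // muln_gt0 (ltnW e1).
  have sf : size f = (2 * e).+1 by rewrite size_polyDl sXe.
  have mf : f \is monic.
    by rewrite monicE lead_coefDl ?sXe // -exprM lead_coefXn.
  have c0 : c != 0 by rewrite !mulf_neq0 ?invr_eq0 ?expf_neq0.
  have f0 : f.[0] = c.
    rewrite /f /rest !(hornerE, horner_exp) !expr0n; have -> : (e == 0)%N = false by case: (e) e1.
    by rewrite /= !mulr0 expr0n oppr0 !add0r.
  apply: (@sum_conj_pairs_odd _ _ f (1 - D) e) => //.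
  - exact: trace_pol_fixed.
  - exact: norm_pol_fixed.
  - move=> r; rewrite trace_polE // -/theta.
    have -> : trace_pol Q e D eta 0 = 0.
      rewrite /trace_pol !add0r etaN !exprS (exprNn_pcharW eta he).
      move: (eta ^+ e) => t; rewrite (_ : _ - _ - _ = 0) ?mul0r //; ring.
    rewrite /norm_pol etaN (_ : (r + eta) * (r - eta) = r ^+ 2 - eta ^+ 2); last by ring.
    rewrite exprBn_pcharW // [(r ^+ 2) ^+ e]exprAC /f /rest !(hornerE, horner_exp) /a /b /c.
    by move: (r ^+ e) ((eta ^+ 2) ^+ e) => t1 t2 /=; field.
  - by rewrite /f /rest !(finvD, finvN, finvM, finvXn, finvX, finvC).
  - by rewrite ltnW.
  - by rewrite f0.
  (* As [e] is 0 in [W], differentiation leaves only the terms coming from 'X^(e+1) and 'X^2. *)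
  - apply: (@nonsquare_of_deriv _ f 'X ((2 * b)%:P - a%:P * 'X^(e.-1)) e) => //.
    + have eX : 'X^e = 'X * 'X^(e.-1) :> {poly W} by rewrite -exprS prednK // ltnW.
      have d1 : ('X^e ^+ 2 : {poly W})^`() = 0 by rewrite deriv_exp dXe !mul0r mul0rn.
      have d2 : ('X^e * 'X : {poly W})^`() = 'X^e.
        by rewrite derivM dXe derivX mul0r add0r mulr1.
      rewrite /f /rest !derivD d1 derivN [(a%:P * _)^`()]derivM d2 [(b%:P * _)^`()]derivM.
      by rewrite derivXn !derivC /= eX polyCM; ring.
    + by rewrite coprimep_sym coprimep_roots ?polyX_eq0 // => x; rewrite /root hornerX => /eqP ->; rewrite f0.
    + apply/eqP => /(congr1 (fun p : {poly W} => p.[0])); rewrite hornerD hornerN hornerM !hornerC hornerXn expr0n.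
      have -> : (e.-1 == 0)%N = false by case: (e) e1 => [|[]].
      by rewrite mulr0 subr0; apply/eqP/mulf_neq0 => //; apply: expf_neq0.
    + rewrite size_polyD_leq ?size_polyN ?size_CM_leq ?size_polyXn //.
        by rewrite (leq_trans (size_polyC_leq1 _)) // ltnW.
      by rewrite prednK // ltnW.
pose a := 2 * (1 + D) / ((1 - D) * theta); pose c := (theta ^+ 2)^-1.
pose f : {poly W} := 'X^(e.-1) ^+ 2 + (- (a%:P * 'X^(e.-1)) + c%:P).
have e10 : (0 < e.-1)%N by case: (e) e1 => [|[]].
have aQ : a ^+ Q = a by rewrite expr_div_n !exprMn fr2 DQ2 thQ DQ1.
have cQ : c ^+ Q = c by rewrite exprVn exprAC thQ.
have sX : size ('X^(e.-1) ^+ 2 : {poly W}) = (2 * e.-1).+1 by rewrite -exprM size_polyXn mulnC.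
have srest : (size (- (a%:P * 'X^(e.-1)) + c%:P)%R < (2 * e.-1).+1)%N.
  rewrite ltnS size_polyD_leq ?size_polyN ?size_CM_leq ?size_polyXn //; first by move: e10; clear; lia.
  by rewrite (leq_trans (size_polyC_leq1 _)) // muln_gt0.
have sf : size f = (2 * e.-1).+1 by rewrite size_polyDl sX.
have mf : f \is monic by rewrite monicE lead_coefDl ?sX // -exprM lead_coefXn.
have fE x : f.[x] = (x ^+ e.-1) ^+ 2 - a * x ^+ e.-1 + c.
  by rewrite /f !hornerD hornerN !horner_exp hornerM !hornerC horner_exp hornerX addrA.
have f0 : f.[0] = c by rewrite fE expr0n gtn_eqF //= mulr0 expr0n subr0 add0r.
have c0 : c != 0 by rewrite invr_eq0 expf_neq0.
apply: (@sum_conj_pairs_odd _ (fun=> D) f ((1 - D) * theta) e.-1) => //.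
- by move=> j jQ; rewrite /det_pol -/theta exprBn_pcharW // !exprMn DQ1 DQ2 thQ exprAC jQ.
- by move=> j; rewrite fE /det_pol -/theta /a /c; field; rewrite th0 D1'.
- by rewrite exprMn DQ1 thQ.
- by rewrite mulf_neq0.
- by rewrite /f !(finvD, finvN, finvM, finvXn, finvX, finvC).
- by rewrite f0.
(* Here [f] is separable: at a double root [x ^+ e.-1] would equal [a / 2], forcing (1 + D)^2 = (1 -
   D)^2 and hence 4 D = 0. *)
apply: (@nonsquare_of_deriv _ f f^`() 1 e.-1) => //; rewrite ?mulr1 ?oner_neq0 ?size_poly1 //.
apply: coprimep_roots => [|x rx]; first exact: monic_neq0.
have x0 : x != 0 by apply: contraTneq rx => ->; rewrite /root f0.
have -> : f^`() = (2 * 'X^(e.-1) - a%:P) * 'X^(e.-1)^`().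
  have d1 : ('X^(e.-1) ^+ 2 : {poly W})^`() = 2 * 'X^(e.-1) * 'X^(e.-1)^`().
    by rewrite expr2 derivM; move: ('X^(e.-1)^`()) => t; ring.
  rewrite /f !derivD d1 derivN [(a%:P * _)^`()]derivM !derivC.
  by move: ('X^(e.-1)^`()) => t; ring.
have en : e.-1%:R = -1 :> W.
  by apply/eqP; rewrite -addr_eq0 natr1 prednK ?(ltnW e1) // (pnat_natr0 he e1).
rewrite /root !hornerE derivXn hornerMn !hornerXn -mulr_natl en mulN1r mulf_neq0 ?oppr_eq0 ?expf_neq0 //.
apply: contraTneq rx => /eqP; rewrite subr_eq0 => /eqP ea.
rewrite /root fE -ea (_ : _ - _ + c = c - (x ^+ e.-1) ^+ 2); last by ring.
rewrite subr_eq0; have -> : x ^+ e.-1 = (1 + D) / ((1 - D) * theta).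
  by apply: (mulfI two0); rewrite ea /a mulrA.
apply/negP => /eqP E0; have E : (1 + D) ^+ 2 = (1 - D) ^+ 2.
  have -> : (1 + D) ^+ 2 = ((1 + D) / ((1 - D) * theta)) ^+ 2 * ((1 - D) * theta) ^+ 2.
    by rewrite expr_div_n divfK // expf_neq0 // mulf_neq0.
  by rewrite -E0 /c; field.
have : 4 * D = 0 by rewrite (_ : 4 * D = (1 + D) ^+ 2 - (1 - D) ^+ 2); [rewrite E subrr | ring].
by apply/eqP; rewrite mulf_neq0.
Qed.
End OddSums.

Section EvenSums.
Variables (W : closedFieldType) (h2 : 2 \in [pchar W]) (r s : nat).
Let Q := (2 ^ r)%N.
Let e := (2 ^ s.+1)%N.
Variable D : W.
Hypotheses (r0 : (0 < r)%N) (eQ : (e < Q)%N).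
Hypotheses (DQ : D ^+ Q = D) (D0 : D != 0) (D1 : D != 1).

Let hQ : [pchar W].-nat Q. Proof. exact: pchar2_nat. Qed.
Let he : [pchar W].-nat e. Proof. exact: pchar2_nat. Qed.
Let Q1 : (1 < Q)%N. Proof. by rewrite /Q -(expn0 2) ltn_exp2l. Qed.
Let e1 : (1 < e)%N. Proof. by rewrite /e -(expn0 2) ltn_exp2l. Qed.
Let opp2 (z : W) : - z = z. Proof. exact: pchar2_opp. Qed.
Let add2 (z : W) : z + z = 0. Proof. by rewrite -{2}[z]opp2 subrr. Qed.
Let D1n : 1 + D != 0. Proof. by rewrite -[D]opp2 subr_eq0 eq_sym. Qed.
Let DQ2 : (1 + D) ^+ Q = 1 + D. Proof. by rewrite exprDn_pchar // expr1n DQ. Qed.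

(** The constant part [k] of [c / tau] is split off so that [C / A] is a proper fraction; it only
    multiplies the whole sum by a sign. *)
Lemma sum_conj_pairs_even (tau c : W -> W) (A C : {poly W}) (G : nat) (x0 k u : W) :
  (forall x, x ^+ Q = x -> tau x ^+ Q = tau x) ->
  (forall x, x ^+ Q = x -> c x ^+ Q = c x) ->
  u != 0 -> (forall x, x ^+ Q = x -> tau x = u * A.[x]) ->
  (forall x, x ^+ Q = x -> A.[x] != 0 -> c x / tau x = k + C.[x] / A.[x]) ->
  k ^+ Q = k ->
  A \is monic -> size A = G.+1 -> finv Q A -> (0 < G)%N -> (size C <= G)%N -> finv Q C ->
  A.[0] != 0 -> (forall t, root A t -> A^`().[t] != 0) -> root A x0 -> C.[x0] != 0 ->
  exists2 S : int, Q%:R - S <= \sum_(x <- fixs W Q) (size (conj_pairs Q (tau x) (c x ^+ 2)))%:R &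
    S ^+ 2 <= ((2 * G).-1 ^ 2 * Q)%N%:R.
Proof.
move=> ht hc u0 etau ec kQ mA sA hA G0 sC hC A0 sep rx Cx.
pose T (x : W) : int := if A.[x] == 0 then 0 else tsign r (C.[x] / A.[x]).
exists (tsign r k * \sum_(x <- fixs W Q) T x); last first.
  have -> : (tsign r k * \sum_(x <- fixs W Q) T x) ^+ 2 = (\sum_(x <- fixs W Q) T x) ^+ 2.
    by rewrite exprMn /tsign; case: ifP => _; rewrite ?sqrrN ?expr1n mul1r.
  exact: (weil_even h2 r0 mA sA hA G0 sC hC A0 sep rx Cx).
have -> : (Q%:R : int) = \sum_(x <- fixs W Q) 1.
  by rewrite big_const_seq count_predT size_fixs // iter_addr_0.
rewrite mulr_sumr -sumrB big_seq [leRHS]big_seq; apply: ler_sum => x; rewrite mem_fixs // => /eqP ex.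
apply: le_trans (size_conj_pairs_even hQ Q1 h2 (erefl Q) (ht x ex) (hc x ex)).
rewrite lerD2l lerN2 /T etau // mulf_eq0 (negbTE u0) /=.
have [_|Ax] := eqVneq A.[x] 0; first by rewrite mulr0.
rewrite -etau // ec // (tsignD h2) //.
by rewrite -/Q expr_div_n !(finv_horner hQ) // ex.
Qed.

(** Adding [b] in F_Q to [eta] translates [trace_pol] by [b], and a polynomial of degree [e < Q]
    cannot vanish on all of F_Q. The nonzero value at 0 supplies the condition on [A.[0]] in Weil's
    bound. *)
Lemma exists_eta_even : exists eta : W, eta ^+ Q = eta + 1 /\ trace_pol Q e D eta 0 != 0.
Proof.
have /closed_rootP[eta0] : size ('X^Q - 'X - 1%:P : {poly W}) != 1.
  rewrite -addrA size_polyDl ?size_polyXn; first by move: Q1; case: (Q).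
  rewrite ltnS size_polyD_leq ?size_polyN ?size_polyX //.
  by rewrite (leq_trans (size_polyC_leq1 _)) // ltnW.
rewrite /root !(hornerE, horner_exp) -addrA -opprD subr_eq0 => /eqP e0.
have eta2 : eta0 ^+ Q ^+ Q = eta0 by rewrite e0 exprDn_pchar // e0 expr1n -addrA add2 addr0.
have etaQ : eta0 ^+ Q != eta0 by rewrite e0 -subr_eq0 addrC addKr oner_neq0.
pose P : {poly W} := (- (1 + D))%:P * 'X^e + (((1 - D) * (eta0 - eta0 ^+ Q) ^+ e.-1)%:P * 'X + (trace_pol Q e D eta0 0)%:P).
have sP : size P = e.+1.
  have s1 : size ((- (1 + D))%:P * 'X^e) = e.+1.
    by rewrite mul_polyC size_scale ?oppr_eq0 // size_polyXn.
  rewrite /P size_polyDl s1 // ltnS.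
  rewrite size_polyD_leq ?size_CM_leq ?size_polyX //.
  by rewrite (leq_trans (size_polyC_leq1 _)) // ltnW.
have [/allP h|] := boolP (all (root P) (fixs W Q)).
  have : (size (fixs W Q) < size P)%N.
    by rewrite max_poly_roots -?size_poly_gt0 ?sP ?uniq_fixs //; apply/allP.
  by rewrite size_fixs // sP ltnS leqNgt eQ.
case/allPn => b; rewrite mem_fixs // => /eqP bQ rb; exists (eta0 + b).
have eQb : (eta0 + b) ^+ Q = eta0 ^+ Q + b by rewrite exprDn_pchar // bQ.
split; first by rewrite eQb e0 addrAC.
have -> : trace_pol Q e D (eta0 + b) 0 = trace_pol Q e D eta0 b.
  rewrite /trace_pol eQb !add0r ![b + _]addrC; congr (_ / _).
  by rewrite opprD addrACA subrr addr0.
by move: rb; rewrite trace_polE // /root /P !hornerD !hornerM !hornerC horner_exp !hornerX addrA.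
Qed.

Lemma trace_norm_sums_even : exists eta : W, [/\ eta ^+ Q ^+ Q = eta, eta ^+ Q != eta,
  exists2 S : int,
    Q%:R - S <= \sum_(x <- fixs W Q)
      (size (conj_pairs Q (trace_pol Q e D eta x) (norm_pol Q e D eta x)))%:R
    & S ^+ 2 <= ((2 * e).-1 ^ 2 * Q)%N%:R &
  exists2 S : int,
    Q%:R - S <= \sum_(j <- fixs W Q) (size (conj_pairs Q (det_pol Q e D eta j) D))%:R
    & S ^+ 2 <= ((2 * e.-1).-1 ^ 2 * Q)%N%:R].
Proof.
have [eta [etaE tp0]] := exists_eta_even; exists eta.
have eta2 : eta ^+ Q ^+ Q = eta by rewrite etaE exprDn_pchar // etaE expr1n -addrA add2 addr0.
have etaQ : eta ^+ Q != eta by rewrite etaE -subr_eq0 addrC addKr oner_neq0.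
have kap : eta - eta ^+ Q = 1 by rewrite etaE opprD addrA subrr sub0r opp2.
(* [D] has a square root in F_Q and [e] is even, so the norms of both families are squares, as
   [sum_conj_pairs_even] requires. *)
have [d ed] := closed_nth_root D (isT : (0 < 2)%N).
have dQ : d ^+ Q = d.
  by apply: (exprp_inj (@pchar2_nat _ 1 h2)); rewrite /= exprAC ed DQ.
pose k := d / (1 + D); have kQ : k ^+ Q = k by rewrite expr_div_n dQ DQ2.
have d0 : d != 0 by apply: contraNneq D0 => z; rewrite -ed z expr0n.
have k0 : k != 0 by rewrite mulf_neq0 ?invr_eq0.
have e10 : (0 < e.-1)%N by case: (e) e1 => [|[]].
have en : (e == 0)%N = false by rewrite gtn_eqF // ltnW.
have ez : e%:R = 0 :> {poly W} by rewrite (pnat_natr0 (pchar_poly_nat he) e1).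
have dXe : ('X^e : {poly W})^`() = 0 by rewrite derivXn -mulr_natl ez mul0r.
split=> //.
  pose c' := trace_pol Q e D eta 0 / (1 + D).
  have tpE x : trace_pol Q e D eta x = (1 + D) * (x ^+ e + (x + c')).
    rewrite trace_polE // kap expr1n mulr1 !opp2 /c'.
    by rewrite addrA mulrDr [in RHS]mulrDr mulrC [X in _ = _ + X]mulrC divfK // mulrC.
  have c'Q : c' ^+ Q = c'.
    by rewrite expr_div_n DQ2 trace_pol_fixed // expr0n; case: (Q) Q1.
  have c'0 : c' != 0 by rewrite mulf_neq0 ?invr_eq0.
  pose h := (2 ^ s)%N; have eh : e = (h * 2)%N by rewrite /e expnSr.
  have hh : [pchar W].-nat h by apply: pchar2_nat.
  pose N := (eta * (eta + 1)) ^+ h.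
  have NQ : N ^+ Q = N by rewrite exprAC exprMn exprDn_pchar // expr1n etaE -addrA add2 addr0 mulrC.
  pose cc x := d * ((x + eta) * (x + eta ^+ Q)) ^+ h.
  have ccE x : cc x = d * (x ^+ e + x ^+ h + N).
    have ex : x ^+ e = (x ^+ 2) ^+ h by rewrite -exprM mulnC -eh.
    rewrite /cc /N ex -!exprDn_pchar // etaE; congr (_ * _ ^+ _).
    by rewrite -[RHS]addr0 -(add2 (x * eta)); ring.
  pose A : {poly W} := 'X^e + ('X + c'%:P).
  pose C : {poly W} := k%:P * ('X^h + 'X + (N + c')%:P).
  have sX : (size ('X + c'%:P)%R < size ('X^e : {poly W}))%N.
    by rewrite size_polyXn ltnS size_XaddC.
  have AE x : A.[x] = x ^+ e + (x + c') by rewrite !(hornerE, horner_exp).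
  have nE x : norm_pol Q e D eta x = cc x ^+ 2.
    by rewrite /norm_pol /cc [RHS]exprMn ed -exprM -eh.
  have [x0 rx0] : exists x0, root A x0.
    apply/closed_rootP; rewrite size_polyDl // size_polyXn eqSS en //.
  have trx0 : trace_pol Q e D eta x0 = 0 by rewrite tpE -AE (rootP rx0) mulr0.
  (* The root [x0] of [A] is a genuine pole: [C.[x0]] is [k] times a power of
     [(x0 + eta) * (x0 + eta ^+ Q)]. If one factor vanished, the other would be 1 and [trace_pol] at
     [x0] would be [D] up to sign. *)
  have ne1 : x0 + eta != 0.
    apply/eqP => z; case/eqP: D0; rewrite -[RHS]trx0 /trace_pol z kap divr1 !expr0n en /=.
    have -> : x0 + eta ^+ Q = 1 by rewrite etaE addrA z add0r.
    by rewrite !expr1n; ring.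
  have ne2 : x0 + eta ^+ Q != 0.
    apply/eqP => z; case/eqP: D0; rewrite -[RHS]opp2 -[in RHS]trx0 /trace_pol z kap divr1 !expr0n en /=.
    have -> : x0 + eta = 1.
      by rewrite -[RHS]opp2; apply/eqP; rewrite -addr_eq0 -addrA -etaE z.
    by rewrite !expr1n; ring.
  have -> : \sum_(x <- fixs W Q) (size (conj_pairs Q (trace_pol Q e D eta x) (norm_pol Q e D eta x)))%:R
     = \sum_(x <- fixs W Q) (size (conj_pairs Q (trace_pol Q e D eta x) (cc x ^+ 2)))%:R :> int.
    by apply: eq_bigr => x _; rewrite nE.
  apply: (@sum_conj_pairs_even _ _ A C e x0 k (1 + D)) => //.
  - by move=> x xQ; apply: trace_pol_fixed.
  - move=> x xQ; rewrite /cc exprMn dQ exprAC exprMn !exprDn_pchar // xQ eta2.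
    by congr (_ * _ ^+ _); rewrite mulrC.
  - by move=> x _; rewrite tpE AE.
  - move=> x _ Ax; rewrite tpE -AE ccE.
    have -> : C.[x] = k * (x ^+ h + x + (N + c')) by rewrite !(hornerE, horner_exp).
    have -> : x ^+ e + x ^+ h + N = A.[x] + (x ^+ h + x + (N + c')).
      by rewrite AE -[LHS]addr0 -[LHS]addr0 -{1}(add2 x) -(add2 c'); ring.
    by rewrite /k; field; rewrite D1n Ax.
  - by rewrite monicE lead_coefDl // lead_coefXn.
  - by rewrite size_polyDl // size_polyXn.
  - by rewrite !(finvD, finvXn, finvX, finvC).
  - exact: ltnW.
  - have h1 : (h < e)%N by rewrite eh muln2 -addnn -{1}[h]addn0 ltn_add2l expn_gt0.
    rewrite size_CM_leq // !size_polyD_leq ?size_polyXn ?size_polyX //.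
    by rewrite (leq_trans (size_polyC_leq1 _)) // ltnW.
  - have NcQ : (N + c') ^+ Q = N + c' by rewrite exprDn_pchar // NQ c'Q.
    by rewrite /C !(finvD, finvM, finvXn, finvX, finvC).
  - by rewrite AE expr0n en add0r add0r.
  - by move=> t _; rewrite !derivD dXe derivX derivC add0r addr0 hornerC oner_neq0.
  have -> : C.[x0] = k * ((x0 + eta) * (x0 + eta ^+ Q)) ^+ h.
    have := ccE x0; rewrite /cc => /(mulfI d0) ->.
    rewrite !(hornerE, horner_exp); congr (_ * _).
    apply/eqP; rewrite -subr_eq0 opp2; apply/eqP; rewrite -[RHS](rootP rx0) AE.
    by rewrite -[RHS]addr0 -(add2 (x0 ^+ h + N)) /=; ring.
  by rewrite mulf_neq0 // expf_neq0 // mulf_neq0.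
pose A : {poly W} := 'X^(e.-1) + 1%:P.
have sX : (size (1%:P : {poly W}) < size ('X^(e.-1) : {poly W}))%N.
  by rewrite size_polyXn ltnS size_polyC oner_neq0.
have AE x : A.[x] = x ^+ e.-1 + 1 by rewrite !(hornerE, horner_exp).
have [x0 rx0] : exists x0, root A x0.
  by apply/closed_rootP; rewrite size_polyDl // size_polyXn eqSS gtn_eqF.
have detE j : det_pol Q e D eta j = (1 + D) * A.[j].
  by rewrite /det_pol kap expr1n mulr1 AE !opp2 mulrDr mulr1.
have -> : \sum_(j <- fixs W Q) (size (conj_pairs Q (det_pol Q e D eta j) D))%:R
     = \sum_(j <- fixs W Q) (size (conj_pairs Q (det_pol Q e D eta j) (d ^+ 2)))%:R :> int.
  by rewrite ed.
apply: (@sum_conj_pairs_even _ (fun=> d) A k%:P e.-1 x0 0 (1 + D)) => //.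
- by move=> j jQ; rewrite detE exprMn DQ2 AE exprDn_pchar // expr1n exprAC jQ.
- by move=> j _ Aj; rewrite detE hornerC add0r /k; field; rewrite D1n Aj.
- by rewrite expr0n; case: (Q) Q1.
- by rewrite monicE lead_coefDl // lead_coefXn.
- by rewrite size_polyDl // size_polyXn.
- by rewrite !(finvD, finvXn, finvX, finvC) ?expr1n.
- exact: leq_trans (size_polyC_leq1 _) _.
- exact: finvC.
- by rewrite AE expr0n gtn_eqF // add0r oner_neq0.
- move=> t rt; rewrite derivD derivC addr0 derivXn hornerMn hornerXn -mulr_natl.
  rewrite mulf_neq0 ?expf_neq0 //.
    apply/eqP => z; have := pnat_natr0 he e1; rewrite -(prednK (ltnW e1)) -natr1 z add0r.
    by apply/eqP; rewrite oner_neq0.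
  by apply: contraTneq rt => ->; rewrite /root AE expr0n gtn_eqF // add0r oner_neq0.
by rewrite hornerC.
Qed.
End EvenSums.

(** * The numerical contradiction *)

(** The crude estimate 4 q^(2 s + 2) <= q^(4 s + 1) fails only for [s = 1] and [q] equal to 2 or 3;
    there the exact values are 25 <= 32 and 196 <= 243. *)
Lemma genus_bound (q s : nat) : (1 < q)%N -> (0 < s)%N ->
  ((2 * q ^ s * q - q - 1) ^ 2 <= q ^ (4 * s + 1))%N.
Proof.
move=> q1; case: s => [//|[_|s _]].
  rewrite expn1 muln1; have [q4|] := leqP 4 q.
    apply: (@leq_trans ((2 * q * q) ^ 2)); first by rewrite leq_sqr -subnDA leq_subr.
    by rewrite (_ : q ^ (4 + 1) = q * (q * q) ^ 2)%N; [move: q4; clear; nia | rewrite expnD; ring].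
  by case: q q1 => [|[|[|[|]]]].
apply: (@leq_trans ((2 * q ^ s.+2 * q) ^ 2)); first by rewrite leq_sqr -subnDA leq_subr.
have -> : (q ^ (4 * s.+2 + 1) = (q ^ s.+2) ^ 4 * q)%N by rewrite -expnM mulnC expnD expn1 [(s.+2 * 4)%N]mulnC.
have : (q ^ 2 <= q ^ s.+2)%N by rewrite leq_exp2l.
move: (q ^ s.+2)%N => x xq; have x4 : (4 * q <= x ^ 2)%N.
  apply: (@leq_trans ((q ^ 2) ^ 2)); last by rewrite leq_sqr.
  have : (2 * q <= q ^ 2)%N by rewrite -mulnn leq_mul2r q1 orbT.
  by move=> h; rewrite -[((q ^ 2) ^ 2)%N]mulnn (leq_trans _ (leq_mul h h)) //; move: q1; clear; nia.
have -> : ((2 * x * q) ^ 2 = x ^ 2 * q * (4 * q))%N by ring.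
by rewrite (_ : x ^ 4 * q = x ^ 2 * q * x ^ 2)%N; [rewrite leq_mul2l x4 orbT | ring].
Qed.

(** The count forces T >= Q - (q - 1), while |T| <= c sqrt Q. As sqrt Q >= c + 1 and c >= q - 1, the
    difference Q - c sqrt Q is at least c + 1, too large. Everything is squared so as to remain in
    the integers. *)
Lemma numeric_contradiction (q e Q S1 S2 N1 N2 : int) :
  2 <= q -> q <= e -> (2 * e * q - q - 1) ^+ 2 <= Q ->
  S1 ^+ 2 <= (2 * e - 1) ^+ 2 * Q -> S2 ^+ 2 <= (2 * e - 3) ^+ 2 * Q ->
  Q - S1 <= N1 -> Q - S2 <= N2 -> (q - 1) * N1 + N2 <= (q - 1) * (Q + 1) -> False.
Proof.
move=> q2 qe cQ b1 b2 n1 n2 tot.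
pose a := 2 * e - 1; pose b := 2 * e - 3; pose c := 2 * e * q - q - 2.
pose T := (q - 1) * S1 + S2.
have a0 : 0 < a by rewrite /a; move: q2 qe; clear; lia.
have b0 : 0 < b by rewrite /b; move: q2 qe; clear; lia.
have c0 : q - 1 <= c by rewrite /c; move: q2 qe; clear; nia.
have Q0 : 0 <= Q by apply: le_trans cQ; rewrite sqr_ge0.
(* The mixed term is controlled by (b S1 - a S2)^2 >= 0. *)
have ab : S1 * S2 <= a * b * Q.
  have h1 : b ^+ 2 * S1 ^+ 2 <= b ^+ 2 * (a ^+ 2 * Q) by rewrite ler_wpM2l ?sqr_ge0.
  have h2 : a ^+ 2 * S2 ^+ 2 <= a ^+ 2 * (b ^+ 2 * Q) by rewrite ler_wpM2l ?sqr_ge0.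
  have h3 := sqr_ge0 (b * S1 - a * S2).
  have ab2 : 0 < 2 * (a * b) by rewrite !mulr_gt0.
  rewrite -(ler_pM2l ab2) -subr_ge0.
  have : 0 <= (b ^+ 2 * (a ^+ 2 * Q) - b ^+ 2 * S1 ^+ 2) + (a ^+ 2 * (b ^+ 2 * Q) - a ^+ 2 * S2 ^+ 2)
     + (b * S1 - a * S2) ^+ 2 by apply: addr_ge0 h3; apply: addr_ge0; rewrite subr_ge0.
  by congr (0 <= _); ring.
have q10 : 0 <= q - 1 by rewrite subr_ge0; move: q2; clear; lia.
have T2 : T ^+ 2 <= c ^+ 2 * Q.
  have h1 : (q - 1) ^+ 2 * S1 ^+ 2 <= (q - 1) ^+ 2 * (a ^+ 2 * Q) by rewrite ler_wpM2l ?sqr_ge0.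
  have h2 : 2 * (q - 1) * (S1 * S2) <= 2 * (q - 1) * (a * b * Q) by rewrite ler_wpM2l ?mulr_ge0.
  have -> : T ^+ 2 = (q - 1) ^+ 2 * S1 ^+ 2 + 2 * (q - 1) * (S1 * S2) + S2 ^+ 2 by rewrite /T; ring.
  have -> : c ^+ 2 * Q = (q - 1) ^+ 2 * (a ^+ 2 * Q) + 2 * (q - 1) * (a * b * Q) + b ^+ 2 * Q.
    by rewrite /c /a /b; ring.
  by rewrite !lerD.
have TQ : Q - (q - 1) <= T.
  have h : (q - 1) * (Q - S1) <= (q - 1) * N1 by rewrite ler_wpM2l.
  have {}h : (q - 1) * (Q - S1) + (Q - S2) <= (q - 1) * (Q + 1).
    by apply: le_trans tot; rewrite lerD.
  have -> : T = (q - 1) * Q + Q - ((q - 1) * (Q - S1) + (Q - S2)) by rewrite /T; ring.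
  by move: h; move: ((q - 1) * (Q - S1)) => t; clear; lia.
have cQ' : c ^+ 2 + 2 * c + 1 <= Q by apply: le_trans cQ; rewrite /c le_eqVlt; apply/orP; left; apply/eqP; ring.
have c2 : 0 <= c ^+ 2 by apply: sqr_ge0.
have Qq : 0 <= Q - (q - 1) by move: c0 c2 cQ' q10; move: (c) => t; move: (t ^+ 2) => u; clear; lia.
have : (Q - (q - 1)) ^+ 2 <= T ^+ 2 by rewrite ler_sqr ?nnegrE // (le_trans Qq).
move/le_trans/(_ T2).
have h : c ^+ 2 * Q <= (Q - (2 * c + 1)) * Q by rewrite ler_wpM2r //; move: cQ'; move: (c) => t; move: (t ^+ 2) => u; clear; lia.
move/le_trans/(_ h) => {}h.
have : (q - 1) * Q <= c * Q by rewrite ler_wpM2r.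
have : 1 <= (q - 1) ^+ 2 by move: q2; clear; nia.
have e1 : (Q - (q - 1)) ^+ 2 = Q * Q - 2 * ((q - 1) * Q) + (q - 1) ^+ 2 by ring.
have e2 : (Q - (2 * c + 1)) * Q = Q * Q - 2 * (c * Q) - Q by ring.
move: h; rewrite e1 e2.
move: ((q - 1) * Q) (c * Q) (Q * Q) ((q - 1) ^+ 2) Q0; clear; lia.
Qed.

(** * From the count to a pair of points *)

Lemma coprime_fixed (R : nzRingType) (q n s : nat) (x : R) : (0 < n)%N -> coprime n s ->
  x ^+ (q ^ n) = x -> x ^+ (q ^ s) = x -> x ^+ q = x.
Proof.
move=> n0 cop xn xs; have [u v euv _] := egcdnP s n0.
have {}euv : (u * n = v * s + 1)%N by rewrite euv (eqP cop).
have xu : x ^+ (q ^ (u * n)) = x by rewrite mulnC expnM (expfix _ xn).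
have xv : x ^+ (q ^ (v * s)) = x by rewrite mulnC expnM (expfix _ xs).
by rewrite -[RHS]xu euv expnD expn1 exprM xv.
Qed.

Lemma exists_weight_two (W : closedFieldType) (p a n s : nat) (D : W) :
  let q := (p ^ a)%N in let Q := (q ^ n)%N in
  p \in [pchar W] -> (0 < a)%N -> (0 < s)%N -> coprime n s -> (4 * s + 1 <= n)%N ->
  D ^+ Q = D -> D != 0 -> D != 1 ->
  exists rho m b, weight_two_witness Q (q ^ s) D rho m b.
Proof.
move=> q Q hp a0 s0 cop ns DQ D0 D1; set e := (q ^ s)%N.
have pp : prime p := pcharf_prime hp.
have n0 : (0 < n)%N by apply: leq_trans ns; rewrite addn1.
have q1 : (1 < q)%N by rewrite /q -(expn0 p) ltn_exp2l ?prime_gt1.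
have Q1 : (1 < Q)%N by rewrite /Q -(expn0 q) ltn_exp2l.
have e1 : (1 < e)%N by rewrite /e -(expn0 q) ltn_exp2l.
have hpn k : [pchar W].-nat (p ^ k)%N.
  by rewrite pnatX pnatE // hp.
have hq : [pchar W].-nat q := hpn a.
have hQ : [pchar W].-nat Q by rewrite /Q /q -expnM.
have he : [pchar W].-nat e by rewrite /e /q -expnM.
have Q21 : (1 < Q ^ 2)%N by rewrite -(expn0 Q) ltn_exp2l.
(* All entries of a witness lie in F_(Q^2); a search through this finite list makes existence a
   boolean, which permits the argument by contradiction. *)
pose F2 := fixs W (Q ^ 2).
pose ok rho m b := [&& rho * rho ^+ Q == D, m ^+ Q ^+ Q == m & m ^+ Q != m] &&
  [&& b ^+ Q == b, b != 0 & m ^+ e + rho * m ^+ Q ^+ e == b ^+ e.-1 * m * (1 + rho)].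
have okP rho m b : reflect (weight_two_witness Q e D rho m b) (ok rho m b).
  apply: (iffP andP) => [[/and3P[/eqP ? /eqP ? ?] /and3P[/eqP ? ? /eqP ?]]|[[? ? ?] [? ? ?]]] //.
  by split; apply/and3P; split => //; apply/eqP.
have [/hasP[rho _ /hasP[m _ /hasP[b _ /okP w]]]|no] :=
    boolP (has (fun rho => has (fun m => has (ok rho m) F2) F2) F2).
  by exists rho, m, b.
have none rho m b : ~ weight_two_witness Q e D rho m b.
  move=> w; have [[rr mm _] [bb _ _]] := w; case/negP: no; apply/hasP; exists rho.
    have rn : rho != 0 by apply: contraNneq D0 => z; rewrite -rr z mul0r.
    rewrite mem_fixs //; apply/eqP/(mulfI (expf_neq0 Q rn)).
    by rewrite -mulnn exprM -exprMn rr DQ -rr mulrC.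
  apply/hasP; exists m; first by rewrite mem_fixs // -mulnn exprM mm.
  by apply/hasP; exists b; [rewrite mem_fixs // -mulnn exprM !bb | apply/okP].
have fixq (j : W) : j ^+ Q = j -> j ^+ e = j -> j ^+ q = j by apply: coprime_fixed.
have qe : (q <= e)%N by rewrite /e -[X in (X <= _)%N]expn1 leq_exp2l.
have cQ : ((2 * e * q - q - 1) ^ 2 <= Q)%N.
  by apply: leq_trans (genus_bound q1 s0) _; rewrite leq_exp2l.
have eQ : (e < Q)%N by rewrite ltn_exp2l //; move: ns; clear; lia.
have [eta [eta2 etaQ [S1 h1 b1] [S2 h2 b2]]] : exists eta : W,
    [/\ eta ^+ Q ^+ Q = eta, eta ^+ Q != eta,
      exists2 S : int, Q%:R - S <= \sum_(r <- fixs W Q)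
            (size (conj_pairs Q (trace_pol Q e D eta r) (norm_pol Q e D eta r)))%:R &
        S ^+ 2 <= ((2 * e).-1 ^ 2 * Q)%N%:R
    & exists2 S : int, Q%:R - S <= \sum_(j <- fixs W Q)
            (size (conj_pairs Q (det_pol Q e D eta j) D))%:R &
        S ^+ 2 <= ((2 * e.-1).-1 ^ 2 * Q)%N%:R].
  have [p2|op] := even_prime pp; last first.
    by apply: trace_norm_sums_odd => //; rewrite /Q /e /q !oddX op !orbT.
  have eE : e = (2 ^ (a * s).-1.+1)%N.
    by rewrite prednK ?muln_gt0 ?a0 // /e /q p2 expnM.
  have QE : Q = (2 ^ (a * n))%N by rewrite /Q /q p2 expnM.
  have h2 : 2 \in [pchar W] by move: hp; rewrite p2.
  have := @trace_norm_sums_even W h2 (a * n)%N (a * s).-1 D.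
  by rewrite -eE -QE; apply=> //; rewrite muln_gt0 a0.
have tot := fibre_count hq q1 hQ Q1 he e1 DQ D0 D1 eta2 etaQ fixq none.
exfalso; rewrite -!natr_sum in h1 h2.
move: (\sum_(r <- _) _)%N (\sum_(r <- _) _)%N h1 h2 tot => N2 N1 h1 h2 tot.
apply: (@numeric_contradiction q%:Z e%:Z Q%:Z S1 S2 N1%:Z N2%:Z) => //.
- have -> : 2 * e%:Z * q%:Z - q%:Z - 1 = (2 * e * q - q - 1)%N%:Z.
    by move: q1 qe; clear; nia.
  by rewrite -!natz -natrX ler_nat.
- apply: le_trans b1 _; have -> : 2 * e%:Z - 1 = (2 * e).-1%N%:Z by move: e1; clear; lia.
  by rewrite natrM natrX !natz.
- apply: le_trans b2 _; have -> : 2 * e%:Z - 3 = (2 * e.-1).-1%N%:Z by move: e1; clear; lia.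
  by rewrite natrM natrX !natz.
- by rewrite !natz in h1.
- by rewrite !natz in h2.
- move: tot; rewrite -lez_nat !PoszD !PoszM; have -> : q.-1%:Z = q%:Z - 1 by move: q1; clear; lia.
  by rewrite intS [1 + _]addrC.
Qed.

(* The value of [x |-> x ^+ e + delta * x ^+ (Q * e)] is proportional to [x] with
   the same factor at both points, which are independent over the fixed field of
   [x |-> x ^+ Q]. *)
Definition weight_two_pair (R : nzRingType) (Q e : nat) (delta x1 x2 : R) :=
  [/\ x2 != 0, x1 * x2 ^+ Q != x1 ^+ Q * x2 &
   (x1 ^+ e + delta * x1 ^+ (Q * e)) * x2 = (x2 ^+ e + delta * x2 ^+ (Q * e)) * x1].

Lemma weight_two_pair_of_witness (W : closedFieldType) (Q e : nat) (delta rho m b : W) :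
  [pchar W].-nat Q -> (1 < Q)%N -> [pchar W].-nat e -> (0 < e)%N ->
  delta ^+ (Q ^ 2) = delta -> delta != 0 ->
  weight_two_witness Q e (delta ^+ (Q + 1)) rho m b ->
  exists x1 x2, [/\ weight_two_pair Q e delta x1 x2,
    x1 ^+ (Q ^ 2) = x1 & x2 ^+ (Q ^ 2) = x2].
Proof.
move=> hQ Q1 he e0 dQ d0 [[rr mm mQ] [bb b0 E]].
have rn : rho != 0 by apply: contraNneq (expf_neq0 (Q + 1) d0) => z; rewrite -rr z mul0r.
(* Hilbert 90 in disguise: [rho] and [delta] have the same norm, so [rho / delta] has norm 1 and [y]
   lies in F_(Q^2). *)
have [y ey] : exists y : W, y ^+ (Q.-1 * e) = rho / delta.
  by apply: closed_nth_root; rewrite muln_gt0 e0 andbT; case: (Q) Q1 => [|[]].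
have y0 : y != 0.
  apply: contraTneq (mulf_neq0 rn (invr_neq0 d0)) => y0.
  by rewrite -ey y0 expr0n muln_eq0; case: (Q) (e) Q1 e0 => [|[|?]] [|?] //; rewrite eqxx.
have yQe : delta * y ^+ (Q * e) = rho * y ^+ e.
  have -> : (Q * e = Q.-1 * e + e)%N by rewrite -mulSnr prednK // ltnW.
  by rewrite exprD ey mulrA mulrCA divff // mulr1.
have yy : y ^+ (Q ^ 2) = y.
  apply: (exprp_inj he) => /=; have : y ^+ (Q.-1 * e) ^+ Q.+1 = 1.
    rewrite ey expr_div_n [rho ^+ _]exprS rr addn1 divff //.
    by rewrite expf_neq0.
  rewrite -exprM mulnAC mulnC -(subn1 Q) -(addn1 Q) -subn_sqr exp1n => h.
  have -> : (Q ^ 2 = (Q ^ 2 - 1) + 1)%N by rewrite subnK // expn_gt0 ltnW.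
  by rewrite addn1 exprS exprMn -exprM mulnC h mulr1.
exists (m * y), (b * y); split; last 2 first.
- by rewrite exprMn yy -mulnn exprM mm.
- by rewrite exprMn yy -mulnn exprM !bb.
split; first by rewrite mulf_neq0.
  rewrite !exprMn bb; apply: contra mQ => /eqP h.
  have nz : y * b * y ^+ Q != 0 by rewrite !mulf_neq0 ?expf_neq0.
  apply/eqP/(mulIf nz); have -> : m * (y * b * y ^+ Q) = m * y * (b * y ^+ Q) by ring.
  by rewrite h; ring.
have g z : (z * y) ^+ e + delta * (z * y) ^+ (Q * e) = y ^+ e * (z ^+ e + rho * z ^+ Q ^+ e).
  by rewrite !exprMn mulrCA yQe [z ^+ (Q * e)]exprM; ring.
rewrite !g E bb; have -> : b ^+ e = b * b ^+ e.-1 by rewrite -exprS prednK.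
by ring.
Qed.

Lemma finField_weight_two (E : finFieldType) (p a n s : nat) (delta : E) :
  let q := (p ^ a)%N in let Q := (q ^ n)%N in
  #|E| = (q ^ (2 * n))%N -> p \in [pchar E] -> (0 < a)%N -> (0 < s)%N -> coprime n s ->
  (4 * s + 1 <= n)%N -> delta != 0 -> delta ^+ (Q + 1) != 1 ->
  exists x1 x2 : E, weight_two_pair Q (q ^ s) delta x1 x2.
Proof.
move=> q Q cE hp a0 s0 cop ns d0 d1.
have {}cE : #|E| = (Q ^ 2)%N by rewrite cE mulnC expnM.
have [W [iota _]] := countable_algebraic_closure E.
have hpW : p \in [pchar W] by rewrite (fmorph_pchar iota).
have pp : prime p := pcharf_prime hp.
have n0 : (0 < n)%N by apply: leq_trans ns; rewrite addn1.
have q1 : (1 < q)%N by rewrite /q -(expn0 p) ltn_exp2l ?prime_gt1.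
have Q1 : (1 < Q)%N by rewrite /Q -(expn0 q) ltn_exp2l.
have hpn k : [pchar W].-nat (p ^ k)%N by rewrite pnatX pnatE // hpW.
have hQ : [pchar W].-nat Q by rewrite /Q /q -expnM.
have he : [pchar W].-nat (q ^ s)%N by rewrite /q -expnM.
have dQ : iota delta ^+ (Q ^ 2) = iota delta by rewrite -rmorphXn -cE expf_card.
have DQ : (iota delta ^+ (Q + 1)) ^+ Q = iota delta ^+ (Q + 1).
  by rewrite -exprM mulnDl mul1n mulnn exprD dQ mulrC exprD expr1.
have D0 : iota delta ^+ (Q + 1) != 0 by rewrite expf_neq0 // fmorph_eq0.
have D1 : iota delta ^+ (Q + 1) != 1 by rewrite -rmorphXn fmorph_eq1.
have [rho [m [b w]]] := exists_weight_two hpW a0 s0 cop ns DQ D0 D1.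
have [||x1 [x2 [[z2 ind pr] f1 f2]]] := weight_two_pair_of_witness hQ Q1 he _ dQ _ w.
- by rewrite expn_gt0 ltnW.
- by rewrite fmorph_eq0.
(* The polynomial X^|E| - X already splits over [E], so the points found in the closure descend to
   [E]. *)
have im x : x ^+ (Q ^ 2) = x -> exists y, x = iota y.
  move=> xx; have : root (map_poly iota ('X^#|E| - 'X)) x.
    by rewrite rmorphB /= map_polyXn map_polyX /root !hornerE cE xx subrr.
  rewrite finField_genPoly rmorph_prod /root horner_prod => /prodf_eq0[y _].
  by rewrite /= rmorphB /= map_polyX map_polyC !hornerE subr_eq0 => /eqP ->; exists y.
have [y1 e1] := im _ f1; have [y2 e2] := im _ f2; exists y1, y2; split.
- by rewrite -(fmorph_eq0 iota) -e2.
- apply: contra ind => /eqP h; rewrite e1 e2 -!rmorphXn -!rmorphM; exact/eqP/congr1.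
- by apply: (fmorph_inj iota); rewrite !(rmorphM, rmorphD, rmorphXn) /= -e1 -e2.
Qed.

(** * The kernel in the original extension *)

Lemma card_finvect (K : finFieldType) (L : fieldExtType K) :
  #|finvect_type L| = (#|K| ^ \dim {:L})%N.
Proof. by rewrite -(@card_vspace K (finvect_type L)) card_vspacef. Qed.

Section Transfer.
Variables (K : finFieldType) (L : fieldExtType K) (n s : nat) (delta : L).
Let q := #|K|.
Let Q := (q ^ n)%N.
Let e := (q ^ s)%N.
Hypotheses (dimL : \dim {:L} = (2 * n)%N) (n0 : (0 < n)%N) (cop : coprime n s).
Hypotheses (d0 : delta != 0) (d1 : delta ^+ (Q + 1) != 1).

Let g (x : L) := x ^+ e + delta * x ^+ (Q * e).

Let q_gt1 : (1 < q)%N. Proof. exact: finNzRing_gt1. Qed.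

Let hq : [pchar L].-nat q.
Proof.
have [p pp hp] := finPcharP K; have := card_pprimeChar hp; rewrite -/q => qE.
have qE' : q = (p ^ logn p q)%N := qE; rewrite qE' pnatX pnatE // orbC.
by rewrite (fmorph_pchar (in_alg L)) hp orbT.
Qed.
Let hQ : [pchar L].-nat Q. Proof. by rewrite pnatX hq. Qed.
Let he : [pchar L].-nat e. Proof. by rewrite pnatX hq. Qed.
Let Qe : [pchar L].-nat (Q * e)%N. Proof. by rewrite pnatM hQ he. Qed.

Let fixQ2 (x : L) : x ^+ Q ^+ Q = x.
Proof.
have := memvf x; rewrite Fermat's_little_theorem dimL => /eqP {2}<-.
by rewrite -exprM mulnn -expnM mulnC.
Qed.

Let scalar_fixed (k : K) : k ^+ q = k. Proof. exact: expf_card. Qed.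

Lemma fabsE a (x : L) : fabs q n s a (delta * a) x = x + a * g x.
Proof. by rewrite /fabs /g expnD mulrDr addrA; congr (_ + _); ring. Qed.

Lemma weight_map_lin (k l : K) (x y : L) : g (k *: x + l *: y) = k *: g x + l *: g y.
Proof.
have kk m : k ^+ (q ^ m) = k by apply: expfix.
have ll m : l ^+ (q ^ m) = l by apply: expfix.
rewrite /g !exprDn_pchar // !exprZn !exprM !kk !ll !scalerDr mulrDr -!scalerAr.
by rewrite addrACA.
Qed.

(** A zero would give [delta] as minus a quotient of conjugates, whose norm is 1 in every
    characteristic. *)
Lemma weight_map_neq0 (x : L) : x != 0 -> g x != 0.
Proof.
move=> x0; apply: contra d1; rewrite /g addrC addr_eq0 => /eqP h.
have nz : x ^+ e ^+ (Q + 1) != 0 by rewrite !expf_neq0.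
apply/eqP/(mulIf nz); rewrite mul1r.
have -> : x ^+ e ^+ (Q + 1) = (x ^+ (Q * e)) ^+ (Q + 1).
  rewrite exprM [x ^+ Q ^+ e]exprAC [LHS]exprD [RHS]exprD !expr1.
  by rewrite [x ^+ e ^+ Q ^+ Q]fixQ2 mulrC.
rewrite -exprMn h exprD exprNn_pcharW // expr1 mulrNN -exprSr.
rewrite exprM [x ^+ Q ^+ e]exprAC !addn1 exprSr [RHS]exprSr.
by rewrite [x ^+ e ^+ Q ^+ Q]fixQ2 mulrC.
Qed.

Lemma kernel_of_pair (x1 x2 : L) : weight_two_pair Q e delta x1 x2 ->
  exists a : L, a != 0 /\ exists U : {vspace L},
    (forall x : L, x \in U <-> fabs q n s a (delta * a) x = 0) /\ \dim U = 2%N.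
Proof.
move=> [x20 ind pr]; have gx2 := weight_map_neq0 x20.
pose a := - x2 / g x2.
have a2 : x2 + a * g x2 = 0 by rewrite /a divfK ?subrr.
have a1 : x1 + a * g x1 = 0.
  apply: (mulIf gx2); rewrite mul0r mulrDl /a.
  have -> : - x2 / g x2 * g x1 * g x2 = - (g x1 * x2) by field.
  by rewrite pr mulrC subrr.
exists a; split; first by rewrite mulf_neq0 ?oppr_eq0 ?invr_eq0.
clearbody a.
exists (<[x1]> + <[x2]>)%VS; split=> [x|]; last first.
  have := seq1_free x2; rewrite x20 => fr.
  have : free [:: x1; x2].
    rewrite free_cons fr andbT span_seq1; apply: contra ind => /vlineP[k ->].
    by rewrite exprZn (expfix _ (scalar_fixed k)) -!scalerAl mulrC.
  by rewrite /free span_cons span_seq1 => /eqP.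
rewrite fabsE; split.
  move=> /memv_addP[_ /vlineP[k ->] [_ /vlineP[l ->] ->]].
  rewrite weight_map_lin mulrDr -!scalerAr addrACA -!scalerDr a1 a2.
  by rewrite !scaler0 addr0.
(* Coordinates by Cramer's rule for [x] and its conjugate: numerators and [dt] all change sign under
   the [Q]-power map, so the quotients are in F_Q. *)
move=> fx; pose dt := x1 * x2 ^+ Q - x1 ^+ Q * x2.
have dt0 : dt != 0 by rewrite subr_eq0.
have conj2 (u v : L) : (u * v ^+ Q - u ^+ Q * v) ^+ Q = - (u * v ^+ Q - u ^+ Q * v).
  by rewrite exprBn_pcharW // !exprMn !fixQ2 opprB.
have ratio (u v : L) : ((u * v ^+ Q - u ^+ Q * v) / dt) ^+ Q = (u * v ^+ Q - u ^+ Q * v) / dt.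
  by rewrite expr_div_n !conj2 invrN mulrNN.
pose al := (x * x2 ^+ Q - x ^+ Q * x2) / dt; pose be := (x1 * x ^+ Q - x1 ^+ Q * x) / dt.
have alQ : al ^+ Q = al := ratio _ _; have beQ : be ^+ Q = be := ratio _ _.
have ex : x = al * x1 + be * x2 by rewrite /al /be; move: dt0; rewrite /dt => h; field.
clearbody al be.
have gx : g x = al ^+ e * g x1 + be ^+ e * g x2.
  by rewrite /g ex !exprDn_pchar // !exprMn ![al ^+ (Q * e)]exprM ![be ^+ (Q * e)]exprM alQ beQ; ring.
(* Since [x1] and [x2] satisfy the kernel equation, that of [x] becomes a relation between [x1] and
   [x2] with coefficients [ga] and [ep] in F_Q; independence makes both vanish. *)
pose ga := al - al ^+ e; pose ep := be - be ^+ e.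
have rel : ga * x1 + ep * x2 = 0.
  rewrite -[RHS]fx gx ex; apply/eqP; rewrite -subr_eq0; apply/eqP.
  have -> : ga * x1 + ep * x2 - (al * x1 + be * x2 + a * (al ^+ e * g x1 + be ^+ e * g x2))
    = - (al ^+ e * (x1 + a * g x1) + be ^+ e * (x2 + a * g x2)) by rewrite /ga /ep; ring.
  by rewrite a1 a2 !mulr0 addr0 oppr0.
have gaQ : ga ^+ Q = ga by rewrite exprBn_pcharW // exprAC alQ.
have epQ : ep ^+ Q = ep by rewrite exprBn_pcharW // exprAC beQ.
have rel' : ga * x1 ^+ Q + ep * x2 ^+ Q = 0.
  by rewrite -{1}gaQ -{1}epQ -!exprMn -exprDn_pchar // rel expr0n eqn0Ngt expn_gt0 ltnW.
have ga0 : ga = 0.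
  apply: (mulIf dt0); rewrite mul0r /dt.
  have -> : ga * (x1 * x2 ^+ Q - x1 ^+ Q * x2) =
    (ga * x1 + ep * x2) * x2 ^+ Q - (ga * x1 ^+ Q + ep * x2 ^+ Q) * x2 by ring.
  by rewrite rel rel' !mul0r subrr.
have ep0 : ep = 0 by apply: (mulIf x20); rewrite mul0r -rel ga0 mul0r add0r.
have scalar (c : L) : c ^+ Q = c -> c - c ^+ e = 0 -> exists k : K, c = k%:A.
  move=> cQ /subr0_eq ce; apply/vlineP; rewrite -/(1%VS).
  rewrite Fermat's_little_theorem dimv1 expn1; apply/eqP.
  exact: coprime_fixed n0 cop cQ (esym ce).
have [k ek] := scalar _ alQ ga0; have [l el] := scalar _ beQ ep0.
rewrite ex ek el !mulr_algl; apply: memv_add; exact: memvZ (memv_line _).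
Qed.

End Transfer.

Theorem theorem1p1 (K : finFieldType) (L : fieldExtType K) (n s : nat) :
  (\dim {:L} = 2 * n)%N ->
  (0 < n)%N -> (0 < s)%N -> coprime n s ->
  (nbound #|K| s <= n)%N ->
  forall delta : L, delta != 0 -> relnorm_q2n #|K| n delta != 1 ->
  exists a : L, a != 0 /\
    exists U : {vspace L},
      (forall x : L, x \in U <-> fabs #|K| n s a (delta * a) x = 0) /\
      \dim U = 2%N.
Proof.
move=> dimL n0 s0 cop nb delta d0 d1.
have ns : (4 * s + 1 <= n)%N.
  by apply: leq_trans nb; rewrite /nbound; case: ifP; rewrite // leq_add2l.
have [p pp hp] := finPcharP K.
have qE : #|K| = (p ^ logn p #|K|)%N := card_pprimeChar hp.
have a0 : (0 < logn p #|K|)%N.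
  by have := finNzRing_gt1 K; rewrite {1}qE; case: (logn _ _).
(* [finvect_type L] is [L] with its structure of finite field, so the pair found there is a pair in
   [L]. *)
have cL : #|finvect_type L| = ((p ^ logn p #|K|) ^ (2 * n))%N by rewrite -qE card_finvect dimL.
have hpL : p \in [pchar (finvect_type L)] by rewrite (fmorph_pchar (in_alg L)).
have d1' : (delta : finvect_type L) ^+ ((p ^ logn p #|K|) ^ n + 1) != 1 by rewrite -qE.
have [x1 [x2]] := finField_weight_two cL hpL a0 s0 cop ns d0 d1'.
rewrite -qE; exact: kernel_of_pair.
Qed.
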